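(* Let $\mathbf{X}$ be an isotropic unimodal Lévy process on $\mathbb{R}^d$ with Lévy–Khintchine exponent $\psi\in\Pi^\infty_\ell$ for some $\ell\in\mathcal{R}^\infty_0$. Then \[ \lim_{x\to0,\ t\psi(|x|^{-1})\to 0}\frac{p(t,x)}{t|x|^{-d}\ell(|x|^{-1})}=\frac{\Gamma(d/2)}{2\pi^{d/2}}. \]
   Context: An isotropic unimodal Lévy process on $\mathbb{R}^d$ is a pure-jump Lévy process $\mathbf{X}=(X_t)_{t\ge0}$, $X_0=0$, with $\mathbb{E}e^{i\langle\xi,X_t\rangle}=e^{-t\psi(\xi)}$, $\psi(\xi)=\int_{\mathbb{R}^d}(1-\cos\langle\xi,x\rangle)\,\nu(\mathrm{d}x)$, where the Lévy measure $\nu$ has a radial, radially non-increasing density (also denoted $\nu$); then for each $t>0$ the law of $X_t$ restricted to $\mathbb{R}^d\setminus\{0\}$ has a radial, radially non-increasing density $p(t,x)$. Radial functions are written as functions of $|x|$, e.g. $\psi(r)$, $r\ge0$. A positive function $\ell$ on $[a,\infty)$ is slowly varying at infinity ($\ell\in\mathcal{R}^\infty_0$) if $\ell(\lambda x)/\ell(x)\to1$ as $x\to\infty$ for every $\lambda>0$. For such $\ell$, the de Haan class $\Pi^\infty_\ell$ consists of $f:[a,\infty)\to[0,\infty)$ with $\lim_{x\to\infty}(f(\lambda x)-f(x))/\ell(x)=\log\lambda$ for every $\lambda>0$. The joint limit means: for all sequences $t_n>0$, $x_n\to0$ with $t_n\psi(|x_n|^{-1})\to0$, the ratio converges to the given value.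 *)

(* Defs.v *)
From HB Require Import structures.
From mathcomp Require Import all_boot all_order all_algebra.
From mathcomp Require Import all_classical all_reals all_analysis.
Set Implicit Arguments. Unset Strict Implicit. Unset Printing Implicit Defensive.
Import Order.TTheory GRing.Theory Num.Theory.
Import numFieldNormedType.Exports.
Local Open Scope classical_set_scope.
Local Open Scope ring_scope.

(* R^d is modelled as d.-tuple R, with the product (= Borel) sigma-algebra
   provided by mathcomp-analysis. *)

Section Defs.
Context {R : realType}.

Definition dotp {d : nat} (x y : d.-tuple R) : R :=
  \sum_(i < d) tnth x i * tnth y i.
Definition enorm {d : nat} (x : d.-tuple R) : R := Num.sqrt (dotp x x).

End Defs.
Definition Rd_nonzero {R : realType} (d : nat) : set (d.-tuple R) := [set x | 0 < enorm x].
Arguments Rd_nonzero {R} d _.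
Section Defs2.
Context {R : realType}.

Definition radial_pt (d : nat) (r : R) : d.-tuple R :=
  [tuple (if val i == 0%N then r else 0) | i < d].

(* lam is Lebesgue measure on R^d: it gives closed boxes their volume
   (this characterizes Lebesgue measure on the Borel sets uniquely) *)
Definition is_lebesgue_Rd {d : nat}
    (lam : {measure set (d.-tuple R) -> \bar R}) : Prop :=
  forall a b : d.-tuple R, (forall i, tnth a i <= tnth b i) ->
    lam [set x | forall i, tnth a i <= tnth x i <= tnth b i] =
    (\prod_(i < d) (tnth b i - tnth a i))%:E.

Definition radial_nonincr {d : nat} (f : d.-tuple R -> R) : Prop :=
  (forall x, 0 < enorm x -> 0 <= f x) /\
  (forall x y, 0 < enorm x -> enorm x <= enorm y -> f y <= f x).

Definition levy_density {d : nat} (lam : {measure set (d.-tuple R) -> \bar R})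
    (nu : d.-tuple R -> R) : Prop :=
  (\int[lam]_(x in Rd_nonzero d) (Num.min 1 (enorm x ^+ 2) * nu x)%:E < +oo)%E.

Definition lk_exponent {d : nat} (lam : {measure set (d.-tuple R) -> \bar R})
    (nu : d.-tuple R -> R) (xi : d.-tuple R) : R :=
  fine (\int[lam]_(x in Rd_nonzero d) ((1 - cos (dotp xi x)) * nu x)%:E).

Definition slowly_varying (l : R -> R) : Prop :=
  (exists a : R, forall x, a <= x -> 0 < l x) /\
  forall lambda : R, 0 < lambda ->
    (l (lambda * x) / l x) @[x --> +oo] --> (1 : R).

Definition deHaan (l : R -> R) (f : R -> R) : Prop :=
  (exists a : R, forall x, a <= x -> 0 <= f x) /\
  forall lambda : R, 0 < lambda ->
    ((f (lambda * x) - f x) / l x) @[x --> +oo] --> ln lambda.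

Definition Gamma (s : R) : R :=
  fine (\int[lebesgue_measure]_(x in `]0, +oo[) (x `^ (s - 1) * expR (- x))%:E).

End Defs2.

(* Main.v *)
Require Import Defs.
From HB Require Import structures.
From mathcomp Require Import all_boot all_order all_algebra.
From mathcomp Require Import all_classical all_reals all_analysis.
From mathcomp Require Import measurable_realfun.
From mathcomp Require Import ring lra.
Import Order.TTheory GRing.Theory Num.Theory.
Import numFieldNormedType.Exports.
Local Open Scope classical_set_scope.
Local Open Scope ring_scope.
Set Implicit Arguments.
Unset Strict Implicit.
Unset Printing Implicit Defensive.

(** Averaging the characteristic function of [X_t] against Gaussians turns the
    hypothesis into the Laplace transform of [|X_t|^2 / r^2]: up to the constant
    [1 / Gamma (d / 2)] it is the integral of
    [expR (- t * psi (2 * sqrt (k * s) / r))] against the Gamma density of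
    parameter [d / 2].  A Potter-type bound for the de Haan class gives dominated
    convergence, so, with [tau = t * l (1 / r)], differences in [k] of these
    transforms divided by [tau] converge to [ln (k' / k) / 2].  Hence the law of
    [|X_t|^2 / r^2] divided by [tau], with the weight [s * exp (- s)] that makes the
    limit finite, has convergent moments in [exp (- s)], and therefore converges to
    [exp (- s) / 2 ds]; the proof of this last point uses Bernstein polynomials.
    On a thin annulus around the sphere of radius [r] the monotonicity of
    the density compares [p(t, x)] with the mass of the annulus divided by its
    volume; letting the width tend to [0] gives the limit. *)

(** * Bernstein polynomials and moment convergence *)

(** Gaussian averaging trades oscillating cosines for the positive kernel [exp (- k s)],
    [s = |X_t|^2 / r^2], so that weak convergence on a half line replaces Fourier inversion. The de
    Haan condition controls only differences of [psi], hence only differences in [k] of the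
    transforms. As [ln (k' / k) / 2] is the Frullani integral of [exp (- k s) - exp (- k' s)]
    against [ds / (2 s)], this infinite measure is the limit; convexity in [k] turns differences
    into derivatives. The [1 / 2] comes from the square root in the argument of [psi]. At [s = 1]
    the limit has density [1 / 2], and Lebesgue measure, rescaled by [r^d], has density
    [pi^(d/2) / Gamma (d/2)]; the quotient is the constant of the theorem. Lebesgue measure is given
    only by volumes of boxes. Its Gaussian integrals are computed by induction on the dimension, and
    both rotation invariance and polar coordinates are deduced from them by uniqueness in the moment
    problem on [[0, 1]]. As [l] is not assumed measurable, the uniform bounds for the de Haan class
    are drawn from continuity of [psi] by Baire's theorem. *)

Section bernstein.
Context {R : realType}.
Implicit Types (f g : nat -> R) (u c : R).

(** The value at [u] is the expectation of [f (S_N)] for a binomial variable [S_N] with [N] trials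
    of success probability [u]; the recursion conditions on one trial. [f] is sampled at integers,
    without division by [N]. *)
Fixpoint bernstein (N : nat) (f : nat -> R) : {poly R} :=
  if N is N'.+1 then
    'X * bernstein N' (fun k => f k.+1) + (1 - 'X) * bernstein N' f
  else (f 0%N)%:P.

Lemma bernsteinS N f u : (bernstein N.+1 f).[u] =
  u * (bernstein N (fun k => f k.+1)).[u] + (1 - u) * (bernstein N f).[u].
Proof. by rewrite /= !hornerE. Qed.

Lemma le_bernstein N f g u : 0 <= u <= 1 -> (forall k, f k <= g k) ->
  (bernstein N f).[u] <= (bernstein N g).[u].
Proof.
move=> /andP[u0 u1]; elim: N f g => [|N IH] f g fg; first by rewrite /= !hornerC.
rewrite !bernsteinS; apply: lerD; apply: ler_wpM2l => //; last exact: IH.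
  by apply: IH => k; exact: fg.
by rewrite subr_ge0.
Qed.

Lemma bernstein_cst N c u : (bernstein N (fun=> c)).[u] = c.
Proof.
by elim: N => [|N IH]; rewrite ?bernsteinS ?IH /= ?hornerC//; ring.
Qed.

Lemma bernstein_affine N f x y u : (bernstein N (fun k => x + y * f k)).[u] =
  x + y * (bernstein N f).[u].
Proof.
by elim: N f => [|N IH] f; rewrite ?bernsteinS ?IH /= ?hornerC//; ring.
Qed.

(** Binomial variance plus squared bias. The centre [c] must be free in the induction, because a
    success shifts it by 1. *)
Lemma bernstein_variance N c u : (bernstein N (fun k => (k%:R - c) ^+ 2)).[u] =
  N%:R * u * (1 - u) + (N%:R * u - c) ^+ 2.
Proof.
elim: N c => [|N IH] c; first by rewrite /= hornerC; ring.
rewrite bernsteinS IH.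
have -> : (fun k => (k.+1%:R - c) ^+ 2) = (fun k => (k%:R - (c - 1)) ^+ 2) :> (nat -> R).
  by apply/funext => k; rewrite -natr1; ring.
by rewrite IH -natr1; ring.
Qed.

(** Chebyshev's inequality: [q] is the probability that [S_M / M] lies between the midpoints [c] of
    [[a, a']] and [e] of [[b', b]]. A wrong decision requires a deviation of at least [dl], so [v]
    divided by [(dl M)^2] dominates the error indicator, and its expectation is at most
    [1 / (4 dl^2 M)]. *)
Lemma bernstein_separation (a a' b' b eps : R) : a < a' -> b' < b -> 0 < eps ->
  exists q : {poly R}, forall u, 0 <= u <= 1 ->
   [/\ 0 <= q.[u] <= 1, a' <= u <= b' -> 1 - eps <= q.[u]
     & ~~ (a <= u <= b) -> q.[u] <= eps].
Proof.
move=> aa' b'b eps0.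
pose c := (a + a') / 2; pose e := (b' + b) / 2.
pose dl := Num.min ((a' - a) / 2) ((b - b') / 2).
have dl0 : 0 < dl by rewrite lt_min !divr_gt0// subr_gt0.
have dl1 : dl <= (a' - a) / 2 by rewrite ge_min lexx.
have dl2 : dl <= (b - b') / 2 by rewrite ge_min lexx orbT.
have [N Nbig] : exists N : nat, (dl ^+ 2 * eps)^-1 < N.+1%:R.
  exists (Num.truncn (dl ^+ 2 * eps)^-1); exact: truncnS_gt.
pose M : R := N.+1%:R.
have M0 : 0 < M by rewrite ltr0n.
pose h (k : nat) : R := ((c * M <= k%:R) && (k%:R <= e * M))%:R.
exists (bernstein N.+1 h) => u u01.
pose v (k : nat) : R := ((k%:R - M * u) ^+ 2).
have key : (bernstein N.+1 v).[u] <= M / 4.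
  rewrite bernstein_variance -/M subrr expr0n addr0 -mulrA ler_pM2l//.
  by have := sqr_ge0 (u - 2^-1); nra.
have small : (dl * M) ^- 2 * (bernstein N.+1 v).[u] <= eps.
  rewrite mulrC ler_pdivrMr ?exprn_gt0 ?mulr_gt0//.
  apply: (le_trans key).
  move: Nbig; rewrite -/M -[X in X < _]mul1r ltr_pdivrMr; last first.
    by rewrite mulr_gt0// exprn_gt0.
  move=> Nb.
  rewrite exprMn; nra.
have far k : dl * M <= `|k%:R - M * u| -> 1 <= (dl * M) ^- 2 * v k.
  move=> H; rewrite mulrC ler_pdivlMr ?exprn_gt0 ?mulr_gt0// mul1r /v.
  by rewrite -[X in _ <= X]real_normK ?num_real// ler_sqr// nnegrE// mulr_ge0// ltW.
have vge0 k : 0 <= (dl * M) ^- 2 * v k.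
  by apply: mulr_ge0; [rewrite invr_ge0 exprn_ge0// mulr_ge0// ltW|exact: sqr_ge0].
split.
- apply/andP; split.
    by rewrite -(bernstein_cst N.+1 0 u); apply: le_bernstein => // k; rewrite /h ler0n.
  by rewrite -(bernstein_cst N.+1 1 u); apply: le_bernstein => // k; rewrite /h lern1 leq_b1.
- move=> /andP[ua ub].
  apply: (@le_trans _ _ (1 + (- (dl * M) ^- 2) * (bernstein N.+1 v).[u])).
    by rewrite mulNr lerD2l lerN2.
  rewrite -bernstein_affine; apply: le_bernstein => // k; rewrite /h.
  case: (boolP (_ && _)) => hk; first by rewrite mulNr gerBl.
  rewrite mulNr subr_le0; apply: far.
  move: hk; rewrite negb_and -!ltNge => /orP[] hk.
    rewrite ler0_norm; last by rewrite /c in hk; nra.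
    by rewrite /c in hk; nra.
  rewrite ger0_norm; last by rewrite /e in hk; nra.
  by rewrite /e in hk; nra.
- move=> uab.
  apply: (le_trans _ small).
  rewrite -[leRHS]add0r -bernstein_affine; apply: le_bernstein => // k; rewrite /h add0r.
  case: (boolP (_ && _)) => // /andP[h1 h2]; apply: far.
  move: uab; rewrite negb_and -!ltNge => /orP[] hk.
    rewrite ger0_norm; last by rewrite /c in h1; nra.
    by rewrite /c in h1; nra.
  rewrite ler0_norm; last by rewrite /e in h2; nra.
  by rewrite /e in h2; nra.
Qed.

End bernstein.

(** * Measures given by a density *)

Section weighted_measure.
Context d (T : measurableType d) (R : realType).
Variables (mu : {measure set T -> \bar R}) (w : T -> R).
Hypotheses (mw : measurable_fun setT w) (w0 : forall x, 0 <= w x).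

(** Both proofs are part of the term, so that the measure structure declared below can be inferred
    from it. *)
Definition wmeasure of measurable_fun setT w & (forall x, 0 <= w x) :=
  fun A : set T => (\int[mu]_(x in A) (w x)%:E)%E.

Local Notation wm := (wmeasure mw w0).

Let wm0 : wm set0 = 0%E.
Proof. by rewrite /wmeasure integral_set0. Qed.

Let wm_ge0 A : (0 <= wm A)%E.
Proof. by apply: integral_ge0 => x _; rewrite lee_fin. Qed.

Let wm_sigma_additive : semi_sigma_additive wm.
Proof.
move=> /= A mA tA mUA; rewrite /wmeasure ge0_integral_bigcup//.
- by apply: is_cvg_ereal_nneg_natsum_cond => n _ _; exact: wm_ge0.
- by apply: measurable_funTS; apply/measurable_EFinP.
- by move=> x _; rewrite lee_fin.
Qed.

HB.instance Definition _ := isMeasure.Build _ _ _ wm wm0 wm_ge0 wm_sigma_additive.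

Import HBNNSimple.

Lemma ge0_integral_wmeasure (f : T -> \bar R) : measurable_fun setT f ->
  (forall x, 0 <= f x)%E ->
  (\int[wm]_x f x = \int[mu]_x (f x * (w x)%:E))%E.
Proof.
move=> mf f0.
pose f_ := nnsfun_approx measurableT mf.
have f_w n x : (0 <= (f_ n x)%:E * (w x)%:E)%E by rewrite mule_ge0// lee_fin.
have mf_w n : measurable_fun setT (fun x => (f_ n x)%:E * (w x)%:E)%E.
  by apply: emeasurable_funM; apply/measurable_EFinP => //; exact: measurable_funP.
transitivity (limn (fun n => \int[wm]_x (f_ n x)%:E)%E).
  rewrite -monotone_convergence//.
  - by apply: eq_integral => y _; apply/esym/cvg_lim => //; exact: cvg_nnsfun_approx.
  - by move=> n; exact/measurable_EFinP/measurable_funP.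
  - by move=> n y _; rewrite lee_fin.
  - by move=> y _ m n mn; rewrite lee_fin; exact/lefP/nd_nnsfun_approx.
rewrite [X in limn X](_ : _ =
    (fun n => \int[mu]_x ((f_ n x)%:E * (w x)%:E))%E).
  rewrite -monotone_convergence//.
  - apply: eq_integral => x _ /=; apply/cvg_lim => //.
    by apply: cvgeZr => //; exact: cvg_nnsfun_approx.
  - by move=> x _ m n mn; rewrite lee_wpmul2r ?lee_fin//; exact/lefP/nd_nnsfun_approx.
apply/funext => n.
transitivity (\sum_(k \in range (f_ n))
    \int[mu]_x ((k * \1_(f_ n @^-1` [set k]) x)%:E * (w x)%:E))%E.
  under eq_integral do rewrite fimfunE -fsumEFin//.
  rewrite ge0_integral_fsum//; last 2 first.
  - by move=> y; exact/measurable_EFinP/measurable_funM.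
  - by move=> y x _; rewrite nnfun_muleindic_ge0.
  apply: eq_fsbigr => r _; rewrite integralZl_indic_nnsfun// integral_indic//= setIT.
  have [r0|r0] := ltP r 0.
    rewrite preimage_nnfun0// measure0 mule0 integral0_eq// => x _.
    by rewrite indic0 mulr0 mul0e.
  under eq_integral do rewrite EFinM -muleA.
  rewrite ge0_integralZl//.
  - congr *%E; rewrite /wmeasure [LHS]integral_mkcond; apply: eq_integral => x _.
    by rewrite epatch_indic/= muleC.
  - by apply: emeasurable_funM; apply/measurable_EFinP.
  - by move=> x _; rewrite mule_ge0// lee_fin.
rewrite -ge0_integral_fsum//.
- apply: eq_integral => x _.
  rewrite -ge0_mule_fsuml; first by rewrite fsumEFin// -fimfunE.
  by move=> r; rewrite nnfun_muleindic_ge0.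
- by move=> r; apply: emeasurable_funM; apply/measurable_EFinP => //; exact: measurable_funM.
- by move=> r x _; rewrite mule_ge0// ?nnfun_muleindic_ge0// lee_fin.
Qed.

End weighted_measure.

(** * The Hausdorff moment problem: convergence and uniqueness *)

Section moments.
Context {R : realType}.

Section one_measure.
Context d (T : measurableType d) (M : {measure set T -> \bar R}) (phi : T -> R).
Hypotheses (Mfin : (M setT < +oo)%E) (mphi : measurable_fun setT phi).
Hypothesis phi01 : forall x, 0 <= phi x <= 1.

Definition moment_of (k : nat) : R := \int[M]_x (phi x ^+ k).

Lemma measurable_horner (q : {poly R}) : measurable_fun setT (fun x => q.[phi x]).
Proof.
apply: (@measurableT_comp _ _ _ _ _ _ (fun u => q.[u])) => //.
apply: continuous_measurable_fun => x.
exact: (@continuous_horner R q).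
Qed.

Lemma integrable_bounded01 (f : T -> R) (B : R) : measurable_fun setT f ->
  (forall x, `|f x| <= B) -> M.-integrable setT (EFin \o f).
Proof.
move=> mf fB; apply: measurable_bounded_integrable => //.
exists B; split; first exact: num_real.
by move=> y By x _ /=; apply: (le_trans (fB x)); exact: ltW.
Qed.

Lemma integrable_phiX k : M.-integrable setT (EFin \o (fun x => phi x ^+ k)).
Proof.
apply: (@integrable_bounded01 _ 1); first exact: measurable_funX.
by move=> x; have /andP[p0 p1] := phi01 x; rewrite ger0_norm ?exprn_ge0// exprn_ile1.
Qed.

Lemma integrable_phi_horner (q : {poly R}) :
  M.-integrable setT (EFin \o (fun x => q.[phi x])).
Proof.
apply: (@integrable_bounded01 _ (\sum_(i < size q) `|q`_i|)); first exact: measurable_horner.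
move=> x; have /andP[p0 p1] := phi01 x.
rewrite horner_coef; apply: (le_trans (ler_norm_sum _ _ _)); apply: ler_sum => i _.
by rewrite normrM ler_piMr// ger0_norm ?exprn_ge0// exprn_ile1.
Qed.

Lemma Rintegral_horner (q : {poly R}) :
  \int[M]_x q.[phi x] = \sum_(i < size q) q`_i * moment_of i.
Proof.
rewrite /Rintegral.
under eq_integral do rewrite horner_coef -sumEFin.
have iq i : M.-integrable setT (fun x => (q`_i * phi x ^+ i)%:E).
  under eq_fun do rewrite EFinM.
  by apply: integrableZl => //; exact: integrable_phiX.
rewrite integral_sum//=.
rewrite -sum_fine; last by move=> i _; exact: integrable_fin_num.
apply: eq_bigr => i _.
by rewrite -[LHS]/(Rintegral _ _ _) RintegralZl//; exact: integrable_phiX.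
Qed.

Lemma fine_meas_Rintegral (A : set T) : measurable A ->
  fine (M A) = \int[M]_x (\1_A x).
Proof. by move=> mA; rewrite /Rintegral integral_indic// setIT. Qed.

Lemma integrable_indicT (A : set T) : measurable A ->
  M.-integrable setT (EFin \o (\1_A : T -> R)).
Proof.
move=> mA; apply: (@integrable_bounded01 _ 1) => //.
by move=> x; rewrite ger0_norm// ?indicE ?lern1 ?leq_b1.
Qed.

Lemma measurable_phi_itv (i : interval R) : measurable (phi @^-1` [set` i]).
Proof. by rewrite -[X in measurable X]setTI; exact: mphi. Qed.

(** Together with [separation_le] this squeezes the mass of an interval between integrals of one
    polynomial, which are linear combinations of moments. *)
Lemma separation_ge (a' b' eps : R) (q : {poly R}) :
  (forall u, 0 <= u <= 1 -> 0 <= q.[u]) ->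
  (forall u, 0 <= u <= 1 -> a' <= u <= b' -> 1 - eps <= q.[u]) ->
  (1 - eps) * fine (M (phi @^-1` `[a', b'])) <= \int[M]_x q.[phi x].
Proof.
move=> q0 q1; rewrite fine_meas_Rintegral; last exact: measurable_phi_itv.
have iI := integrable_indicT (measurable_phi_itv `[a', b']).
rewrite -RintegralZl//; apply: le_Rintegral => //.
- by rewrite /comp; under eq_fun do rewrite EFinM; exact: integrableZl.
- exact: integrable_phi_horner.
move=> x _; rewrite indicE; case: (boolP (_ \in _)).
  by rewrite inE/= in_itv/= mulr1 => ?; exact: q1.
by rewrite mulr0 => _; exact: q0.
Qed.

Lemma separation_le (a b eps : R) (q : {poly R}) :
  (forall u, 0 <= u <= 1 -> q.[u] <= 1) -> 0 <= eps ->
  (forall u, 0 <= u <= 1 -> ~~ (a <= u <= b) -> q.[u] <= eps) ->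
  \int[M]_x q.[phi x] <= fine (M (phi @^-1` `[a, b])) + eps * fine (M setT).
Proof.
move=> q1 e0 q0; rewrite !fine_meas_Rintegral//; last exact: measurable_phi_itv.
have iI := integrable_indicT (measurable_phi_itv `[a, b]).
have iT := integrable_indicT (@measurableT _ T).
rewrite -RintegralZl// -RintegralD//; last first.
  by rewrite /comp; under eq_fun do rewrite EFinM; exact: integrableZl.
apply: le_Rintegral => //.
- exact: integrable_phi_horner.
- rewrite (_ : _ \o _ = (fun x => (EFin \o \1_(phi @^-1` `[a, b])) x + eps%:E * (EFin \o \1_setT) x)%E)//.
  by apply: integrableD => //; exact: integrableZl.
move=> x _; rewrite indicT mulr1 indicE; case: (boolP (_ \in _)).
  by move=> _; rewrite -[leLHS]addr0 lerD// q1.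
by move=> H; rewrite add0r; apply: q0 => //; move: H; rewrite notin_setE/= in_itv/= => /negP.
Qed.

End one_measure.

Section two_measures.
Context d (T : measurableType d) (M_ : nat -> {measure set T -> \bar R})
  (phi_ : nat -> T -> R).
Hypotheses (Mfin_ : forall n, (M_ n setT < +oo)%E)
  (mphi_ : forall n, measurable_fun setT (phi_ n)).
Hypothesis phi01_ : forall n x, 0 <= phi_ n x <= 1.
Context d' (T' : measurableType d') (M : {measure set T' -> \bar R}) (phi : T' -> R).
Hypotheses (Mfin : (M setT < +oo)%E) (mphi : measurable_fun setT phi).
Hypothesis phi01 : forall x, 0 <= phi x <= 1.
Hypothesis cvg_moments : forall k,
  moment_of (M_ n) (phi_ n) k @[n --> \oo] --> moment_of M phi k.

Lemma cvg_Rintegral_horner (q : {poly R}) :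
  \int[M_ n]_x q.[phi_ n x] @[n --> \oo] --> \int[M]_x q.[phi x].
Proof.
rewrite Rintegral_horner// (_ : (fun n => \int[M_ n]_x q.[phi_ n x]) =
  (fun n => \sum_(i < size q) (fun m => q`_i * moment_of (M_ m) (phi_ m) i) n));
  last by apply/funext => n; rewrite Rintegral_horner.
apply: cvg_big => [|i _]; first exact: add_continuous.
 apply: cvgM; first exact: cvg_cst.
exact: cvg_moments.
Qed.

Lemma near_total_mass : \forall n \near \oo, fine (M_ n setT) <= fine (M setT) + 1.
Proof.
have := @cvg_Rintegral_horner 1.
have E d0 (T0 : measurableType d0) (M0 : {measure set T0 -> \bar R}) (phi0 : T0 -> R) :
  \int[M0]_x (1 : {poly R}).[phi0 x] = fine (M0 setT).
  by under eq_Rintegral do rewrite hornerC; rewrite Rintegral_cst// mul1r.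
rewrite E; under eq_fun do rewrite E.
by move=> /cvgr_le /(_ (fine (M setT) + 1)); apply; rewrite ltrDl.
Qed.

(** Convergence of moments gives convergence of polynomial integrals, and the separating polynomial
    passes from these to masses. The strictly larger interval on the limit side is needed since
    endpoints may carry mass. *)
Lemma moment_cvg_le (a a' b' b eps : R) : a < a' -> b' < b -> 0 < eps ->
  \forall n \near \oo, fine (M_ n (phi_ n @^-1` `[a', b'])) <=
     fine (M (phi @^-1` `[a, b])) + eps.
Proof.
move=> aa' bb' e0.
pose K := fine (M setT) + 1.
have M0 : 0 <= fine (M setT) by exact: fine_ge0.
have K0 : 0 < K by rewrite /K ltr_wpDl.
(* Three errors are to be covered: [e * K] where [q] is only at least [1 - e], [e] from the
   convergence of the integrals, and [e * (K - 1)] from the part outside [[a, b]]. *)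
pose e := eps / (2 * K + 1).
have K1 : 0 < 2 * K + 1 by lra.
have e'0 : 0 < e by rewrite divr_gt0.
have [q Hq] := bernstein_separation aa' bb' e'0.
have C := @cvg_Rintegral_horner q.
have H1 : \int[M]_x q.[phi x] <= fine (M (phi @^-1` `[a, b])) + e * fine (M setT).
  apply: separation_le => //; last by move=> u /Hq[].
    by move=> u /Hq[/andP[]].
  exact: ltW.
have C' : \forall n \near \oo, \int[M_ n]_x q.[phi_ n x] <= \int[M]_x q.[phi x] + e.
  by move/cvgr_le : C; apply; rewrite ltrDl.
near=> n.
have H2 : \int[M_ n]_x q.[phi_ n x] <= \int[M]_x q.[phi x] + e by near: n.
have H3 : fine (M_ n setT) <= K by near: n; exact: near_total_mass.
have H4 : (1 - e) * fine (M_ n (phi_ n @^-1` `[a', b'])) <= \int[M_ n]_x q.[phi_ n x].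
  by apply: separation_ge => // u /Hq[/andP[]].
have H5 : fine (M_ n (phi_ n @^-1` `[a', b'])) <= fine (M_ n setT).
  have mI := measurable_phi_itv (mphi_ n) `[a', b'].
  apply: fine_le; rewrite ?ge0_fin_numE//.
  - by apply: (le_lt_trans _ (Mfin_ n)); rewrite le_measure ?inE.
  - by rewrite le_measure ?inE.
have ee : e * (2 * K + 1) = eps by rewrite /e divfK// gt_eqF.
set x := fine (M_ n _) in H4 H5 *.
have : x - e * K <= (1 - e) * x.
  by rewrite mulrBl mul1r lerD2l lerN2 ler_wpM2l// ?(le_trans H5)// ltW.
by move: ee; rewrite /K; lra.
Unshelve. all: by end_near. Qed.

Lemma moment_cvg_ge (a a' b' b eps : R) : a < a' -> b' < b -> 0 < eps ->
  \forall n \near \oo, fine (M (phi @^-1` `[a', b'])) - eps <=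
     fine (M_ n (phi_ n @^-1` `[a, b])).
Proof.
move=> aa' bb' e0.
pose K := fine (M setT) + 1.
have M0 : 0 <= fine (M setT) by exact: fine_ge0.
have K0 : 0 < K by rewrite /K ltr_wpDl.
pose e := eps / (2 * K + 1).
have K1 : 0 < 2 * K + 1 by lra.
have e'0 : 0 < e by rewrite divr_gt0.
have [q Hq] := bernstein_separation aa' bb' e'0.
have C := @cvg_Rintegral_horner q.
have C' : \forall n \near \oo, \int[M]_x q.[phi x] - e <= \int[M_ n]_x q.[phi_ n x].
  by move/cvgr_ge : C; apply; rewrite ltrBlDr ltrDl.
have H4 : (1 - e) * fine (M (phi @^-1` `[a', b'])) <= \int[M]_x q.[phi x].
  by apply: separation_ge => // u /Hq[/andP[]].
have H5 : fine (M (phi @^-1` `[a', b'])) <= fine (M setT).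
  have mI := measurable_phi_itv mphi `[a', b'].
  apply: fine_le; rewrite ?ge0_fin_numE//.
  - by apply: (le_lt_trans _ Mfin); rewrite le_measure ?inE.
  - by rewrite le_measure ?inE.
have ee : e * (2 * K + 1) = eps by rewrite /e divfK// gt_eqF.
near=> n.
have H2 : \int[M]_x q.[phi x] - e <= \int[M_ n]_x q.[phi_ n x] by near: n.
have H3 : fine (M_ n setT) <= K by near: n; exact: near_total_mass.
have H1 : \int[M_ n]_x q.[phi_ n x] <= fine (M_ n (phi_ n @^-1` `[a, b])) + e * fine (M_ n setT).
  apply: separation_le => //; last by move=> u /Hq[].
    by move=> u /Hq[/andP[]].
  exact: ltW.
set x := fine (M (phi @^-1` _)) in H4 H5 *.
have : x - e * fine (M setT) <= (1 - e) * x.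
  by rewrite mulrBl mul1r lerD2l lerN2 ler_wpM2l// ltW.
have : e * fine (M_ n setT) <= e * K by rewrite ler_wpM2l// ltW.
by move: ee; rewrite /K; lra.
Unshelve. all: by end_near. Qed.

End two_measures.

Section uniqueness.
Context d (T : measurableType d) (M : {measure set T -> \bar R}) (phi : T -> R).
Hypotheses (Mfin : (M setT < +oo)%E) (mphi : measurable_fun setT phi).
Hypothesis phi01 : forall x, 0 <= phi x <= 1.
Context d' (T' : measurableType d') (M' : {measure set T' -> \bar R}) (phi' : T' -> R).
Hypotheses (Mfin' : (M' setT < +oo)%E) (mphi' : measurable_fun setT phi').
Hypothesis phi01' : forall x, 0 <= phi' x <= 1.
Hypothesis eq_moments : forall k, moment_of M phi k = moment_of M' phi' k.

(** The convergence result is applied to a constant sequence of measures; the widening it costs,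
    here [1 / (n + 1)], is removed by continuity from above. *)
Lemma moment_eq_le (a : R) : (M (phi @^-1` `[a, +oo[) <= M' (phi' @^-1` `[a, +oo[))%E.
Proof.
have fin' (A : set T') : measurable A -> M' A \is a fin_num.
  by move=> mA; rewrite ge0_fin_numE//; apply: (le_lt_trans _ Mfin'); rewrite le_measure ?inE.
have fin (A : set T) : measurable A -> M A \is a fin_num.
  by move=> mA; rewrite ge0_fin_numE//; apply: (le_lt_trans _ Mfin); rewrite le_measure ?inE.
have H n : (M (phi @^-1` `[a, +oo[) <= M' (phi' @^-1` `[(a - n.+1%:R^-1)%R, +oo[))%E.
  have E d0 (T0 : measurableType d0) (p0 : T0 -> R) (c b : R) : 1 <= b ->
      (forall x, 0 <= p0 x <= 1) -> p0 @^-1` `[c, +oo[ = p0 @^-1` `[c, b].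
    move=> b1 p01; apply/seteqP; split => x /=; rewrite !in_itv/= andbT.
      by move=> ->/=; have /andP[_ h] := p01 x; exact: (le_trans h).
    by move=> /andP[].
  (* The upper ends 1 and 2 both reach past the range of the functions, so the strict inequality
     between them costs nothing. *)
  rewrite (E _ _ phi a 1)// (E _ _ phi' _ 2)//; last by rewrite ler1n.
  rewrite -(fineK (fin _ _)); last exact: measurable_phi_itv.
  rewrite -[leRHS](fineK (fin' _ _)); last exact: measurable_phi_itv.
  rewrite lee_fin; apply/ler_addgt0Pr => e e0.
  have := @moment_cvg_le _ _ (fun=> M) (fun=> phi) (fun=> Mfin) (fun=> mphi) (fun=> phi01)
     _ _ M' phi' Mfin' mphi' phi01' _ (a - n.+1%:R^-1) a 1 2 e.
  case=> //.
  - by move=> k; rewrite eq_moments; exact: cvg_cst.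
  - by rewrite ltrBlDr ltrDl invr_gt0.
  - by rewrite ltr1n.
  - by move=> N _ /(_ N); apply => /=.
have C : (M' (phi' @^-1` `[(a - n.+1%:R^-1)%R, +oo[) @[n --> \oo] --> M' (phi' @^-1` `[a, +oo[))%E.
  rewrite (_ : phi' @^-1` `[a, +oo[ = \bigcap_n (phi' @^-1` `[(a - n.+1%:R^-1)%R, +oo[)).
    apply: nonincreasing_cvg_mu => //.
    - by rewrite -ge0_fin_numE//; exact: fin' (measurable_phi_itv mphi' _).
    - by move=> n; exact: measurable_phi_itv.
    - by apply: bigcapT_measurable => n; exact: measurable_phi_itv.
    - move=> m n mn; apply/subsetPset => x /=; rewrite !in_itv/= !andbT.
      apply: le_trans; rewrite lerD2l lerN2 lef_pV2 ?posrE//.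
      by rewrite ler_nat.
  apply/seteqP; split => x /=; rewrite !in_itv/= andbT.
    by move=> ax n _ /=; rewrite in_itv/= andbT (le_trans _ ax)// gerBl.
  move=> h; apply/ler_addgt0Pr => e e0.
  have [N Nbig] : exists N : nat, e^-1 < N.+1%:R.
    by exists (Num.truncn e^-1); exact: truncnS_gt.
  have := h N Logic.I; rewrite /= in_itv/= andbT lerBlDr => /le_trans; apply.
  by rewrite lerD2l -[leRHS]invrK lef_pV2 ?posrE ?invr_gt0// ltW.
apply: (cvge_ge _ C); first exact: nearW.
Qed.

End uniqueness.

Section moment_uniqueness.
Context d (T : measurableType d) (M : {measure set T -> \bar R}) (phi : T -> R).
Hypotheses (Mfin : (M setT < +oo)%E) (mphi : measurable_fun setT phi).
Hypothesis phi01 : forall x, 0 <= phi x <= 1.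
Context d' (T' : measurableType d') (M' : {measure set T' -> \bar R}) (phi' : T' -> R).
Hypotheses (Mfin' : (M' setT < +oo)%E) (mphi' : measurable_fun setT phi').
Hypothesis phi01' : forall x, 0 <= phi' x <= 1.
Hypothesis eq_moments : forall k, moment_of M phi k = moment_of M' phi' k.

(** Half lines form a generating pi-system, so the image measures under [phi] and [phi'] coincide.
    The two underlying spaces are unrelated, which allows a measure on R^d to be compared with one
    on the line. *)
Lemma moment_unique (f : R -> \bar R) : measurable_fun setT f ->
  (forall u, 0 <= f u)%E ->
  (\int[M]_x f (phi x) = \int[M']_x f (phi' x))%E.
Proof.
move=> mf f0.
have P d0 (T0 : measurableType d0) (M0 : {measure set T0 -> \bar R}) (p0 : T0 -> R) :
    measurable_fun setT p0 ->
    (\int[M0]_x f (p0 x) = \int[pushforward M0 p0]_y f y)%E.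
  by move=> mp; rewrite (@ge0_integral_pushforward _ _ _ _ _ p0 mp M0 setT f) ?preimage_setT// => y _; exact: f0.
rewrite (P _ _ M _ mphi) (P _ _ M' _ mphi').
apply: eq_measure_integral => A mA _.
apply: (@measure_unique _ R _ (@RGenCInfty.G R) (fun n => `[- n%:R, +oo[%classic)
  _ _ _ _ (pushforward M phi) (pushforward M' phi')) => //.
- exact: RGenCInfty.measurableE.
- move=> _ _ [x ->] [y ->]; exists (Num.max x y); apply/seteqP; split => z /=.
    by rewrite !in_itv/= !andbT ge_max => -[-> ->].
  by rewrite !in_itv/= !andbT ge_max => /andP[].
- by move=> n; exists (- n%:R).
- apply/seteqP; split => // x _; exists (Num.truncn `|x|).+1 => //=.
  rewrite in_itv/= andbT lerNl (le_trans (ler_norm _))// normrN.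
  by rewrite ltW// truncnS_gt.
- move=> _ [x ->]; apply/eqP; rewrite eq_le; apply/andP; split.
    exact: (moment_eq_le Mfin mphi phi01 Mfin' mphi' phi01').
  by apply: (moment_eq_le Mfin' mphi' phi01' Mfin mphi phi01) => k; rewrite eq_moments.
- move=> n; apply: (@le_lt_trans _ _ (M setT)) => //; apply: (le_measure M); rewrite ?inE//.
  exact: measurable_phi_itv.
Qed.

End moment_uniqueness.
End moments.

(** * Gamma densities and Gaussian integrals *)

Section scaling.
Context {R : realType}.
Local Notation leb := (@lebesgue_measure R).

Lemma lebesgue_measure_scale (k : R) A : 0 < k -> measurable A ->
  (k%:E * leb ((fun x : R => (k * x)%R) @^-1` A) = leb A)%E.
Proof.
move=> k0 mA.
have mk : measurable_fun [set: measurableTypeR R] (fun x : R => k * x : measurableTypeR R).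
  exact: measurable_funM.
have -> : (k%:E * leb ((fun x : R => k * x)%R @^-1` A) =
  mscale (NngNum (ltW k0)) (pushforward leb (fun x : R => k * x : measurableTypeR R)%R) A)%E by [].
apply/esym/lebesgue_measure_unique => //= _ [[a b]] _ <-.
rewrite /mscale/= /pushforward.
rewrite (_ : _ @^-1` _ = `]a / k, b / k]%classic); last first.
  by apply/seteqP; split => x /=; rewrite !in_itv/= ltr_pdivrMr// ler_pdivlMr// !(mulrC _ x).
rewrite !lebesgue_measure_itv/= !lte_fin ltr_pM2r ?invr_gt0//.
case: ifPn => _; last by rewrite mule0.
by rewrite -!EFinB -EFinM -mulrBl mulrC divfK// gt_eqF.
Qed.

Lemma ge0_integral_scale (k : R) (f : R -> \bar R) : 0 < k ->
  measurable_fun setT f -> (forall x, 0 <= f x)%E ->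
  (\int[leb]_x f x = k%:E * \int[leb]_x f (k * x)%R)%E.
Proof.
move=> k0 mf f0.
have mk : measurable_fun [set: measurableTypeR R] (fun x : R => k * x : measurableTypeR R).
  exact: measurable_funM.
have -> : (\int[leb]_x f (k * x)%R = \int[pushforward leb (fun x : R => k * x : measurableTypeR R)%R]_x f x)%E.
  by rewrite (@ge0_integral_pushforward _ _ _ _ _ _ mk leb setT f) ?preimage_setT// => y _; exact: f0.
rewrite -(@ge0_integral_mscale _ _ _ _ _ measurableT (NngNum (ltW k0)))//.
apply: eq_measure_integral => A mA _.
by apply/esym; exact: (lebesgue_measure_scale k0 mA).
Qed.

End scaling.

Section gamma.
Context {R : realType}.
Local Notation leb := (@lebesgue_measure R).

(** The unnormalised Gamma density, extended by 0 so that integrals run over the whole line. *)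
Definition gamma_density (c s : R) : R :=
  if 0 < s then s `^ (c - 1) * expR (- s) else 0.

Lemma gamma_density_ge0 c s : 0 <= gamma_density c s.
Proof. by rewrite /gamma_density; case: ifP => // _; rewrite mulr_ge0// ?powR_ge0 ?expR_ge0. Qed.

Lemma measurable_gamma_density c : measurable_fun setT (gamma_density c).
Proof.
apply: measurable_fun_if => //.
- exact: measurable_fun_ltr.
- apply: (@measurable_funTS _ _ _ _ _ (fun t : R => t `^ (c - 1) * expR (- t) : R)).
  by apply: measurable_funM => //; exact: measurableT_comp.
Qed.

Lemma GammaE (c : R) : Gamma c = fine (\int[leb]_s (gamma_density c s)%:E)%E.
Proof.
rewrite /Gamma integral_mkcond; congr fine; apply: eq_integral => s _.
rewrite /patch /gamma_density mem_setE in_itv/= andbT; by case: ifP.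
Qed.

(** For [c < 1] the integrand is singular at 0, so the fundamental theorem is applied on
    [[1 / (n + 2), 1]], an interval with distinct endpoints for every [n], before passing to the
    limit. *)
Lemma integral_powR01 (c : R) : 0 < c ->
  (\int[leb]_(s in `]0%R, 1%R]) (s `^ (c - 1))%:E < +oo)%E.
Proof.
move=> c0.
pose F (n : nat) : set R := `[n.+2%:R^-1, 1]%classic.
have FU : \bigcup_n F n = `]0, 1]%classic.
  apply/seteqP; split => x.
    move=> [n _]; rewrite /F /= !in_itv/= => /andP[h ->]; rewrite andbT.
    by apply: lt_le_trans h; rewrite invr_gt0.
  rewrite /= in_itv/= => /andP[x0 x1]; exists (Num.truncn x^-1) => //.
  rewrite /F /= in_itv/= x1 andbT -[leRHS]invrK lef_pV2 ?posrE ?invr_gt0//.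
  by rewrite ltW// (lt_le_trans (truncnS_gt _))// ler_nat.
have mf A : measurable_fun A (fun s : R => (s `^ (c - 1))%:E).
  by apply: measurable_funTS; apply/measurable_EFinP; exact: measurable_powR.
have : (\int[leb]_(s in F i) (s `^ (c - 1))%:E @[i --> \oo] --> \int[leb]_(s in `]0%R, 1%R]) (s `^ (c - 1))%:E)%E.
  rewrite -FU; apply: ge0_nondecreasing_set_cvg_integral => //.
  - move=> m n mn; apply/subsetPset => x; rewrite /F /= !in_itv/= => /andP[h ->].
    by rewrite andbT (le_trans _ h)// lef_pV2 ?posrE// ler_nat.
  - by move=> i; exact: measurable_itv.
  - by move=> i; exact: mf.
  - by move=> i x _; rewrite lee_fin powR_ge0.
move=> H; apply: (@le_lt_trans _ _ (c^-1)%:E); last by rewrite ltry.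
apply: cvge_le H; apply: nearW => n.
have n0 : 0 < (n.+2%:R : R)^-1 by rewrite invr_gt0.
have n1 : (n.+2%:R : R)^-1 < 1 by rewrite invf_lt1// ltr1n.
have dp (b x : R) : 0 < x -> is_derive x 1 (@powR R ^~ b) (b * x `^ (b - 1)).
  by move=> x0; exact: is_derive1_powR.
have cp (b x : R) : 0 < x -> {for x, continuous (@powR R ^~ b)}.
  move=> x0; apply/differentiable_continuous/derivable1_diffP.
  by case: (dp b x x0).
rewrite /F (@continuous_FTC2 _ _ (fun s => c^-1 * s `^ c))//.
- rewrite -EFinB lee_fin powR1 mulr1 gerBl mulr_ge0 ?powR_ge0// invr_ge0 ltW//.
- apply: continuous_in_subspaceT => x /[!inE]/=; rewrite in_itv/= => /andP[h _].
  by apply: cp; exact: lt_le_trans h.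
- split.
  + move=> x; rewrite in_itv/= => /andP[h _].
    apply: derivableM => //.
    by case: (dp c x (lt_trans n0 h)).
  + by apply: cvg_at_right_filter; apply: cvgM; [exact: cvg_cst|exact: cp].
  + by apply: cvg_at_left_filter; apply: cvgM; [exact: cvg_cst|exact: cp].
- move=> x; rewrite in_itv/= => /andP[h _].
  have x0 := lt_trans n0 h.
  have D := dp c x x0.
  rewrite derive1E (@derive_val _ _ _ _ _ _ _ (is_deriveZ c^-1 D)).
  by rewrite /GRing.scale/= mulrA mulVf ?mul1r// gt_eqF.
Qed.

(** With [B = |c| + 1], the inequality [ln y < y] at [y = s / (2 B)] gives
    [s^B <= (2 B)^B * exp (s / 2)]: half of the exponential absorbs the power. *)
Lemma gamma_density_le (c s : R) : 1 <= s ->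
  s `^ (c - 1) * expR (- s) <= expR ((`|c| + 1) * (ln (2 * (`|c| + 1)))) * expR (- (1/2) * s).
Proof.
move=> s1; have s0 : 0 < s by exact: lt_le_trans s1.
set B := `|c| + 1.
have B0 : 0 < B by rewrite ltr_wpDl.
have cB : c - 1 <= B by rewrite /B; have := ler_norm c; lra.
apply: (@le_trans _ _ (s `^ B * expR (- s))).
  by rewrite ler_wpM2r ?expR_ge0// ler_powR.
rewrite /powR gt_eqF// -!expRD ler_expR.
have h : ln (s / (2 * B)) < s / (2 * B) by apply: ln_sublinear; rewrite divr_gt0// mulr_gt0.
rewrite ln_div ?posrE ?mulr_gt0// in h.
have : B * (ln s - ln (2 * B)) <= B * (s / (2 * B)) by rewrite ler_pM2l// ltW.
have -> : B * (s / (2 * B)) = s / 2 by field; rewrite gt_eqF.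
by rewrite mulrBr; lra.
Qed.

Lemma gamma_density_lty (c : R) : 0 < c ->
  (\int[leb]_s (gamma_density c s)%:E < +oo)%E.
Proof.
move=> c0.
(* The factor 2 compensates the rate [1 / 2] that normalises the exponential density used as
   majorant on the tail. *)
pose K := 2 * expR ((`|c| + 1) * (ln (2 * (`|c| + 1)))).
have K0 : 0 <= K by rewrite mulr_ge0// expR_ge0.
pose h1 (s : R) : \bar R := ((fun s => (s `^ (c - 1))%:E) \_ `]0%R, 1%R]) s.
pose h2 (s : R) : \bar R := (K * exponential_pdf (1/2) s)%:E.
have mh1 : measurable_fun setT h1.
  apply/(measurable_restrictT _ _).1 => //.
  by apply: measurable_funTS; apply/measurable_EFinP; exact: measurable_powR.
have h10 x : (0 <= h1 x)%E by apply: erestrict_ge0 => y _; rewrite lee_fin powR_ge0.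
have e0 x : 0 <= exponential_pdf (1/2 : R) x by apply: exponential_pdf_ge0; lra.
have h20 x : (0 <= h2 x)%E by rewrite lee_fin mulr_ge0.
have mh2 : measurable_fun setT h2.
  by apply/measurable_EFinP; apply: measurable_funM => //; exact: measurable_exponential_pdf.
apply: (@le_lt_trans _ _ (\int[leb]_s (h1 s + h2 s))%E).
  apply: ge0_le_integral => //.
  - by move=> x _; rewrite lee_fin gamma_density_ge0.
  - by apply/measurable_EFinP; exact: measurable_gamma_density.
  - exact: emeasurable_funD.
  move=> s _; rewrite /gamma_density; case: ifPn => s0; last by rewrite adde_ge0.
  have [s1|s1] := leP s 1.
    apply: (@le_trans _ _ (h1 s)); last by rewrite leeDl.
    rewrite /h1 patchE mem_setE in_itv/= s0 s1/= lee_fin ler_piMr ?powR_ge0//.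
    by rewrite -expR0 ler_expR oppr_le0 ltW.
  apply: (@le_trans _ _ (h2 s)); last by rewrite leeDr.
  rewrite /h2 lee_fin exponential_pdfE ?(ltW s0)//.
  apply: (le_trans (gamma_density_le c (ltW s1))).
  by rewrite /K; set X := expR _; set Y := expR _; lra.
rewrite ge0_integralD//; apply: lte_add_pinfty.
  by rewrite /h1 -integral_mkcond; exact: integral_powR01.
rewrite /h2; under eq_integral do rewrite EFinM.
rewrite ge0_integralZl//; last first.
- by move=> x _; rewrite lee_fin.
- by apply/measurable_EFinP; exact: measurable_exponential_pdf.
by rewrite integral_exponential_pdf// ?mule1 ?ltry//; lra.
Qed.

Lemma integral_gamma_density (c : R) : 0 < c ->
  (\int[leb]_s (gamma_density c s)%:E = (Gamma c)%:E)%E.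
Proof.
move=> c0; rewrite GammaE fineK// ge0_fin_numE ?gamma_density_lty//.
by apply: integral_ge0 => x _; rewrite lee_fin gamma_density_ge0.
Qed.

Lemma Gamma_gt0 (c : R) : 0 < c -> 0 < Gamma c.
Proof.
move=> c0; rewrite -lte_fin -integral_gamma_density//.
(* A lower bound of the integrand on [[1, 2]], where [0 <= ln s <= ln 2] and [s <= 2]. *)
pose m := expR (- (`|c - 1| * ln 2) - 2).
apply: (@lt_le_trans _ _ (\int[leb]_(s in `[1%R, 2%R]) m%:E)%E).
  rewrite integral_cst//= lebesgue_measure_itv/= lte_fin ltr1n.
  by rewrite mule_gt0 ?lte_fin ?expR_gt0// subr_gt0 ltr1n.
rewrite integral_mkcond; apply: ge0_le_integral => //.
- by move=> x _; apply: erestrict_ge0 => y _; rewrite lee_fin expR_ge0.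
- exact/(measurable_restrictT _ _).1.
- by apply/measurable_EFinP; exact: measurable_gamma_density.
move=> s _; rewrite patchE; case: ifPn; last by rewrite lee_fin gamma_density_ge0.
rewrite inE/= in_itv/= => /andP[s1 s2].
have s0 : 0 < s by exact: lt_le_trans s1.
rewrite lee_fin /gamma_density s0 /powR gt_eqF// -expRD ler_expR.
have l0 : 0 <= ln s by exact: ln_ge0.
have l2 : ln s <= ln 2 by rewrite ler_ln ?posrE.
have : - ((c - 1) * ln s) <= `|c - 1| * ln 2.
  rewrite -mulNr (le_trans (ler_norm _))// normrM normrN ler_wpM2l//.
  by rewrite ger0_norm.
by lra.
Qed.

(** Substitution of [(k + 1) s] for [s]. At integers [k] this yields every moment in [exp (- s)]
    used below. *)
Lemma integral_gamma_scale (c k : R) : 0 < c -> 0 <= k ->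
  (\int[leb]_s (gamma_density c s * expR (- (k * s)))%:E = (Gamma c * (k + 1) `^ (- c))%:E)%E.
Proof.
move=> c0 k0.
have k1 : 0 < k + 1 by lra.
have mg : measurable_fun setT (fun s => (gamma_density c s)%:E).
  by apply/measurable_EFinP; exact: measurable_gamma_density.
have g0 s : (0 <= (gamma_density c s)%:E)%E by rewrite lee_fin gamma_density_ge0.
rewrite EFinM -integral_gamma_density// (ge0_integral_scale k1 mg g0).
have E s : gamma_density c ((k + 1) * s) = (k + 1) `^ (c - 1) * (gamma_density c s * expR (- (k * s))).
  rewrite /gamma_density pmulr_rgt0//; case: ifPn => s0; last by rewrite mul0r mulr0.
  rewrite powRM ?(ltW k1) ?(ltW s0)// !mulrA; set u := _ `^ _; set v := _ `^ _.
  by rewrite -!mulrA -expRD; congr (_ * (_ * expR _)); lra.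
under [in RHS]eq_integral do rewrite E EFinM.
rewrite ge0_integralZl//; last first.
- by rewrite lee_fin powR_ge0.
- by move=> x _; rewrite lee_fin mulr_ge0 ?gamma_density_ge0 ?expR_ge0.
- apply/measurable_EFinP; apply: measurable_funM; first exact: measurable_gamma_density.
  by apply: measurableT_comp => //; apply: measurableT_comp => //; exact: measurable_funM.
rewrite muleA -EFinM mulr_powRB1 ?(ltW k1)// muleAC -EFinM.
by rewrite powRN mulfV ?mul1e// gt_eqF// powR_gt0.
Qed.

End gamma.

Section calculus.
Context {R : realType}.
Implicit Types (f g : R -> R) (x : R).

Lemma is_derive_mul f g x (df dg : R) : is_derive x (1 : R) f df ->
  is_derive x (1 : R) g dg ->
  is_derive x (1 : R) (fun z => f z * g z) (f x * dg + g x * df).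
Proof. by move=> hf hg; exact: is_deriveM. Qed.

Lemma is_derive_sub f g x (df dg : R) : is_derive x (1 : R) f df ->
  is_derive x (1 : R) g dg -> is_derive x (1 : R) (fun z => f z - g z) (df - dg).
Proof. by move=> hf hg; exact: is_deriveB. Qed.

Lemma is_derive_chain f g x (a b : R) : is_derive (g x) (1 : R) f a ->
  is_derive x (1 : R) g b -> is_derive x (1 : R) (fun z => f (g z)) (a * b).
Proof. by move=> hf hg; exact: is_derive1_comp. Qed.

Lemma is_derive_cmul (c x : R) : is_derive x (1 : R) (fun z => c * z) c.
Proof.
apply: (is_derive_eq (is_derive_mul (is_derive_cst c x (1 : R)) (is_derive_id x (1 : R)))).
by rewrite /cst; ring.
Qed.

Lemma is_derive_csqr (c x : R) : is_derive x (1 : R) (fun z => c * z ^+ 2) (2 * c * x).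
Proof. by apply: is_derive_eq; rewrite /GRing.scale/= ?mulr0 ?mulr1 ?add0r ?addr0; ring. Qed.

Lemma is_derive_continuous f x (df : R) : is_derive x (1 : R) f df ->
  {for x, continuous f}.
Proof. by move=> [h _]; exact/differentiable_continuous/derivable1_diffP. Qed.

End calculus.

(** * The Gaussian and its Fourier transform on the line *)

Section gaussian_fourier.
Context {R : realType}.
Local Notation leb := (@lebesgue_measure R).
Variable a : R.
Hypothesis a0 : 0 < a.

Definition gaussian (a x : R) : R := expR (- (a * x ^+ 2)).
Local Notation g := (gaussian a).

Lemma gaussian_ge0 b x : 0 <= gaussian b x. Proof. exact: expR_ge0. Qed.

Lemma is_derive_gaussian b x : is_derive x (1 : R) (gaussian b) (gaussian b x * (- (2 * b * x))).
Proof.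
apply: (@is_derive_chain _ expR (fun z => - (b * z ^+ 2))).
have -> : (fun z : R => - (b * z ^+ 2)) = (fun z => (- b) * z ^+ 2).
  by apply/funext => z; rewrite mulNr.
by apply: (is_derive_eq (is_derive_csqr (- b) x)); ring.
Qed.

Lemma measurable_gaussian b : measurable_fun setT (gaussian b).
Proof.
apply: continuous_measurable_fun => x.
exact: (is_derive_continuous (is_derive_gaussian b x)).
Qed.

Lemma integral_gaussian : (\int[leb]_x (g x)%:E = (Num.sqrt (pi / a))%:E)%E.
Proof.
have s0 : 0 < Num.sqrt a by rewrite sqrtr_gt0.
have := @integralT_gauss R.
have mg : measurable_fun setT (fun x : R => (gauss_fun x)%:E).
  by apply/measurable_EFinP; exact: measurable_gauss_fun.
have gg (x : R) : (0 <= (gauss_fun x)%:E)%E by rewrite lee_fin gauss_fun_ge0.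
rewrite (ge0_integral_scale s0 mg gg).
have E x : gauss_fun (Num.sqrt a * x) = g x.
  by rewrite /gauss_fun /gaussian exprMn sqr_sqrtr// ltW.
under eq_integral do rewrite E.
move=> /(congr1 (fun y => ((Num.sqrt a)^-1)%:E * y)%E).
rewrite muleA -!EFinM mulVf ?gt_eqF// mul1e => ->.
by rewrite sqrtrM ?pi_ge0// sqrtrV ?(ltW a0)// mulrC.
Qed.

Lemma integrable_gaussian : leb.-integrable setT (EFin \o g).
Proof.
apply/integrableP; split; first by apply/measurable_EFinP; exact: measurable_gaussian.
under eq_integral do rewrite /= ger0_norm ?gaussian_ge0//.
by rewrite integral_gaussian ltry.
Qed.

(** Half of the exponent is spent on absorbing [|x|]. The result is the integrable majorant for
    differentiation under the integral sign. *)
Lemma le_norm_gaussian x : `|x| * g x <= (1 + 2 / a) * gaussian (a / 2) x.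
Proof.
have -> : g x = gaussian (a / 2) x * gaussian (a / 2) x.
  by rewrite /gaussian -expRD; congr expR; field.
rewrite mulrA ler_wpM2r ?gaussian_ge0//.
have h : 1 + a / 2 * x ^+ 2 <= expR (a / 2 * x ^+ 2) by exact: expR_ge1Dx.
have h2 : `|x| <= (1 + 2 / a) * (1 + a / 2 * x ^+ 2).
  have -> : (1 + 2 / a) * (1 + a / 2 * x ^+ 2) = 1 + x ^+ 2 + (2 / a + a / 2 * x ^+ 2).
    by field; rewrite gt_eqF.
  have t : 0 <= 2 / a + a / 2 * x ^+ 2.
    by apply: addr_ge0; [|apply: mulr_ge0; [|exact: sqr_ge0]]; rewrite divr_ge0// ltW.
  have : `|x| <= 1 + x ^+ 2.
    rewrite -(real_normK (num_real x)); have := sqr_ge0 (`|x| - 1); have := normr_ge0 x; nra.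
  by lra.
have b0 : 0 < 1 + 2 / a by rewrite addr_gt0// divr_gt0.
have := ler_wpM2l (ltW b0) h => /(le_trans h2).
by rewrite /gaussian expRN ler_pdivrMr ?expR_gt0.
Qed.

End gaussian_fourier.

Section gaussian_phase_line.
Context {R : realType}.
Local Notation leb := (@lebesgue_measure R).
Variable a : R.
Hypothesis a0 : 0 < a.
Local Notation g := (gaussian a).

Let dom (x : R) : R := (1 + 2 / a) * gaussian (a / 2) x.

Lemma integrable_dom : leb.-integrable setT (EFin \o dom).
Proof.
rewrite /comp /dom; under eq_fun do rewrite EFinM.
by apply: integrableZl => //; apply: integrable_gaussian; rewrite divr_gt0.
Qed.

Lemma measurable_cosM (xi : R) : measurable_fun setT (fun x : R => cos (xi * x)).
Proof.
apply: continuous_measurable_fun => x.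
apply: (@continuous_comp _ _ _ (fun x => xi * x) cos); last exact: continuous_cos.
by apply: continuousM; [exact: cst_continuous|].
Qed.

Lemma measurable_sinM (xi : R) : measurable_fun setT (fun x : R => sin (xi * x)).
Proof.
apply: continuous_measurable_fun => x.
apply: (@continuous_comp _ _ _ (fun x => xi * x) sin); last exact: continuous_sin.
by apply: continuousM; [exact: cst_continuous|].
Qed.

Lemma integrable_gauss_cos xi : leb.-integrable setT (EFin \o (fun x => g x * cos (xi * x))).
Proof.
apply: (le_integrable _ _ _ (integrable_gaussian a0)) => //.
- apply/measurable_EFinP; apply: measurable_funM; first exact: measurable_gaussian.
  exact: measurable_cosM.
- move=> x _ /=; rewrite lee_fin normrM ler_piMr//.
  by rewrite ler_norml cos_geN1 cos_le1.
Qed.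

Lemma integrable_gauss_sin xi : leb.-integrable setT (EFin \o (fun x => g x * sin (xi * x))).
Proof.
apply: (le_integrable _ _ _ (integrable_gaussian a0)) => //.
- apply/measurable_EFinP; apply: measurable_funM; first exact: measurable_gaussian.
  exact: measurable_sinM.
- move=> x _ /=; rewrite lee_fin normrM ler_piMr//.
  by rewrite ler_norml sin_geN1 sin_le1.
Qed.

Lemma le_xgauss_sin xi x : `|x * g x * sin (xi * x)| <= dom x.
Proof.
apply: (le_trans _ (le_norm_gaussian a0 x)).
rewrite !normrM (ger0_norm (gaussian_ge0 _ _)) ler_piMr ?mulr_ge0 ?gaussian_ge0//.
by rewrite ler_norml sin_geN1 sin_le1.
Qed.

Lemma integrable_xgauss_sin xi :
  leb.-integrable setT (EFin \o (fun x => x * g x * sin (xi * x))).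
Proof.
apply: (le_integrable _ _ _ integrable_dom) => //.
- apply/measurable_EFinP; apply: measurable_funM; last exact: measurable_sinM.
  by apply: measurable_funM => //; exact: measurable_gaussian.
- move=> x _ /=; rewrite lee_fin (le_trans (le_xgauss_sin _ _))//.
  by rewrite ger0_norm// mulr_ge0 ?gaussian_ge0// addr_ge0// divr_ge0// ltW.
Qed.

Lemma is_derive_cosM (c y x : R) :
  is_derive x (1 : R) (fun z => c * cos (z * y)) (- (y * c * sin (x * y))).
Proof.
have H1 : is_derive x (1 : R) (fun z : R => z * y) y.
  have -> : (fun z : R => z * y) = (fun z => y * z) by apply/funext => z; rewrite mulrC.
  exact: is_derive_cmul.
have H := is_derive_mul (is_derive_cst c x (1 : R))
  (@is_derive_chain _ cos (fun z => z * y) x _ _ (is_derive_cos (x * y)) H1).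
by apply: (is_derive_eq H); rewrite /cst; ring.
Qed.

Definition gauss_ft (xi : R) : R := \int[leb]_x (g x * cos (xi * x)).

Lemma is_derive_gauss_ft (xi : R) : is_derive xi (1 : R) gauss_ft
  (- (\int[leb]_x (x * g x * sin (xi * x)))).
Proof.
have E x y : partial1of2 (fun z w => g w * cos (z * w)) x y = - (y * g y * sin (x * y)).
  by rewrite partial1of2E; exact: (@derive_val _ _ _ _ _ _ _ (is_derive_cosM (g y) y x)).
have I : `]xi - 1, xi + 1[%classic xi by rewrite /= in_itv/= ltrBlDr !ltrDl ltr01.
have D1 (x y : R) : derivable (fun z : R => g y * cos (z * y)) x 1 by case: (is_derive_cosM (g y) y x).
have dom0 y : 0 <= dom y by rewrite mulr_ge0 ?gaussian_ge0// addr_ge0// divr_ge0// ltW.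
have ub x y : `|partial1of2 (fun z w => g w * cos (z * w)) x y| <= dom y.
  by rewrite E normrN; exact: le_xgauss_sin.
apply: DeriveDef.
  by apply: (@derivable_under_integral _ _ _ leb (fun z w => g w * cos (z * w)) setT measurableT
    xi (xi - 1) (xi + 1) I _ _ dom) => //; [move=> x _; exact: integrable_gauss_cos|exact: integrable_dom].
rewrite -derive1E (@differentiation_under_integral _ _ _ leb (fun z w => g w * cos (z * w)) setT measurableT
    xi (xi - 1) (xi + 1) I _ _ dom) => //; [|by move=> x _; exact: integrable_gauss_cos|exact: integrable_dom].
rewrite -[RHS]mulN1r -RintegralZl//; last exact: integrable_xgauss_sin.
by apply: eq_Rintegral => y _; rewrite E mulN1r.
Qed.

Lemma is_derive_gauss_sin (xi x : R) : is_derive x (1 : R) (fun z => g z * sin (xi * z))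
  (xi * (g x * cos (xi * x)) - 2 * a * (x * g x * sin (xi * x))).
Proof.
have H2 := is_derive_chain (is_derive_sin (xi * x)) (is_derive_cmul xi x).
apply: (is_derive_eq (is_derive_mul (is_derive_gaussian a x) H2)); ring.
Qed.

(** The difference of the two integrands is the derivative of [g x * sin (xi * x)], whose boundary
    terms on [[- (n + 1), n + 1]] vanish as [n] grows. *)
Lemma gauss_ibp xi : xi * gauss_ft xi = 2 * a * (\int[leb]_x (x * g x * sin (xi * x))).
Proof.
pose h x := xi * (g x * cos (xi * x)) - 2 * a * (x * g x * sin (xi * x)).
have ih1 : leb.-integrable setT (EFin \o (fun x => xi * (g x * cos (xi * x)))).
  by rewrite /comp; under eq_fun do rewrite EFinM; apply: integrableZl => //; exact: integrable_gauss_cos.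
have ih2 : leb.-integrable setT (EFin \o (fun x => 2 * a * (x * g x * sin (xi * x)))).
  by rewrite /comp; under eq_fun do rewrite EFinM; apply: integrableZl => //; exact: integrable_xgauss_sin.
have ih : leb.-integrable setT (EFin \o h).
  by rewrite /comp /h; under eq_fun do rewrite EFinB; exact: integrableB.
suff : \int[leb]_x h x = 0.
  rewrite RintegralB// !RintegralZl//; last 2 first.
  - exact: integrable_xgauss_sin.
  - exact: integrable_gauss_cos.
  by move/eqP; rewrite subr_eq0 => /eqP.
pose F (n : nat) (x : R) : \bar R := ((EFin \o h) \_ `[- n.+1%:R, n.+1%:R]%classic) x.
have mh : measurable_fun setT (EFin \o h) by exact: measurable_int ih.
have [_ _ C] : [/\ leb.-integrable setT (EFin \o h),
  [sequence \int[leb]_x `|F n x - (h x)%:E|]_n%E @ \oo --> 0%E &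
  [sequence \int[leb]_x F n x]_n%E @ \oo --> (\int[leb]_x (h x)%:E)%E].
  apply: (@dominated_convergence _ _ _ leb setT measurableT F (EFin \o h) (abse \o (EFin \o h))) => //.
  - move=> n; apply/(measurable_restrictT _ _).1 => //; exact: measurable_funTS.
  - apply: aeW => x _.
    apply: cvg_near_cst; exists (Num.truncn `|x|) => // n /= tn.
    rewrite /F patchE ifT// inE/= in_itv/= -ler_norml ltW//.
    by rewrite (lt_le_trans (truncnS_gt _))// ler_nat.
  - exact: integrable_abse.
  - by apply: aeW => x n _; rewrite /F patchE; case: ifP => _; rewrite ?abse0//=.
have gx n : `|g n.+1%:R| <= (a * n.+1%:R)^-1.
  rewrite ger0_norm ?gaussian_ge0// /gaussian expRN lef_pV2 ?posrE ?expR_gt0 ?mulr_gt0//.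
  apply: (le_trans _ (expR_ge1Dx _)); rewrite expr2 mulrA.
  by rewrite (@le_trans _ _ (a * n.+1%:R * n.+1%:R))// ?lerDr// ler_peMr ?ler1n// mulr_ge0// ltW.
have FE n : (\int[leb]_x F n x = (2 * (g n.+1%:R * sin (xi * n.+1%:R)))%:E)%E.
  rewrite /F -integral_mkcond (@continuous_FTC2 _ h (fun z => g z * sin (xi * z)))//.
  - by rewrite -EFinB; congr EFin; rewrite mulrN sinN /gaussian sqrrN; lra.
  - by rewrite gtrN.
  - apply: continuous_subspaceT => x.
    have C1 := is_derive_chain (is_derive_cos (xi * x)) (is_derive_cmul xi x).
    have C2 := is_derive_chain (is_derive_sin (xi * x)) (is_derive_cmul xi x).
    have C3 := is_derive_gaussian a x.
    have C4 := is_derive_mul (is_derive_cst xi x (1 : R)) (is_derive_mul C3 C1).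
    have C5 := is_derive_mul (is_derive_cst (2 * a) x (1 : R)) (is_derive_mul (is_derive_mul (is_derive_id x (1 : R)) C3) C2).
    exact: (is_derive_continuous (is_derive_sub C4 C5)).
  - have cc x : {for x, continuous (fun z => g z * sin (xi * z))}.
      apply/differentiable_continuous/derivable1_diffP.
      by case: (is_derive_gauss_sin xi x).
    split.
    + by move=> x _; case: (is_derive_gauss_sin xi x).
    + by apply: cvg_at_right_filter; exact: cc.
    + by apply: cvg_at_left_filter; exact: cc.
  - by move=> x _; rewrite derive1E; exact: (@derive_val _ _ _ _ _ _ _ (is_derive_gauss_sin xi x)).
have C0 : (\int[leb]_x F n x)%E @[n --> \oo] --> (0 : \bar R).
  rewrite (_ : (fun n => _) = EFin \o (fun n => 2 * (g n.+1%:R * sin (xi * n.+1%:R)))); last first.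
    by apply/funext => n /=; rewrite FE.
  apply: cvg_EFin; first exact: nearW.
  rewrite (_ : _ \o _ = (fun n => 2 * (g n.+1%:R * sin (xi * n.+1%:R))))//.
  rewrite -[X in _ --> X](mulr0 2); apply: cvgM; first exact: cvg_cst.
  apply: norm_cvg0.
  apply: (@squeeze_cvgr _ _ _ _ (cst 0) (fun n => a^-1 * n.+1%:R^-1)).
  - apply: nearW => n; rewrite normr_ge0/= normrM (le_trans _ (_ : `|g n.+1%:R| <= _))//.
      by rewrite ler_piMr// ler_norml sin_geN1 sin_le1.
    by rewrite -invfM.
  - exact: cvg_cst.
  - rewrite -(mulr0 a^-1); apply: cvgM; first exact: cvg_cst.
    exact: cvg_harmonic.
by rewrite /Rintegral; have := cvg_unique _ C C0 => ->.
Qed.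

(** Integration by parts makes the transform satisfy [y' = - xi * y / (2 a)], so its product with
    [exp (xi^2 / (4 a))] has zero derivative and equals its value at 0. *)
Lemma gauss_ftE xi : gauss_ft xi = Num.sqrt (pi / a) * expR (- (xi ^+ 2 / (4 * a))).
Proof.
pose f z := gauss_ft z * expR (z ^+ 2 / (4 * a)).
have D z : is_derive z (1 : R) f 0.
  have H3 : is_derive z (1 : R) (fun z : R => z ^+ 2 / (4 * a)) (2 * z / (4 * a)).
    have -> : (fun z : R => z ^+ 2 / (4 * a)) = (fun z => (4 * a)^-1 * z ^+ 2).
      by apply/funext => y; rewrite mulrC.
    by apply: (is_derive_eq (is_derive_csqr _ z)); rewrite mulrAC.
  have H4 := @is_derive_chain _ expR (fun z => z ^+ 2 / (4 * a)) z _ _ (is_derive_expR _) H3.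
  apply: (is_derive_eq (is_derive_mul (is_derive_gauss_ft z) H4)).
  have := gauss_ibp z; set I := Rintegral _ _ _ => H.
  have -> : I = z * gauss_ft z / (2 * a) by rewrite H; field; rewrite gt_eqF.
  by field; rewrite gt_eqF.
have := is_derive_0_is_cst xi 0 D.
rewrite /f expr0n/= mul0r expR0 mulr1.
have -> : gauss_ft 0 = Num.sqrt (pi / a).
  rewrite /gauss_ft; under eq_Rintegral do rewrite mul0r cos0 mulr1.
  by rewrite /Rintegral integral_gaussian.
by move=> <-; rewrite -mulrA -expRD subrr expR0 mulr1.
Qed.

(** Reflection preserves Lebesgue measure and changes the sign of the integrand. *)
Lemma gauss_st0 xi : \int[leb]_x (g x * sin (xi * x)) = 0.
Proof.
have E : \int[leb]_x (g x * sin (xi * x)) = - \int[leb]_x (g x * sin (xi * x)).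
  rewrite {1}/Rintegral.
  have mN : measurable_fun [set: measurableTypeR R] (-%R : R -> measurableTypeR R).
    by apply: continuous_measurable_fun; exact: opp_continuous.
  rewrite (eq_measure_integral (pushforward leb (-%R : R -> measurableTypeR R))); last first.
    by move=> A mA _; apply/esym; exact: lebesgue_measureN.
  have iN : leb.-integrable setT ((fun x => (- (g x * sin (xi * x)))%:E)).
    by under eq_fun do rewrite EFinN; apply: (integrableN (integrable_gauss_sin xi)).
  have EN : (fun x => (- (g x * sin (xi * x)))%:E) = (fun x : R => (g x * sin (xi * x))%:E) \o -%R.
    by apply/funext => x /=; rewrite /gaussian sqrrN mulrN sinN mulrN.
  rewrite integral_pushforward//=; last 2 first.
  - exact: measurable_int (integrable_gauss_sin xi).
  - by rewrite preimage_setT -EN.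
  rewrite preimage_setT -[X in integral _ _ X]/((fun x : R => (g x * sin (xi * x))%:E) \o -%R) -EN.
  rewrite -[LHS]/(Rintegral _ _ _) -[RHS]mulN1r -RintegralZl//; last exact: integrable_gauss_sin.
  by apply: eq_Rintegral => x _; rewrite mulN1r.
by apply/eqP; rewrite -eqNr -E.
Qed.

(** This is the step from one dimension to the next: [E] is the damping already produced by the
    other coordinates, and [theta] the phase still to be carried. *)
Lemma integral_gauss_phase (E theta xi : R) : `|E| <= 1 ->
  (\int[leb]_x (g x * (1 + E * cos (theta + xi * x)))%:E =
   (Num.sqrt (pi / a) * (1 + E * cos theta * expR (- (xi ^+ 2 / (4 * a)))))%:E)%E.
Proof.
move=> E1.
have D x : g x * (1 + E * cos (theta + xi * x)) =
   g x + (E * cos theta * (g x * cos (xi * x)) + (- (E * sin theta)) * (g x * sin (xi * x))).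
  by rewrite cosD; ring.
under eq_integral do rewrite D.
have i1 := integrable_gaussian a0.
have i2 : leb.-integrable setT (EFin \o (fun x => E * cos theta * (g x * cos (xi * x)))).
  by rewrite /comp; under eq_fun do rewrite EFinM; apply: integrableZl => //; exact: integrable_gauss_cos.
have i3 : leb.-integrable setT (EFin \o (fun x => - (E * sin theta) * (g x * sin (xi * x)))).
  by rewrite /comp; under eq_fun do rewrite EFinM; apply: integrableZl => //; exact: integrable_gauss_sin.
have i4 : leb.-integrable setT (EFin \o (fun x => E * cos theta * (g x * cos (xi * x)) +
    - (E * sin theta) * (g x * sin (xi * x)))).
  by rewrite /comp; under eq_fun do rewrite EFinD; exact: integrableD.
rewrite -[LHS]fineK; last by apply: integrable_fin_num => //; rewrite /comp; under eq_fun do rewrite EFinD; exact: integrableD.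
congr EFin; rewrite -[LHS]/(Rintegral _ _ _) RintegralD// RintegralD// !RintegralZl//; last 2 first.
- exact: integrable_gauss_sin.
- exact: integrable_gauss_cos.
rewrite gauss_st0 -/(gauss_ft xi) gauss_ftE {1}/Rintegral integral_gaussian//=.
by ring.
Qed.

End gaussian_phase_line.

(** * Lebesgue measure on R^d in polar coordinates *)

Section sigma_finite_wrapper.
Context d (T : measurableType d) (R : realType).
Variables (m : {measure set T -> \bar R}) (h : sigma_finite setT m).

(** An alias of [m] that turns the proof [h] into the structure expected by Tonelli's theorem. *)
Definition sigma_finite_of of sigma_finite setT m : set T -> \bar R := m.
Local Notation sm := (sigma_finite_of h).

HB.instance Definition _ := Measure.on sm.
HB.instance Definition _ := @Measure_isSigmaFinite.Build _ _ _ sm h.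

End sigma_finite_wrapper.

Section tuple_lebesgue.
Context {R : realType}.
Local Notation leb := (@lebesgue_measure R).

Definition box (n : nat) (a b : n.-tuple R) : set (n.-tuple R) :=
  [set x | forall i, tnth a i <= tnth x i <= tnth b i].

Definition boxes (n : nat) : set (set (n.-tuple R)) :=
  [set A | exists a b : n.-tuple R, A = box a b].
Arguments boxes : clear implicits.

Lemma boxE (n : nat) (a b : n.-tuple R) :
  box a b = \bigcap_(i in [set: 'I_n]) ((fun x => tnth x i) @^-1` `[tnth a i, tnth b i]).
Proof.
apply/seteqP; split => x /= h i; first by move=> _ /=; rewrite in_itv/=.
by have := h i Logic.I; rewrite /= in_itv.
Qed.

Lemma measurable_box (n : nat) (a b : n.-tuple R) : measurable (box a b).
Proof.
rewrite boxE; apply: fin_bigcap_measurable => [|i _]; first exact: finite_finset.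
by rewrite -[X in measurable X]setTI; apply: measurable_tnth => //; exact: measurable_itv.
Qed.

Lemma boxI (n : nat) : setI_closed (boxes n).
Proof.
move=> _ _ [a [b ->]] [a' [b' ->]].
exists [tuple Num.max (tnth a i) (tnth a' i) | i < n],
       [tuple Num.min (tnth b i) (tnth b' i) | i < n].
apply/seteqP; split => x /=.
  move=> [h h'] i; rewrite !tnth_mktuple ge_max le_min.
  by have /andP[-> ->] := h i; have /andP[-> ->] := h' i.
move=> h; split => i; have := h i; rewrite !tnth_mktuple ge_max le_min.
  by move=> /andP[/andP[-> _] /andP[-> _]].
by move=> /andP[/andP[_ ->] /andP[_ ->]].
Qed.

Definition cube (n k : nat) : set (n.-tuple R) :=
  box [tuple - k%:R | i < n] [tuple k%:R | i < n].
Arguments cube : clear implicits.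

Lemma bigcup_cube n : \bigcup_k cube n k = setT.
Proof.
apply/seteqP; split => // x _.
exists (\sum_(i < n) (Num.truncn `|tnth x i|).+1)%N => // i.
rewrite !tnth_mktuple -ler_norml (le_trans (ltW (truncnS_gt _)))//.
by rewrite ler_nat (bigD1 i)//= leq_addr.
Qed.

(** A half-space [c <= tnth x i] is a countable union of boxes, and half-spaces generate the product
    sigma-algebra. *)
Lemma measurable_boxesE n : (@measurable _ (n.-tuple R)) = <<s boxes n >>.
Proof.
apply/seteqP; split; last first.
  apply: smallest_sub; first exact: sigma_algebra_measurable.
  by move=> _ [a [b ->]]; exact: measurable_box.
move=> A mA.
pose T' := g_sigma_algebraType (boxes n).
have : measurable_fun [set: T'] (fun x : T' => (x : n.-tuple R)).
  apply/measurable_fun_tnthP => i /=.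
  apply: (@measurability _ _ _ _ setT _ (@RGenCInfty.G R)); first exact: RGenCInfty.measurableE.
  move=> _ [_ [c ->] <-]; rewrite setTI.
  rewrite (_ : _ @^-1` _ = \bigcup_k box [tuple if j == i then c else - k%:R | j < n] [tuple k%:R | j < n]).
    by apply: bigcupT_measurable => k; apply: sub_sigma_algebra; eexists; eexists; reflexivity.
  apply/seteqP; split => x /=; rewrite in_itv/= andbT.
    move=> cx; have : (\bigcup_k cube n k) x by rewrite bigcup_cube.
    move=> [k _ h]; exists k => // j; have := h j; rewrite !tnth_mktuple.
    by case: eqP => // -> /andP[_ ->]; rewrite andbT.
  by move=> [k _ /(_ i)]; rewrite !tnth_mktuple eqxx => /andP[].
by move=> /(_ measurableT A mA); rewrite setTI.
Qed.

Lemma lebesgue_Rd_boxlty n (lam : {measure set (n.-tuple R) -> \bar R}) :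
  is_lebesgue_Rd lam -> forall k, (lam (cube n k) < +oo)%E.
Proof.
move=> hl k; rewrite /cube hl ?ltry// => i.
by rewrite !tnth_mktuple (@le_trans _ _ 0)// oppr_le0.
Qed.

Lemma lebesgue_Rd_unique n (lam lam' : {measure set (n.-tuple R) -> \bar R}) :
  is_lebesgue_Rd lam -> is_lebesgue_Rd lam' ->
  forall A, measurable A -> lam A = lam' A.
Proof.
move=> h h'; apply: (measure_unique (boxes n) (cube n)) => //.
- exact: measurable_boxesE.
- exact: boxI.
- by move=> k; eexists; eexists; reflexivity.
- exact: bigcup_cube.
- move=> _ [a [b ->]]; have [ab|] := pselect (forall i, tnth a i <= tnth b i).
    by rewrite h// h'.
  move=> /existsNP[i /negP]; rewrite -ltNge => ba.
  suff -> : box a b = set0 by rewrite !measure0.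
  by apply/seteqP; split => // x /(_ i) /andP[/le_trans H /H]; rewrite leNgt ba.
- exact: lebesgue_Rd_boxlty.
Qed.

Lemma lebesgue_Rd_sigma_finite n (lam : {measure set (n.-tuple R) -> \bar R}) :
  is_lebesgue_Rd lam -> sigma_finite setT lam.
Proof.
move=> hl; exists (cube n); first by rewrite bigcup_cube.
by move=> k; split; [exact: measurable_box|exact: lebesgue_Rd_boxlty].
Qed.

Lemma measurable_dotp d (T : measurableType d) n (f g : T -> n.-tuple R) :
  measurable_fun setT f -> measurable_fun setT g ->
  measurable_fun setT (fun x => dotp (f x) (g x)).
Proof.
move=> /measurable_fun_tnthP mf /measurable_fun_tnthP mg.
apply: measurable_sum => i; apply: measurable_funM.
  exact: mf.
exact: mg.
Qed.

Lemma dotp_cons n (x y : R) (s t : n.-tuple R) :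
  dotp [tuple of x :: s] [tuple of y :: t] = x * y + dotp s t.
Proof.
rewrite /dotp big_ord_recl !tnth0; congr (_ + _).
by apply: eq_bigr => i _; rewrite !tnthS.
Qed.

Lemma dotpp_ge0 n (x : n.-tuple R) : 0 <= dotp x x.
Proof. by apply: sumr_ge0 => i _; exact: sqr_ge0. Qed.

(** The summand 1 keeps the function nonnegative, so that Tonelli's theorem and weighted measures
    apply. For [theta = pi / 2] and [xi = 0] it is the plain Gaussian; for [theta = pi] it contains
    the [1 - cos] of the Levy-Khintchine formula. *)
Definition gauss_phase n (a theta : R) (xi x : n.-tuple R) : R :=
  expR (- (a * dotp x x)) * (1 + cos (theta + dotp xi x)).

Lemma gauss_phase_ge0 n a theta (xi x : n.-tuple R) : 0 <= gauss_phase a theta xi x.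
Proof.
by rewrite mulr_ge0 ?expR_ge0// -lerBlDl sub0r cos_geN1.
Qed.

Lemma measurable_gauss_phase n a theta (xi : n.-tuple R) :
  measurable_fun setT (gauss_phase a theta xi).
Proof.
apply: measurable_funM.
  apply: measurableT_comp => //; apply: measurableT_comp => //.
  by apply: measurable_funM => //; exact: measurable_dotp.
apply: measurable_funD => //; apply: measurableT_comp.
  by apply: continuous_measurable_fun; exact: continuous_cos.
by apply: measurable_funD => //; exact: measurable_dotp.
Qed.

(** The measure is an iterated product. The Gaussian integral belongs to the induction because
    splitting off a coordinate only adds [x0 * x] to the phase, which is why [theta] is
    arbitrary. *)
Lemma exists_lebesgue_Rd n : exists L : {measure set (n.-tuple R) -> \bar R},
  is_lebesgue_Rd L /\ forall (a theta : R) (xi : n.-tuple R), 0 < a ->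
   (\int[L]_x (gauss_phase a theta xi x)%:E =
    (Num.sqrt (pi / a) ^+ n * (1 + cos theta * expR (- (dotp xi xi / (4 * a)))))%:E)%E.
Proof.
elim: n => [|n [L [hL gL]]].
  exists (dirac ([tuple] : 0.-tuple R)); split.
    move=> a b _; rewrite big_ord0 /= /dirac indicE mem_set//.
    by case.
  move=> a theta xi a0; rewrite integral_dirac//; last first.
    by apply/measurable_EFinP; exact: measurable_gauss_phase.
  rewrite diracE mem_set// mul1e /gauss_phase /dotp !big_ord0 mulr0 oppr0 expR0.
  by rewrite addr0 mul0r oppr0 expR0 expr0 mulr1.
pose SL : {sigma_finite_measure set (n.-tuple R) -> \bar R} :=
  sigma_finite_of (lebesgue_Rd_sigma_finite hL).
pose c (z : R * n.-tuple R) : n.+1.-tuple R := [the n.+1.-tuple R of z.1 :: z.2].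
have mc : measurable_fun setT c by exact: measurable_cons.
exists (pushforward (leb \x SL)%E c); split.
  move=> /= a b ab; rewrite /pushforward.
  have := ab; case/tupleP: a {ab} => a0 a; case/tupleP: b => b0 b ab.
  rewrite (_ : _ @^-1` _ = `[a0, b0]%classic `*` box a b); last first.
    apply/seteqP; split => -[x y] /=.
      move=> h; split; first by have := h ord0; rewrite !tnth0 in_itv.
      by move=> i; have := h (lift ord0 i); rewrite !tnthS.
    rewrite in_itv/= => -[h1 h2] i; case: (unliftP ord0 i) => [j|] ->; rewrite ?tnthS ?tnth0//.
  rewrite product_measure1E//; last exact: measurable_box.
  rewrite [X in (_ * X)%E]hL; last by move=> i; have := ab (lift ord0 i); rewrite !tnthS.
  rewrite [X in (X * _)%E](_ : _ = leb `[a0, b0]%classic)//.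
  rewrite lebesgue_measure_itv/= big_ord_recl !tnth0 EFinM; congr (_ * _)%E.
    have := ab ord0; rewrite !tnth0 lte_fin le_eqVlt => /predU1P[->|->//].
    by rewrite ltxx subrr.
  by congr EFin; apply: eq_bigr => i _; rewrite !tnthS.
move=> a theta; case/tupleP => x0 xi a0.
rewrite ge0_integral_pushforward//; last 2 first.
- by apply/measurable_EFinP; exact: measurable_gauss_phase.
- by move=> y _; rewrite lee_fin gauss_phase_ge0.
rewrite preimage_setT fubini_tonelli1//; last 2 first.
- apply: measurableT_comp; last exact: mc.
  by apply/measurable_EFinP; exact: measurable_gauss_phase.
- by move=> y; rewrite /= lee_fin gauss_phase_ge0.
rewrite /fubini_F /=.
(* The induction hypothesis at phase [theta + x0 * x] evaluates the inner integral and leaves a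
   one-dimensional integral of the form treated by [integral_gauss_phase]. *)
have E x : (\int[SL]_y (gauss_phase a theta [tuple of x0 :: xi] (c (x, y)))%:E =
   (Num.sqrt (pi / a) ^+ n)%:E * (gaussian a x * (1 + expR (- (dotp xi xi / (4 * a))) * cos (theta + x0 * x)))%:E)%E.
  transitivity (\int[SL]_y ((gaussian a x)%:E * (gauss_phase a (theta + x0 * x) xi y)%:E))%E.
    apply: eq_integral => y _; rewrite -EFinM; congr EFin.
    rewrite /gauss_phase /c !dotp_cons addrA [RHS]mulrA /gaussian -expRD.
    by congr (expR _ * _); rewrite /=; ring.
  rewrite ge0_integralZl//; last 3 first.
  - by apply/measurable_EFinP; exact: measurable_gauss_phase.
  - by move=> y _; rewrite lee_fin gauss_phase_ge0.
  - by rewrite lee_fin gaussian_ge0.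
  rewrite gL// -!EFinM; congr EFin; ring.
under eq_integral do rewrite E.
rewrite ge0_integralZl//; last 2 first.
- apply/measurable_EFinP; apply: measurable_funM; first exact: measurable_gaussian.
  apply: measurable_funD => //; apply: measurable_funM => //; apply: measurableT_comp.
    by apply: continuous_measurable_fun; exact: continuous_cos.
  by apply: measurable_funD => //; exact: measurable_funM.
- move=> x _; rewrite lee_fin mulr_ge0 ?gaussian_ge0//.
  set e := expR _; set k := cos _.
  have e1 : e <= 1 by rewrite -expR0 ler_expR oppr_le0 divr_ge0 ?dotpp_ge0// mulr_ge0// ltW.
  have e0 : 0 <= e by exact: expR_ge0.
  have := cos_geN1 (theta + x0 * x); rewrite -/k => k1.
  by nra.
rewrite integral_gauss_phase//; last first.
  by rewrite ger0_norm ?expR_ge0// -expR0 ler_expR oppr_le0 divr_ge0 ?dotpp_ge0// mulr_ge0// ltW.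
rewrite -EFinM; congr EFin.
have -> : dotp [tuple of x0 :: xi] [tuple of x0 :: xi] / (4 * a) =
    x0 ^+ 2 / (4 * a) + dotp xi xi / (4 * a) by rewrite dotp_cons; ring.
by rewrite opprD expRD [_ ^+ n.+1]exprSr; ring.
Unshelve. all: exact: mc.
Qed.

Lemma integral_gauss_phase_Rd n (lam : {measure set (n.-tuple R) -> \bar R})
  (a theta : R) (xi : n.-tuple R) : is_lebesgue_Rd lam -> 0 < a ->
   (\int[lam]_x (gauss_phase a theta xi x)%:E =
    (Num.sqrt (pi / a) ^+ n * (1 + cos theta * expR (- (dotp xi xi / (4 * a)))))%:E)%E.
Proof.
move=> hl a0; have [L [hL gL]] := exists_lebesgue_Rd n.
rewrite -gL//; apply: eq_measure_integral => A mA _; exact: lebesgue_Rd_unique.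
Qed.

End tuple_lebesgue.

(** * Rotation invariance and polar coordinates from Gaussian moments *)

Section polar.
Context {R : realType}.
Local Notation leb := (@lebesgue_measure R).

Lemma moment_of_wmeasure d (T : measurableType d) (mu : {measure set T -> \bar R})
    (w : T -> R) (mw : measurable_fun setT w) (w0 : forall x, 0 <= w x)
    (phi : T -> R) (k : nat) : measurable_fun setT phi -> (forall x, 0 <= phi x) ->
  moment_of (wmeasure mu mw w0) phi k = fine (\int[mu]_x (phi x ^+ k * w x)%:E)%E.
Proof.
move=> mphi phi0; rewrite /moment_of /Rintegral ge0_integral_wmeasure//.
- by apply/measurable_EFinP; exact: measurable_funX.
- by move=> x; rewrite lee_fin exprn_ge0.
Qed.

Lemma sqrtX_powR (y : R) n : 0 <= y -> Num.sqrt y ^+ n = y `^ (n%:R / 2).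
Proof.
by move=> y0; rewrite -powR12_sqrt// -powR_mulrn ?powR_ge0// -powRrM mulrC.
Qed.

Definition zerot n : n.-tuple R := [tuple 0 | _ < n].

Lemma dotp0l n (x : n.-tuple R) : dotp (zerot n) x = 0.
Proof. by rewrite /dotp big1// => i _; rewrite tnth_mktuple mul0r. Qed.

Variables (d : nat) (lam : {measure set (d.-tuple R) -> \bar R}).
Hypotheses (hd : (0 < d)%N) (hl : is_lebesgue_Rd lam).

Local Notation sq x := (dotp x x).

Lemma measurable_sq : measurable_fun setT (fun x : d.-tuple R => sq x).
Proof. exact: measurable_dotp. Qed.

(** Maps R^d into [[0, 1]], where moments determine a measure; its powers are again Gaussians, so
    these moments are known. *)
Definition phi_sq (x : d.-tuple R) : R := expR (- sq x).

Lemma measurable_phi_sq : measurable_fun setT phi_sq.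
Proof. by apply: measurableT_comp => //; apply: measurableT_comp => //; exact: measurable_sq. Qed.

Lemma phi_sq_ge0 x : 0 <= phi_sq x. Proof. exact: expR_ge0. Qed.

Lemma phi_sq01 x : 0 <= phi_sq x <= 1.
Proof. by rewrite phi_sq_ge0 -expR0 ler_expR oppr_le0 dotpp_ge0. Qed.

Lemma phi_sqX x k (y : R) : phi_sq x ^+ k * (expR (- (1 * sq x)) * y) = expR (- (k.+1%:R * sq x)) * y.
Proof.
rewrite mulrA -expRM_natl -expRD; congr (expR _ * _).
by rewrite -natr1; ring.
Qed.

Lemma phase_moment (theta : R) (xi : d.-tuple R) k :
  (\int[lam]_x (phi_sq x ^+ k * gauss_phase 1 theta xi x)%:E =
   (Num.sqrt (pi / k.+1%:R) ^+ d * (1 + cos theta * expR (- (sq xi / (4 * k.+1%:R)))))%:E)%E.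
Proof.
rewrite -(@integral_gauss_phase_Rd _ _ lam)//.
by apply: eq_integral => x _; rewrite /gauss_phase phi_sqX.
Qed.

Lemma phase_fin (theta : R) (xi : d.-tuple R) :
  (wmeasure lam (measurable_gauss_phase 1 theta xi) (gauss_phase_ge0 1 theta xi) setT < +oo)%E.
Proof.
have E : (\int[lam]_x (gauss_phase 1 theta xi x)%:E =
  \int[lam]_x (phi_sq x ^+ 0 * gauss_phase 1 theta xi x)%:E)%E.
  by apply: eq_integral => x _; rewrite expr0 mul1r.
by rewrite /wmeasure E phase_moment ltry.
Qed.

(** A substitute for rotation invariance: the moments of [phi_sq] under the two weighted measures
    involve [xi] only through [|xi|^2]. *)
Lemma radial_phase (theta : R) (xi xi' : d.-tuple R) (f : R -> \bar R) : sq xi = sq xi' ->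
  measurable_fun setT f -> (forall u, 0 <= f u)%E ->
  (\int[lam]_x (f (phi_sq x) * (gauss_phase 1 theta xi x)%:E) =
   \int[lam]_x (f (phi_sq x) * (gauss_phase 1 theta xi' x)%:E))%E.
Proof.
move=> e mf f0.
have mfp : measurable_fun setT (fun x => f (phi_sq x)).
  by apply: measurableT_comp => //; exact: measurable_phi_sq.
have W x0 := ge0_integral_wmeasure lam (measurable_gauss_phase 1 theta x0)
  (gauss_phase_ge0 1 theta x0) mfp (fun x => f0 (phi_sq x)).
apply: (etrans (esym (W xi))); apply: (etrans _ (W xi')).
apply: (@moment_unique R _ _ _ phi_sq (phase_fin theta xi) measurable_phi_sq phi_sq01
  _ _ _ phi_sq (phase_fin theta xi') measurable_phi_sq phi_sq01 _ f mf f0).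
move=> k; rewrite !moment_of_wmeasure; try exact: measurable_phi_sq; try exact: phi_sq_ge0.
by rewrite !phase_moment e.
Qed.

(** Half the area of the unit sphere; the half comes from the variable [s = |x|^2], for which [dx]
    becomes [polar_cst * s^(d/2 - 1) ds]. *)
Definition polar_cst : R := pi `^ (d%:R / 2) / Gamma (d%:R / 2).
Let d2 : 0 < d%:R / 2 :> R. Proof. by rewrite divr_gt0// ltr0n. Qed.

Lemma polar_cst_gt0 : 0 < polar_cst.
Proof. by rewrite divr_gt0 ?powR_gt0 ?pi_gt0// Gamma_gt0. Qed.

Definition polar_w (s : R) : R := polar_cst * gamma_density (d%:R / 2) s.
Lemma measurable_polar_w : measurable_fun setT polar_w.
Proof. by apply: measurable_funM => //; exact: measurable_gamma_density. Qed.
Lemma polar_w_ge0 s : 0 <= polar_w s.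
Proof. by rewrite mulr_ge0 ?gamma_density_ge0 ?(ltW polar_cst_gt0). Qed.

(** The truncation at 0 keeps the values in [[0, 1]] on the whole line; on [s <= 0] the densities
    integrated against it vanish. *)
Definition phi_max (s : R) : R := expR (- Num.max 0 s).
Lemma measurable_phi_max : measurable_fun setT phi_max.
Proof.
apply: measurableT_comp => //; apply: measurableT_comp => //.
exact: measurable_maxr.
Qed.
Lemma phi_max01 s : 0 <= phi_max s <= 1.
Proof. by rewrite expR_ge0 -expR0 ler_expR oppr_le0 le_max lexx. Qed.

Lemma phi_max_moment k : (\int[leb]_s (phi_max s ^+ k * polar_w s)%:E =
   (Num.sqrt (pi / k.+1%:R) ^+ d)%:E)%E.
Proof.
transitivity (\int[leb]_s (polar_cst%:E * (gamma_density (d%:R / 2) s * expR (- (k%:R * s)))%:E))%E.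
  apply: eq_integral => s _; rewrite -EFinM; congr EFin.
  rewrite /polar_w mulrCA; congr (_ * _).
  rewrite /gamma_density; case: ifPn => s0; last by rewrite mulr0 mul0r.
  rewrite mulrC /phi_max -expRM_natl; congr (_ * expR _).
  by rewrite (max_idPr (ltW s0)); ring.
rewrite ge0_integralZl//; last 3 first.
- apply/measurable_EFinP; apply: measurable_funM; first exact: measurable_gamma_density.
  by apply: measurableT_comp => //; apply: measurableT_comp => //; exact: measurable_funM.
- by move=> s _; rewrite lee_fin mulr_ge0 ?gamma_density_ge0 ?expR_ge0.
- by rewrite lee_fin (ltW polar_cst_gt0).
rewrite integral_gamma_scale// -EFinM; congr EFin.
rewrite sqrtX_powR ?divr_ge0 ?pi_ge0// powRM ?pi_ge0// ?invr_ge0//.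
rewrite /polar_cst mulrA divfK ?gt_eqF ?Gamma_gt0//; congr (_ * _).
by rewrite natr1 -[in RHS]powR_inv1// -powRrM mulN1r.
Qed.

(** Under [exp (- |x|^2) dx] the function [phi_sq] has the moments [sqrt (pi / (k + 1))^d], which
    are also those of [phi_max] under [polar_w]. The function [f] recovers [s] from [exp (- s)]. *)
Lemma polar (G : R -> R) : measurable_fun setT G -> (forall s, 0 <= G s) ->
  (\int[lam]_x (G (sq x) * expR (- sq x))%:E = \int[leb]_s (G s * polar_w s)%:E)%E.
Proof.
move=> mG G0.
(* This phase makes the cosine term vanish. *)
pose th : R := pi / 2.
pose f (u : R) : \bar R := (G (- ln u))%:E.
have mf : measurable_fun setT f.
  apply/measurable_EFinP; apply: measurableT_comp => //; exact: measurableT_comp.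
have f0 u : (0 <= f u)%E by rewrite lee_fin.
have mfp : measurable_fun setT (fun x => f (phi_sq x)).
  by apply: measurableT_comp => //; exact: measurable_phi_sq.
have mfm : measurable_fun setT (fun x => f (phi_max x)).
  by apply: measurableT_comp => //; exact: measurable_phi_max.
have := @moment_unique R _ _ (wmeasure lam (measurable_gauss_phase 1 th (zerot d)) (gauss_phase_ge0 1 th (zerot d)))
  phi_sq (phase_fin _ _) measurable_phi_sq phi_sq01 _ _ (wmeasure leb measurable_polar_w polar_w_ge0)
  phi_max _ measurable_phi_max phi_max01 _ f mf f0.
rewrite ge0_integral_wmeasure// ge0_integral_wmeasure// => H.
transitivity (\int[lam]_x (f (phi_sq x) * (gauss_phase 1 th (zerot d) x)%:E))%E.
  apply: eq_integral => x _; rewrite -EFinM; congr EFin.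
  rewrite /phi_sq expRK opprK /gauss_phase dotp0l addr0 /th cos_pihalf addr0 mulr1.
  by rewrite mul1r.
rewrite H.
- apply: eq_integral => s _; rewrite -EFinM; congr EFin.
  rewrite /phi_max expRK opprK /polar_w /gamma_density; case: ifPn => s0; last by rewrite !mulr0.
  by rewrite (max_idPr (ltW s0)).
- apply: (@le_lt_trans _ _ (\int[leb]_s (phi_max s ^+ 0 * polar_w s)%:E)%E).
    rewrite le_eqVlt; apply/orP; left; apply/eqP; apply: eq_integral => x _.
    by rewrite expr0 mul1r.
  by rewrite phi_max_moment ltry.
- move=> k; rewrite !moment_of_wmeasure; try exact: measurable_phi_sq; try exact: phi_sq_ge0;
    try exact: measurable_phi_max; try by move=> x; exact: expR_ge0.
  by rewrite phase_moment phi_max_moment /th cos_pihalf mul0r addr0 mulr1.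
Qed.

End polar.

(** * The Levy-Khintchine exponent and subordination *)

Lemma nonincreasing_in_measurable {R : realType} (D : set R) (f : R -> R) :
  measurable D -> is_interval D ->
  (forall x y, D x -> D y -> x <= y -> f y <= f x) -> measurable_fun D f.
Proof.
move=> mD iD fD.
apply: (measurability (@RGenCInfty.G R)) => [|/= _ [_] [r] -> <-].
  exact: RGenCInfty.measurableE.
apply: is_interval_measurable => s t /= [Ds +] [Dt +] u /andP[su ut].
rewrite !in_itv/= !andbT => fs ft.
have Du : D u by apply: (iD s t) => //; rewrite su ut.
by split => //; rewrite (le_trans ft)// fD.
Qed.

Section exponent.
Context {R : realType}.
Local Notation leb := (@lebesgue_measure R).
Variables (d : nat) (lam : {measure set (d.-tuple R) -> \bar R}) (nu : d.-tuple R -> R).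
Hypotheses (hd : (0 < d)%N) (hl : is_lebesgue_Rd lam) (hnu : radial_nonincr nu).
Local Notation sq x := (dotp x x).
Let i0 : 'I_d := Ordinal hd.

Lemma dotp_radial_pt r (x : d.-tuple R) : dotp (radial_pt d r) x = r * tnth x i0.
Proof.
rewrite /dotp (bigD1 i0)//= tnth_mktuple/= big1 ?addr0// => i ii0.
rewrite tnth_mktuple ifF ?mul0r//; apply: contra_neqF ii0 => /eqP h.
by apply/val_inj.
Qed.

Lemma enorm_radial_pt (r : R) : enorm (radial_pt d r) = `|r|.
Proof. by rewrite /enorm dotp_radial_pt tnth_mktuple/= -expr2 sqrtr_sqr. Qed.

Lemma enorm_ge0 (x : d.-tuple R) : 0 <= enorm x. Proof. exact: sqrtr_ge0. Qed.

Lemma sqr_enorm (x : d.-tuple R) : enorm x ^+ 2 = sq x.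
Proof. by rewrite /enorm sqr_sqrtr// dotpp_ge0. Qed.

Lemma enorm_gt0 (x : d.-tuple R) : (0 < enorm x) = (0 < sq x).
Proof. by rewrite /enorm sqrtr_gt0. Qed.

Lemma measurable_enorm : measurable_fun setT (fun x : d.-tuple R => enorm x).
Proof.
apply: (@measurableT_comp _ _ _ _ _ _ (@Num.sqrt R)); last exact: measurable_sq.
by apply: continuous_measurable_fun; exact: sqrt_continuous.
Qed.

Lemma measurable_Rd_nonzero : measurable (Rd_nonzero d : set (d.-tuple R)).
Proof.
rewrite (_ : Rd_nonzero d = setT `&` (fun x : d.-tuple R => enorm x) @^-1` `]0, +oo[%classic).
  by apply: measurable_enorm => //; exact: measurable_itv.
by apply/seteqP; split => x; rewrite /Rd_nonzero /= in_itv/= andbT => //; case.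
Qed.

Lemma radialE (f : d.-tuple R -> R) x y : radial_nonincr f -> 0 < enorm x ->
  enorm x = enorm y -> f x = f y.
Proof.
by move=> [_ h] x0 e; apply/eqP; rewrite eq_le !h// -?e.
Qed.

(** The Levy density as a function of [u = exp (- |x|^2)], divided by [u] to cancel the Gaussian
    factor of [gauss_phase]. That factor is what makes the weighted measure finite, so that
    [radial_phase] applies; [0 < u < 1] corresponds to [x] nonzero. *)
Let prof (u : R) : R := nu (radial_pt d (Num.sqrt (- ln u))) * u^-1.
Let F (u : R) : \bar R := ((EFin \o prof) \_ `]0, 1[) u.

Let sqrt_ln_gt0 (u : R) : 0 < u < 1 -> 0 < Num.sqrt (- ln u).
Proof. by move=> u01; rewrite sqrtr_gt0 oppr_gt0 ln_lt0. Qed.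

Let F_ge0 u : (0 <= F u)%E.
Proof.
apply: erestrict_ge0 => v /=; rewrite in_itv/= => v01.
rewrite lee_fin mulr_ge0//; last by rewrite invr_ge0; case/andP: v01 => /ltW.
by apply: hnu.1; rewrite enorm_radial_pt normr_gt0 gt_eqF// sqrt_ln_gt0.
Qed.

Let mF : measurable_fun setT F.
Proof.
apply/(measurable_restrictT _ _).1 => //; apply/measurable_EFinP.
apply: measurable_funM.
  rewrite -[X in measurable_fun _ X]opprK; apply: measurable_funN.
  apply: nonincreasing_in_measurable => //; first exact: interval_is_interval.
  move=> x y /=; rewrite !in_itv/= => hx hy xy; rewrite lerN2; apply: hnu.2.
    by rewrite enorm_radial_pt normr_gt0 gt_eqF// sqrt_ln_gt0.
  rewrite !enorm_radial_pt !ger0_norm ?sqrtr_ge0// ler_sqrt; last first.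
    by rewrite oppr_ge0 ltW// ln_lt0.
  by rewrite lerN2 ler_ln// posrE; [case/andP: hx|case/andP: hy].
apply: nonincreasing_in_measurable => //; first exact: interval_is_interval.
move=> x y /=; rewrite !in_itv/= => /andP[x0 _] /andP[y0 _] xy.
by rewrite lef_pV2 ?posrE.
Qed.

Lemma lk_integralE (xi : d.-tuple R) :
  (\int[lam]_(x in Rd_nonzero d) ((1 - cos (dotp xi x)) * nu x)%:E =
   \int[lam]_x (F (phi_sq x) * (gauss_phase 1 pi xi x)%:E))%E.
Proof.
rewrite integral_mkcond; apply: eq_integral => x _; rewrite patchE.
case: ifPn.
  rewrite inE /Rd_nonzero/= => x0.
  have s0 : 0 < sq x by rewrite -enorm_gt0.
  rewrite /F patchE ifT; last first.
    by rewrite inE/= in_itv/= /phi_sq expR_gt0 expR_lt1 oppr_lt0.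
  rewrite /= /prof /phi_sq expRK opprK -/(enorm x) -EFinM; congr EFin.
  rewrite -(@radialE nu x)//; last by rewrite enorm_radial_pt ger0_norm// enorm_ge0.
  rewrite /gauss_phase mul1r [pi + _]addrC cosDpi.
  by rewrite mulrA divfK ?gt_eqF ?expR_gt0// mulrC.
move=> /negP h; rewrite /F patchE ifF ?mul0e//.
apply/negP; rewrite inE/= in_itv/= /phi_sq => /andP[_]; rewrite expR_lt1 oppr_lt0 => s0.
by apply: h; rewrite inE /Rd_nonzero/= enorm_gt0.
Qed.

Definition psi (r : R) : R := lk_exponent lam nu (radial_pt d r).

Lemma lk_exponent_radial (xi : d.-tuple R) : lk_exponent lam nu xi = psi (enorm xi).
Proof.
rewrite /psi /lk_exponent !lk_integralE; congr fine.
apply: radial_phase => //.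
by rewrite -[in RHS]sqr_enorm enorm_radial_pt ger0_norm ?enorm_ge0// sqr_enorm.
Qed.

Lemma lk_exponent_ge0 (xi : d.-tuple R) : 0 <= lk_exponent lam nu xi.
Proof.
apply: fine_ge0; apply: integral_ge0 => x x0; rewrite lee_fin mulr_ge0//; exact: hnu.1.
Qed.

Lemma psi_ge0 r : 0 <= psi r. Proof. exact: lk_exponent_ge0. Qed.

Variable mu : R -> probability (d.-tuple R) R.
Hypothesis hmu : forall t, 0 < t -> forall xi : d.-tuple R,
     (\int[mu t]_x (cos (dotp xi x))%:E
        = (expR (- (t * lk_exponent lam nu xi)))%:E)%E /\
     (\int[mu t]_x (sin (dotp xi x))%:E = 0)%E.

Lemma measurable_cos_dotp (xi : d.-tuple R) : measurable_fun setT (fun x => cos (dotp xi x)).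
Proof.
apply: measurableT_comp; last exact: measurable_dotp.
by apply: continuous_measurable_fun; exact: continuous_cos.
Qed.

Lemma mu_lty t : (mu t setT < +oo)%E.
Proof. by apply: (le_lt_trans (probability_le1 (mu t) measurableT)); exact: ltry. Qed.

Lemma integral_mu1 t : (\int[mu t]_x 1 = 1)%E.
Proof. by rewrite integral_cst// mul1e; exact: probability_setT. Qed.

Lemma integrable_cos_dotp t (xi : d.-tuple R) :
  (mu t).-integrable setT (EFin \o (fun x => cos (dotp xi x))).
Proof.
apply: (@integrable_bounded01 _ _ _ (mu t) _ _ 1).
- exact: mu_lty.
- exact: measurable_cos_dotp.
- by move=> x; rewrite ler_norml cos_geN1 cos_le1.
Qed.

Lemma psi_char r : expR (- psi r) = \int[mu 1]_x cos (r * tnth x i0).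
Proof.
have [+ _] := hmu ltr01 (radial_pt d r); rewrite mul1r => H.
rewrite /Rintegral -[LHS]/(fine (expR (- psi r))%:E) -H.
by congr fine; apply: eq_integral => x _; rewrite dotp_radial_pt.
Qed.

(** Read off from the law at time 1: its characteristic function is continuous by domination by 1
    and equals the positive number [exp (- psi)], so the logarithm can be taken. *)
Lemma continuous_psi : continuous psi.
Proof.
move=> r.
have C : {for r, continuous (fun z : R => \int[mu 1]_x cos (z * tnth x i0))}.
  apply: (@continuity_under_integral _ _ _ (mu 1) (fun z x => cos (z * tnth x i0)) setT measurableT
    (r - 1) (r + 1) _ _ (cst 1)) => //.
  - move=> z _; have := integrable_cos_dotp 1 (radial_pt d z).
    by rewrite /comp; under eq_fun do rewrite dotp_radial_pt.
  - apply: aeW => x _ z _.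
    apply: (@is_derive_continuous _ _ _ (- (tnth x i0 * 1 * sin (z * tnth x i0)))).
    by have := is_derive_cosM 1 (tnth x i0) z; under eq_fun do rewrite mul1r.
  - apply: (@integrable_bounded01 _ _ _ (mu 1) _ _ 1) => //.
      exact: mu_lty.
    by move=> x; rewrite normr1.
  - move=> z _; apply: aeW => x _.
    by rewrite ler_norml cos_geN1 cos_le1.
  - by rewrite inE/= in_itv/= ltrBlDr !ltrDl ltr01.
have E z : psi z = - ln (\int[mu 1]_x cos (z * tnth x i0)).
  by rewrite -psi_char expRK opprK.
rewrite (_ : psi = (fun z => - ln (\int[mu 1]_x cos (z * tnth x i0)))); last exact/funext.
have C2 : {for r, continuous (fun z : R => ln (\int[mu 1]_x cos (z * tnth x i0)))}.
  have Cl : {for \int[mu 1]_x cos (r * tnth x i0), continuous (@ln R)}.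
    by apply: continuous_ln; rewrite -psi_char expR_gt0.
  exact: (continuous_comp C Cl).
by apply: cvgN.
Qed.

Definition scalet (r : R) (x : d.-tuple R) : d.-tuple R := [tuple r * tnth x i | i < d].

Lemma dotp_scaletl r x y : dotp (scalet r x) y = r * dotp x y.
Proof. by rewrite /dotp mulr_sumr; apply: eq_bigr => i _; rewrite tnth_mktuple mulrA. Qed.

Lemma dotpC (x y : d.-tuple R) : dotp x y = dotp y x.
Proof. by apply: eq_bigr => i _; rewrite mulrC. Qed.

Lemma enorm_scalet r x : 0 <= r -> enorm (scalet r x) = r * enorm x.
Proof.
move=> r0; rewrite /enorm dotp_scaletl dotpC dotp_scaletl mulrA -expr2.
by rewrite sqrtrM ?sqr_ge0// sqrtr_sqr ger0_norm.
Qed.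

Lemma integral_1Dcos t (xi : d.-tuple R) : 0 < t ->
  (\int[mu t]_x (1 + cos (dotp xi x))%:E = (1 + expR (- (t * lk_exponent lam nu xi)))%:E)%E.
Proof.
move=> t0; under eq_integral do rewrite EFinD.
have i1 : (mu t).-integrable setT (cst 1%:E).
  apply: (@integrable_bounded01 _ _ _ (mu t) _ (cst 1) 1) => //.
    exact: mu_lty.
  by move=> x; rewrite normr1.
rewrite (integralD measurableT i1 (integrable_cos_dotp t xi)) integral_mu1.
by rewrite (hmu t0 xi).1.
Qed.

Let d2 : 0 < d%:R / 2 :> R. Proof. by rewrite divr_gt0// ltr0n. Qed.

Lemma measurable_psi_sqrt (rho : R) : measurable_fun setT (fun s : R => psi (rho * Num.sqrt s)).
Proof.
apply: (@measurableT_comp _ _ _ _ _ _ psi _ (fun s : R => rho * Num.sqrt s)).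
  by apply: continuous_measurable_fun; exact: continuous_psi.
apply: measurable_funM => //.
by apply: continuous_measurable_fun; exact: sqrt_continuous.
Qed.

(** The function [exp (- |y|^2) * (1 + cos (rho * dotp x y))] is integrated against [mu t] in [x]
    and Lebesgue measure in [y], in both orders. Integrating [y] first uses the Gaussian Fourier
    transform; integrating [x] first uses the characteristic function, then polar coordinates. *)
Lemma subordination t rho : 0 < t -> 0 < rho ->
  (\int[mu t]_x (expR (- (rho ^+ 2 / 4 * sq x)))%:E =
   ((Gamma (d%:R / 2))^-1)%:E *
     \int[leb]_s (expR (- (t * psi (rho * Num.sqrt s))) * gamma_density (d%:R / 2) s)%:E)%E.
Proof.
move=> t0 rho0.
pose slam : {sigma_finite_measure set (d.-tuple R) -> \bar R} :=
  sigma_finite_of (lebesgue_Rd_sigma_finite hl).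
pose f (z : d.-tuple R * d.-tuple R) : \bar R := (gauss_phase 1 0 (scalet rho z.1) z.2)%:E.
have f0 z : (0 <= f z)%E by rewrite lee_fin gauss_phase_ge0.
have fE z : f z = (expR (- sq z.2) * (1 + cos (rho * dotp z.1 z.2)))%:E.
  by rewrite /f /gauss_phase mul1r add0r dotp_scaletl.
have mf : measurable_fun setT f.
  rewrite (_ : f = fun z => (expR (- sq z.2) * (1 + cos (rho * dotp z.1 z.2)))%:E); last exact/funext.
  apply/measurable_EFinP; apply: measurable_funM.
    by apply: measurableT_comp => //; apply: measurableT_comp => //; exact: measurable_dotp.
  apply: measurable_funD => //; apply: measurableT_comp.
    by apply: continuous_measurable_fun; exact: continuous_cos.
  by apply: measurable_funM => //; exact: measurable_dotp.
have FT := @fubini_tonelli _ _ _ _ _ (mu t) slam f mf f0.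
pose P : R := pi `^ (d%:R / 2).
have P0 : 0 < P by rewrite powR_gt0// pi_gt0.
pose X := (\int[mu t]_x (expR (- (rho ^+ 2 / 4 * sq x)))%:E)%E.
pose Y := (\int[leb]_s (expR (- (t * psi (rho * Num.sqrt s))) * gamma_density (d%:R / 2) s)%:E)%E.
have mX : measurable_fun setT (fun x : d.-tuple R => (expR (- (rho ^+ 2 / 4 * sq x)))%:E).
  apply/measurable_EFinP; apply: measurableT_comp => //; apply: measurableT_comp => //.
  by apply: measurable_funM => //; exact: measurable_sq.
have mY : measurable_fun setT (fun s : R => (expR (- (t * psi (rho * Num.sqrt s))) * gamma_density (d%:R / 2) s)%:E).
  apply/measurable_EFinP; apply: measurable_funM; last exact: measurable_gamma_density.
  apply: measurableT_comp => //; apply: measurableT_comp => //.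
  by apply: measurable_funM => //; exact: measurable_psi_sqrt.
have E1 : (\int[mu t]_x \int[slam]_y f (x, y) = P%:E * (1 + X))%E.
  transitivity (\int[mu t]_x (P%:E * (1 + (expR (- (rho ^+ 2 / 4 * sq x)))%:E)))%E.
    apply: eq_integral => x _.
    transitivity (\int[lam]_y (gauss_phase 1 0 (scalet rho x) y)%:E)%E; first by [].
    rewrite integral_gauss_phase_Rd// cos0 mul1r divr1 sqrtX_powR ?pi_ge0//.
    rewrite -EFinD -EFinM dotp_scaletl dotpC dotp_scaletl mulr1; congr (_ * (1 + expR (- _)))%:E.
    by field.
  rewrite ge0_integralZl//; last 3 first.
  - exact: emeasurable_funD.
  - by move=> x _; rewrite -EFinD lee_fin addr_ge0// expR_ge0.
  - by rewrite lee_fin ltW.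
  rewrite ge0_integralD//.
  by rewrite integral_mu1.
have E2 : (\int[slam]_y \int[mu t]_x f (x, y) = P%:E + (polar_cst d)%:E * Y)%E.
  transitivity (\int[lam]_y ((1 + expR (- (t * psi (rho * Num.sqrt (sq y))))) * expR (- sq y))%:E)%E.
    apply: eq_integral => y _.
    transitivity (\int[mu t]_x ((expR (- sq y))%:E * (1 + cos (dotp (scalet rho y) x))%:E))%E.
      by apply: eq_integral => x _; rewrite fE/= dotp_scaletl dotpC EFinM.
    rewrite ge0_integralZl; [|exact: measurableT
     |by apply/measurable_EFinP; apply: measurable_funD => //; exact: measurable_cos_dotp
     |by move=> x _; rewrite lee_fin -lerBlDl sub0r cos_geN1
     |by rewrite lee_fin expR_ge0].
    rewrite integral_1Dcos// -EFinM mulrC lk_exponent_radial enorm_scalet//.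
    exact: ltW.
  have mh : measurable_fun setT (fun s : R => 1 + expR (- (t * psi (rho * Num.sqrt s)))).
    apply: measurable_funD => //; apply: measurableT_comp => //; apply: measurableT_comp => //.
    by apply: measurable_funM => //; exact: measurable_psi_sqrt.
  have h0 (s : R) : 0 <= 1 + expR (- (t * psi (rho * Num.sqrt s))).
    by rewrite addr_ge0// expR_ge0.
  rewrite (@polar _ _ lam hd hl _ mh h0).
  transitivity (\int[leb]_s ((polar_cst d)%:E * ((gamma_density (d%:R / 2) s)%:E +
     (expR (- (t * psi (rho * Num.sqrt s))) * gamma_density (d%:R / 2) s)%:E)))%E.
    by apply: eq_integral => s _; rewrite -EFinD -EFinM /polar_w; congr EFin; ring.
  have mg : measurable_fun setT (fun s : R => (gamma_density (d%:R / 2) s)%:E).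
    by apply/measurable_EFinP; exact: measurable_gamma_density.
  have g0 (s : R) : (0 <= (gamma_density (d%:R / 2) s)%:E)%E by rewrite lee_fin gamma_density_ge0.
  have e0 (s : R) : (0 <= (expR (- (t * psi (rho * Num.sqrt s))) * gamma_density (d%:R / 2) s)%:E)%E.
    by rewrite lee_fin; apply: mulr_ge0; [exact: expR_ge0|exact: gamma_density_ge0].
  rewrite ge0_integralZl; [|exact: measurableT
   |exact: emeasurable_funD
   |by move=> s _; apply: adde_ge0
   |by rewrite lee_fin ltW// polar_cst_gt0].
  rewrite ge0_integralD; [|exact: measurableT
   |by move=> s _|by []|by move=> s _|by []].
  rewrite integral_gamma_density// ge0_muleDr//; last 2 first.
  - by rewrite lee_fin ltW// Gamma_gt0.
  - by apply: integral_ge0 => s _; rewrite lee_fin mulr_ge0 ?gamma_density_ge0 ?expR_ge0.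
  by rewrite -EFinM /polar_cst divfK// gt_eqF// Gamma_gt0.
have Xfin : X \is a fin_num.
  rewrite ge0_fin_numE; last by apply: integral_ge0 => x _; rewrite lee_fin expR_ge0.
  apply: (@le_lt_trans _ _ (\int[mu t]_x 1)%E); last by rewrite integral_mu1 ltry.
  apply: ge0_le_integral => //.
  move=> x _; rewrite lee_fin -[leRHS]expR0 ler_expR oppr_le0 mulr_ge0 ?dotpp_ge0//.
  by rewrite divr_ge0// sqr_ge0.
have Yfin : Y \is a fin_num.
  rewrite ge0_fin_numE; last by apply: integral_ge0 => s _; rewrite lee_fin mulr_ge0 ?gamma_density_ge0 ?expR_ge0.
  apply: (le_lt_trans _ (gamma_density_lty d2)); apply: ge0_le_integral => //.
  - by move=> s _; rewrite lee_fin mulr_ge0 ?gamma_density_ge0 ?expR_ge0.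
  - by apply/measurable_EFinP; exact: measurable_gamma_density.
  - move=> s _; rewrite lee_fin ler_piMl ?gamma_density_ge0// -[leRHS]expR0 ler_expR oppr_le0.
    by rewrite mulr_ge0 ?psi_ge0// ltW.
(* Tonelli's theorem equates the two iterated integrals. The summand 1 contributes [P] to both and
   cancels, [X] and [Y] being finite. *)
have : (P%:E * (1 + X) = P%:E + (polar_cst d)%:E * Y)%E by rewrite -E1 -E2.
rewrite -/X -/Y -(fineK Xfin) -(fineK Yfin) -EFinD -!EFinM -EFinD => -[].
rewrite /polar_cst -/P mulrDr mulr1 => /addrI.
by rewrite -mulrA => /(mulfI (lt0r_neq0 P0)) ->.
Qed.

End exponent.

(** * Bounds for the de Haan class *)

Section deHaan_bound.
Context {R : realType}.
Variables F L : R -> R.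
Hypothesis L_gt0 : exists a : R, forall u, a <= u -> 0 < L u.
Hypothesis L_slow : forall v : R, L (u + v) / L u @[u --> +oo] --> (1 : R).
Hypothesis F_haan : forall v : R, (F (u + v) - F u) / L u @[u --> +oo] --> v.
Hypothesis F_cont : continuous F.
Hypothesis F_bnd : forall U : R, exists M : R, forall u, u <= U -> `|F u| <= M.

Lemma pinfty_ex_ge (P : R -> Prop) : (\forall u \near +oo, P u) ->
  exists U, forall u, U <= u -> P u.
Proof.
move=> [U [_ hU]]; exists (U + 1) => u Uu; apply: hU.
by apply: lt_le_trans Uu; rewrite ltrDl.
Qed.

Lemma deHaan_near (v eps : R) : 0 < eps -> exists U : R, forall u, U <= u ->
  0 < L u /\ `|F (u + v) - F u - v * L u| <= eps * L u.
Proof.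
move=> e0; have [a ha] := L_gt0.
have /cvgrPdist_le /(_ _ e0) /pinfty_ex_ge [U hU] := @F_haan v.
exists (Num.max a U) => u; rewrite ge_max => /andP[au Uu].
have Lu := ha _ au; split => //.
have := hU _ Uu; rewrite distrC => h.
have -> : F (u + v) - F u - v * L u = ((F (u + v) - F u) / L u - v) * L u.
  by rewrite mulrBl divfK// gt_eqF.
by rewrite normrM (gtr0_norm Lu) ler_wpM2r// ltW.
Qed.

Lemma slow_near (v theta : R) : 1 < theta -> exists U : R, forall u, U <= u ->
  0 < L u /\ L (u + v) <= theta * L u.
Proof.
move=> t1; have [a ha] := L_gt0.
have /cvgr_le /(_ _ t1) /pinfty_ex_ge [U hU] := @L_slow v.
exists (Num.max a U) => u; rewrite ge_max => /andP[au Uu].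
have Lu := ha _ au; split => //.
by have := hU _ Uu; rewrite ler_pdivrMr.
Qed.

(** The shifts for which the bound with constant [n] fails at some [u >= n]. Each member of the
    union is open by continuity of [F], whatever [L] is. *)
Let bad (n : nat) : set R :=
  \bigcup_(u in [set u : R | n%:R <= u]) ((fun v : R => `|F (u + v) - F u|) @^-1` [set y : R | n%:R * L u < y]).

Let F_shift (u v : R) : F (u + w) @[w --> v] --> F (u + v).
Proof.
apply: (@cvg_comp _ _ _ (fun w : R => u + w) F _ (nbhs (u + v))); last exact: F_cont.
by apply: cvgD; [exact: cvg_cst|exact: cvg_id].
Qed.

Let open_bad n : open (bad n).
Proof.
apply: bigcup_open => u _; apply: open_comp; last exact: open_gt.
move=> v _; apply: cvg_norm; apply: cvgB; last exact: cvg_cst.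
exact: F_shift.
Qed.

Let not_bad (v : R) : exists n, ~ bad n v.
Proof.
have [U hU] := deHaan_near v ltr01.
pose m := Num.max U (`|v| + 1).
exists (Num.truncn `|m|).+1 => -[u /= nu]; rewrite ltNge => /negP; apply.
have mn : m <= (Num.truncn `|m|).+1%:R.
  by rewrite (le_trans (ler_norm _))// ltW// truncnS_gt.
have [Uu vu] : U <= u /\ `|v| + 1 <= (Num.truncn `|m|).+1%:R.
  split.
    by rewrite (le_trans _ nu)// (le_trans _ mn)// le_max lexx.
  by rewrite (le_trans _ mn)// le_max lexx orbT.
have [Lu h] := hU _ Uu.
apply: (@le_trans _ _ ((`|v| + 1) * L u)); last by rewrite ler_wpM2r// ltW.
rewrite mulrDl; have -> : F (u + v) - F u = v * L u + (F (u + v) - F u - v * L u) by ring.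
rewrite (le_trans (ler_normD _ _))// lerD// normrM (gtr0_norm Lu)//.
Qed.

(* Baire: a uniform bound on an interval of shifts replaces the uniform
   convergence theorem, without any measurability assumption on [L]. *)
Let shift_interval : exists (n : nat) (c dl : R), 0 < dl /\
  forall v u : R, `|v - c| <= dl -> n%:R <= u -> `|F (u + v) - F u| <= n%:R * L u.
Proof.
have [n nd] : exists n, ~ dense (bad n).
  apply: contrapT => /forallNP h.
  have D : dense (\bigcap_i bad i).
    by apply: (@Baire R R^o) => i; split; [exact: open_bad|exact: contrapT (h i)].
  have [v [_ hv]] := D setT (ex_intro _ 0 Logic.I) openT.
  by have [n] := not_bad v; apply; exact: hv.
move/existsNP: nd => [W /not_implyP [[c Wc] /not_implyP [oW hW]]].
have W0 : W `&` bad n = set0.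
  by apply: contrapT => ne; apply: hW; apply/set0P/eqP.
have /nbhs_ballP[e /= e0 be] := open_nbhs_nbhs (conj oW Wc).
exists n, c, (e / 2); split; first by rewrite divr_gt0.
move=> v u vc nu; rewrite leNgt; apply/negP => h.
have : (W `&` bad n) v.
  split; last by exists u.
  apply: be; rewrite /ball/= distrC (le_lt_trans vc)// ltr_pdivrMr// ltr_pMr// ltr1n.
  by [].
by rewrite W0.
Qed.

(** The interval around [c] is moved to 0 by comparing [F (u + w)] and [F u] with [F (u - c)]; slow
    variation at shift [- c] then replaces [L (u - c)] by [2 * L u]. *)
Let local_bound : exists (C dl U : R), [/\ 0 < C, 0 < dl &
  forall u, U <= u -> 0 < L u /\ forall w : R, `|w| <= dl -> `|F (u + w) - F u| <= C * L u].
Proof.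
have [n [c [dl [dl0 h]]]] := shift_interval.
have t1 : (1 : R) < 2 by rewrite ltr1n.
have [U hU] := slow_near (- c) t1.
(* Two comparisons, each costing [n * 2 * L u]; the successor makes the constant positive. *)
exists (4 * n.+1%:R), dl, (Num.max U (n%:R + c)); split => //.
move=> u; rewrite ge_max => /andP[Uu cu].
have [Lu Lc] := hU _ Uu; split => // w wdl.
have nu : n%:R <= u - c by rewrite lerBrDr.
have h1 := h (c + w) (u - c) _ nu.
have h2 := h c (u - c) _ nu.
rewrite subrr normr0 in h2; have {}h2 := h2 (ltW dl0).
rewrite subrK in h2.
have -> : F (u + w) - F u = (F (u - c + (c + w)) - F (u - c)) - (F u - F (u - c)).
  rewrite (_ : u - c + (c + w) = u + w); ring.
rewrite (le_trans (ler_normB _ _))//.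
have e1 : c + w - c = w by ring.
rewrite e1 in h1; have {}h1 := h1 wdl.
have : n%:R * L (u - c) <= n%:R * (2 * L u) by rewrite ler_wpM2l.
have : 0 <= 4 * L u by rewrite mulr_ge0// ltW.
rewrite -natr1; lra.
Qed.

Section chain.
Variables (C th rho U : R).
Hypotheses (C0 : 0 < C) (th1 : 1 < th).
Hypothesis step : forall u, U <= u -> [/\ 0 < L u, L (u + rho) <= th * L u &
  `|F (u + rho) - F u| <= C * L u].

(** The increments form a geometric sum, [C * (1 + th + ... + th^(k-1))], which is at most
    [C * th^k / (th - 1)]. Only the starting points of steps must lie beyond [U], hence [j < k]. *)
Lemma chain_bound (k : nat) u : (forall j, (j < k)%N -> U <= u + rho *+ j) -> 0 < L u ->
  L (u + rho *+ k) <= th ^+ k * L u /\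
  `|F (u + rho *+ k) - F u| <= C / (th - 1) * th ^+ k * L u.
Proof.
have th0 : 0 < th - 1 by rewrite subr_gt0.
have A0 : 0 <= C / (th - 1) by rewrite divr_ge0 ?ltW.
elim: k => [|k IH] hk Lu.
  by rewrite mulr0n addr0 expr0 mul1r mulr1 subrr normr0; split => //; rewrite mulr_ge0// ltW.
have [j jk|h1 h2] := IH _ Lu; first by apply: hk; rewrite (ltn_trans jk).
have [L1 L2 L3] := step (hk k (ltnSn k)).
rewrite mulrSr addrA; split.
  by rewrite (le_trans L2)// exprS -mulrA ler_wpM2l// (le_trans ler01)// ltW.
have -> : F (u + rho *+ k + rho) - F u =
  (F (u + rho *+ k + rho) - F (u + rho *+ k)) + (F (u + rho *+ k) - F u) by ring.
rewrite (le_trans (ler_normD _ _))//.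
have -> : C / (th - 1) * th ^+ k.+1 * L u =
   C * (th ^+ k * L u) + C / (th - 1) * th ^+ k * L u.
  by rewrite exprS; field; rewrite gt_eqF.
by rewrite lerD// (le_trans L3)// ler_wpM2l// ltW.
Qed.

End chain.

(** Steps of length [dl], each costing a factor [exp (dl / 2)] in [L], lead from [u] up, or down as
    far as [U]; below [U] the boundedness of [F] takes over. The rate [1 / 2] becomes [1 / 4] once a
    square root is inserted in the argument, and a power [s^(- 1/4)] is integrable against the Gamma
    density of parameter [d / 2 >= 1 / 2]. *)
Lemma deHaan_potter : exists C U : R, 0 < C /\ forall u, U <= u ->
  0 < L u /\ forall v : R, `|F (u + v) - F u| <= C * expR (`|v| / 2) * L u.
Proof.
have [C [dl [U1 [C0 dl0 loc]]]] := local_bound.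
pose th := expR (dl / 2).
have th1 : 1 < th by rewrite -expR0 ltr_expR divr_gt0.
have th0 : 0 < th - 1 by rewrite subr_gt0.
have [U2 sl2] := slow_near dl th1.
have [U3 sl3] := slow_near (- dl) th1.
have h12 : (0 : R) < 1 / 2 by rewrite divr_gt0.
have [U4 sl4] := deHaan_near 1 h12.
pose U := Num.max (Num.max U1 U2) (Num.max U3 U4).
have UE u : U <= u -> [/\ U1 <= u, U2 <= u, U3 <= u & U4 <= u].
  by rewrite !ge_max => /andP[/andP[-> ->] /andP[-> ->]].
have Lpos u : U <= u -> 0 < L u by move=> /UE[/loc[]].
have adl : `|dl| <= dl by rewrite gtr0_norm.
have step1 u : U <= u -> [/\ 0 < L u, L (u + dl) <= th * L u & `|F (u + dl) - F u| <= C * L u].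
  by move=> /UE[/loc[h1 h2] /sl2[_ h3] _ _]; split => //; exact: h2.
have step2 u : U <= u -> [/\ 0 < L u, L (u - dl) <= th * L u & `|F (u - dl) - F u| <= C * L u].
  by move=> /UE[/loc[h1 h2] _ /sl3[_ h3] _]; split => //; apply: h2; rewrite normrN.
pose A := C / (th - 1) + C.
have A0 : 0 < A by rewrite addr_gt0// divr_gt0.
have thk (v : R) k : dl *+ k <= v -> th ^+ k <= expR (v / 2).
  by move=> h; rewrite /th -expRM_natl ler_expR mulrA mulr_natl ler_pM2r.
have fl (v : R) : 0 <= v -> exists k : nat, dl *+ k <= v < dl *+ k + dl.
  move=> v0; exists (Num.truncn (v / dl)).
  have /andP[t1 t2] := truncn_itv (divr_ge0 v0 (ltW dl0)).
  apply/andP; split; first by rewrite -mulr_natl -ler_pdivlMr.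
  by rewrite -mulrSr -mulr_natl -ltr_pdivrMr.
have up (u v : R) : U <= u -> 0 <= v -> `|F (u + v) - F u| <= A * expR (v / 2) * L u.
  move=> Uu v0; have [k /andP[k1 k2]] := fl _ v0.
  have Lu := Lpos _ Uu.
  have hk j : U <= u + dl *+ j by rewrite (le_trans Uu)// lerDl mulrn_wge0// ltW.
  have [h1 h2] := chain_bound C0 th1 step1 (k := k) (fun j _ => hk j) Lu.
  have [_ h3] := loc _ (let: And4 h _ _ _ := UE _ (hk k) in h).
  have h4 : `|F (u + dl *+ k + (v - dl *+ k)) - F (u + dl *+ k)| <= C * L (u + dl *+ k).
    by apply: h3; rewrite ger0_norm ?subr_ge0// lerBlDl ltW.
  rewrite (_ : u + dl *+ k + (v - dl *+ k) = u + v) in h4; last by ring.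
  have -> : F (u + v) - F u = (F (u + v) - F (u + dl *+ k)) + (F (u + dl *+ k) - F u) by ring.
  rewrite (le_trans (ler_normD _ _))//.
  apply: (@le_trans _ _ (A * th ^+ k * L u)); last first.
    by rewrite ler_wpM2r ?(ltW Lu)// ler_wpM2l ?(ltW A0)// thk.
  have : C * L (u + dl *+ k) <= C * (th ^+ k * L u) by rewrite ler_wpM2l// ltW.
  by rewrite /A; lra.
have down (u v : R) : 0 <= v -> U <= u - v -> `|F (u - v) - F u| <= A * expR (v / 2) * L u
    /\ exists w, [/\ 0 <= w, w < dl & L (u - v + w) <= expR (v / 2) * L u].
  move=> v0 Uv; have [k /andP[k1 k2]] := fl _ v0.
  have Uu : U <= u by rewrite (le_trans Uv)// gerBl.
  have Lu := Lpos _ Uu.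
  have hk j : (j <= k)%N -> U <= u + (- dl) *+ j.
    move=> jk; rewrite (le_trans Uv)// lerD2l mulNrn lerN2 (le_trans _ k1)//.
    by rewrite ler_pMn2l.
  have [h1 h2] := chain_bound C0 th1 step2 (k := k) (fun j jk => hk j (ltnW jk)) Lu.
  have [_ h3] := loc _ (let: And4 h _ _ _ := UE _ (hk k (leqnn k)) in h).
  rewrite mulNrn in h1 h2 h3.
  have h4 : `|F (u - dl *+ k + (dl *+ k - v)) - F (u - dl *+ k)| <= C * L (u - dl *+ k).
    by apply: h3; rewrite ler0_norm ?subr_le0// opprB lerBlDl ltW.
  rewrite (_ : u - dl *+ k + (dl *+ k - v) = u - v) in h4; last by ring.
  split; last first.
    exists (v - dl *+ k); split; first by rewrite subr_ge0.
      by rewrite ltrBlDl.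
    rewrite (_ : u - v + (v - dl *+ k) = u - dl *+ k); last by ring.
    by rewrite (le_trans h1)// ler_wpM2r ?(ltW Lu)// thk.
  have -> : F (u - v) - F u = (F (u - v) - F (u - dl *+ k)) + (F (u - dl *+ k) - F u) by ring.
  rewrite (le_trans (ler_normD _ _))//.
  apply: (@le_trans _ _ (A * th ^+ k * L u)); last first.
    by rewrite ler_wpM2r ?(ltW Lu)// ler_wpM2l ?(ltW A0)// thk.
  have : C * L (u - dl *+ k) <= C * (th ^+ k * L u) by rewrite ler_wpM2l// ltW.
  by rewrite /A; lra.
have [M hM] := F_bnd U.
have M0 : 0 <= M by rewrite (le_trans _ (hM U (lexx U))).
(* A descent from [u] in steps of [dl] stops within [dl] above [U], so a positive lower bound of [L]
   on that interval is needed. [L] may be discontinuous; the continuous function [g], comparable to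
   [L] by the de Haan property at shift 1, attains its minimum instead. *)
have [m [m0 hm]] : exists m : R, 0 < m /\ forall w : R, 0 <= w -> w < dl -> m <= L (U + w).
  pose g (w : R) := F (U + 1 + w) - F (U + w).
  have cg : {within `[0, dl], continuous g}.
    apply: continuous_subspaceT => w; apply: cvgB.
      exact: F_shift.
    exact: F_shift.
  have [c c01 hc] := EVT_min (ltW dl0) cg.
  have gL (w : R) : 0 <= w -> L (U + w) / 2 <= g w /\ g w <= 2 * L (U + w).
    move=> w0; have Uw : U <= U + w by rewrite lerDl.
    have [_ _ _ /sl4[Lw]] := UE _ Uw.
    rewrite mul1r (addrAC U w 1) -/(g w) ler_norml => /andP[a b]; split; lra.
  move: c01; rewrite in_itv/= => /andP[c0 c1].
  exists (g c / 2); split.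
    have [h _] := gL _ c0; have := Lpos (U + c); rewrite lerDl => /(_ c0) h'; lra.
  move=> w w0 wdl; have [_ h] := gL _ w0.
  have := hc w; rewrite in_itv/= w0 (ltW wdl) => /(_ isT); lra.
have Mm0 : 0 <= 2 * M / m by rewrite divr_ge0 ?mulr_ge0// ltW.
(* Below [U] an increment of [F] is at most [2 * M], and [m <= exp (|v| / 2) * L u] brings this
   constant into the required form. *)
exists (A + 2 * M / m), U; split; first by rewrite ltr_wpDr.
move=> u Uu; have Lu := Lpos _ Uu; split => // v.
have big (w : R) : `|F (u + w) - F u| <= A * expR (`|w| / 2) * L u ->
   `|F (u + w) - F u| <= (A + 2 * M / m) * expR (`|w| / 2) * L u.
  move=> h; apply: (le_trans h); rewrite ler_wpM2r ?(ltW Lu)// ler_wpM2r ?expR_ge0//.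
  by rewrite lerDl.
have [v0|v0] := leP 0 v; first by apply: big; rewrite (ger0_norm v0); exact: up.
have v0' : 0 <= - v by rewrite oppr_ge0 ltW.
have [Uv|Uv] := leP U (u + v).
  apply: big; have [] := @down u (- v) v0'; first by rewrite opprK.
  by rewrite opprK (ltr0_norm v0).
have uU : 0 <= u - U by rewrite subr_ge0.
have [|h [w [w0 wdl hw]]] := @down u (u - U) uU; first by rewrite opprB addrCA subrr addr0.
rewrite (_ : u - (u - U) = U) in h hw; last by ring.
have e1 : expR ((u - U) / 2) <= expR (`|v| / 2).
  by rewrite ler_expR ler_wpM2r// (ltr0_norm v0); lra.
have -> : F (u + v) - F u = (F (u + v) - F U) + (F U - F u) by ring.
rewrite (le_trans (ler_normD _ _))//.
have h1 : `|F (u + v) - F U| <= 2 * M.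
  rewrite (le_trans (ler_normB _ _))//.
  have := hM _ (ltW Uv); have := hM U (lexx U); lra.
have h2 : m <= expR (`|v| / 2) * L u.
  rewrite (le_trans (hm w w0 wdl))// (le_trans hw)// ler_wpM2r// ltW//.
have h3 : A * expR ((u - U) / 2) * L u <= A * (expR (`|v| / 2) * L u).
  by rewrite -mulrA ler_wpM2l ?(ltW A0)// ler_wpM2r// ltW.
have h4 : 2 * M <= 2 * M / m * (expR (`|v| / 2) * L u).
  have : 2 * M / m * m <= 2 * M / m * (expR (`|v| / 2) * L u) by rewrite ler_wpM2l.
  by rewrite divfK// gt_eqF.
by rewrite -mulrA; lra.
Qed.

End deHaan_bound.

Section potter.
Context {R : realType}.
Variables f l : R -> R.
Hypotheses (cf : continuous f) (f0 : forall x, 0 <= f x).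
Hypotheses (sl : slowly_varying l) (hf : deHaan l f).

Lemma cvg_expR_pinfty : @expR R u @[u --> +oo] --> +oo.
Proof.
apply/cvgryPge => A; near=> u.
apply: (@le_trans _ _ u); first by near: u; apply: nbhs_pinfty_ge; exact: num_real.
by rewrite (le_trans _ (expR_ge1Dx _))// lerDr.
Unshelve. all: by end_near. Qed.

(** The substitution [x = exp u] turns dilations into shifts. Boundedness to the left holds because
    [f] is continuous on the compact interval [[0, exp U]]. *)
Lemma potter : exists C X : R, [/\ 0 < C, 0 < X & forall x, X <= x ->
  [/\ 0 < l x, l x <= 2 * f x & forall a, 0 < a ->
    `|f (a * x) - f x| <= C * expR (`|ln a| / 2) * l x]].
Proof.
pose F (u : R) := f (expR u); pose L (u : R) := l (expR u).
have L0 : exists a : R, forall u, a <= u -> 0 < L u.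
  have [[a ha] _] := sl; exists `|a| => u au; apply: ha.
  apply: (le_trans (ler_norm a)); apply: (le_trans au).
  by rewrite (le_trans _ (expR_ge1Dx _))// lerDr.
have Ls (v : R) : L (u + v) / L u @[u --> +oo] --> (1 : R).
  rewrite (_ : (fun u => L (u + v) / L u) = (fun x => l (expR v * x) / l x) \o expR).
    exact: (cvg_comp _ _ cvg_expR_pinfty (sl.2 (expR v) (expR_gt0 v))).
  by apply/funext => u; rewrite /L /= expRD (mulrC (expR v)).
have Fh (v : R) : (F (u + v) - F u) / L u @[u --> +oo] --> v.
  rewrite (_ : (fun u => (F (u + v) - F u) / L u) =
      (fun x => (f (expR v * x) - f x) / l x) \o expR).
    have := cvg_comp _ _ cvg_expR_pinfty (hf.2 (expR v) (expR_gt0 v)).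
    by rewrite expRK.
  by apply/funext => u; rewrite /F /L /= expRD (mulrC (expR v)).
have Fc : continuous F.
  by move=> u; apply: continuous_comp; [exact: continuous_expR|exact: cf].
have Fb (U : R) : exists M : R, forall u, u <= U -> `|F u| <= M.
  have [|c _ hc] := @EVT_max R f 0 (expR U) (expR_ge0 U).
    exact: continuous_subspaceT.
  exists (f c) => u uU; rewrite ger0_norm; last exact: f0.
  apply: (hc (expR u)).
  by rewrite in_itv/= expR_ge0 ler_expR.
have [C [U [C0 H]]] := deHaan_potter L0 Ls Fh Fc Fb.
have h12 : (0 : R) < 1 / 2 by rewrite divr_gt0.
(* The shift by [-1] gives [f x - f (x / e) >= l x / 2], and [f >= 0] then yields [l <= 2 f]; this
   is what makes [t * l] tend to 0 with [t * psi]. *)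
have [U' H'] := deHaan_near L0 Fh (-1) h12.
exists C, (expR (Num.max U U')); split => //; first exact: expR_gt0.
move=> x Xx; have x0 : 0 < x by apply: lt_le_trans Xx; exact: expR_gt0.
have : Num.max U U' <= ln x by rewrite -ler_expR lnK.
rewrite ge_max => /andP[/H[Lx h1] /H'[_ h2]].
have Fx : F (ln x) = f x by rewrite /F lnK.
have Lxx : L (ln x) = l x by rewrite /L lnK.
rewrite Lxx in Lx h1 h2; split => //.
  move: h2; rewrite Fx ler_norml => /andP[_]; have := f0 (expR (ln x - 1)).
  by rewrite /F; lra.
move=> a a0; have := h1 (ln a).
by rewrite Fx /F expRD !lnK// mulrC.
Qed.

End potter.

(** The first bound provides a majorant, the second a linearisation with relative error [a + b];
    both rest on [exp y >= 1 + y]. *)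
Lemma expR_diff_bounds {R : realType} (a b : R) : 0 <= a -> 0 <= b ->
  `|expR (- a) - expR (- b)| <= `|b - a| /\
  `|expR (- a) - expR (- b) - (b - a)| <= `|b - a| * (a + b).
Proof.
wlog ab : a b / a <= b.
  move=> H a0 b0; have [ab|/ltW ba] := leP a b; first exact: H.
  have [h1 h2] := H _ _ ba b0 a0; split.
    by rewrite distrC (distrC b).
  have -> : expR (- a) - expR (- b) - (b - a) = - (expR (- b) - expR (- a) - (a - b)) by ring.
  by rewrite normrN (distrC b) (addrC a b).
move=> a0 b0.
have ba : 0 <= b - a by rewrite subr_ge0.
have e1 : expR (- a) <= 1 by rewrite -expR0 ler_expR oppr_le0.
have e2 : expR (- b) <= 1 by rewrite -expR0 ler_expR oppr_le0.
have e3 : 1 - b <= expR (- b) by have := expR_ge1Dx (- b); lra.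
have d1 : expR (- a) - expR (- b) = expR (- b) * (expR (b - a) - 1).
  by rewrite mulrBr -expRD mulr1; congr (expR _ - _); ring.
have d2 : expR (- a) - expR (- b) = expR (- a) * (1 - expR (- (b - a))).
  by rewrite mulrBr -expRD mulr1; congr (_ - expR _); ring.
have lo : expR (- b) * (b - a) <= expR (- a) - expR (- b).
  by rewrite d1 ler_wpM2l ?expR_ge0//; have := expR_ge1Dx (b - a); lra.
have hi : expR (- a) - expR (- b) <= b - a.
  rewrite d2; have h : 1 - expR (- (b - a)) <= b - a by have := expR_ge1Dx (- (b - a)); lra.
  have h0 : 0 <= 1 - expR (- (b - a)) by rewrite subr_ge0 -expR0 ler_expR oppr_le0.
  by apply: le_trans h; rewrite ler_piMl.
have lo0 : 0 <= expR (- b) * (b - a) by rewrite mulr_ge0// expR_ge0.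
rewrite (ger0_norm ba); split; rewrite ler_norml.
  by apply/andP; split; [apply: le_trans (le_trans lo0 lo); rewrite oppr_le0|].
have : (1 - b) * (b - a) <= expR (- b) * (b - a) by rewrite ler_wpM2r.
have : 0 <= (b - a) * a by rewrite mulr_ge0.
have : 0 <= (b - a) * b by rewrite mulr_ge0.
move=> *; apply/andP; split; lra.
Qed.

(** * Convergence of Laplace transforms and of masses of annuli *)

Section gamma_density_bounds.
Context {R : realType}.
Implicit Types c s : R.

Lemma integrable_gamma_density c : 0 < c ->
  (@lebesgue_measure R).-integrable setT (EFin \o gamma_density c).
Proof.
move=> c0; apply/integrableP; split.
  by apply/measurable_EFinP; exact: measurable_gamma_density.
under eq_integral do rewrite /= ger0_norm ?gamma_density_ge0//.
exact: gamma_density_lty.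
Qed.

Lemma gamma_density_shift c e s : 0 < s ->
  s `^ e * gamma_density c s = gamma_density (c + e) s.
Proof.
move=> s0; rewrite /gamma_density s0 mulrA -powRD; last by rewrite (gt_eqF s0) implybT.
by congr (_ `^ _ * _); ring.
Qed.

(** Turns the Potter majorant into a sum of powers, which merely shift the Gamma parameter by
    [gamma_density_shift]. *)
Lemma expR_norm_ln s : 0 < s -> expR (`|ln s| / 4) <= s `^ (1 / 4) + s `^ (- (1 / 4)).
Proof.
move=> s0; rewrite /powR gt_eqF//.
have [l0|l0] := leP 0 (ln s).
  rewrite ger0_norm//; apply: (@le_trans _ _ (expR (1 / 4 * ln s))).
    by rewrite ler_expR; lra.
  by rewrite lerDl expR_ge0.
rewrite ltr0_norm//; apply: (@le_trans _ _ (expR (- (1 / 4) * ln s))).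
  by rewrite ler_expR; lra.
by rewrite lerDr expR_ge0.
Qed.

Lemma ln_sqrt s : 0 < s -> ln (Num.sqrt s) = ln s / 2.
Proof. by move=> s0; rewrite -powR12_sqrt ?(ltW s0)// ln_powR mulrC. Qed.

End gamma_density_bounds.

(** * Differences of Laplace transforms by dominated convergence *)

Section laplace_differences.
Context {R : realType}.
Local Notation leb := (@lebesgue_measure R).
Variables (psi l : R -> R) (t_ r_ : nat -> R) (C c : R).
Hypotheses (t_gt0 : forall n, 0 < t_ n) (c4 : 1 / 4 < c).
Hypotheses (psi0 : forall x, 0 <= psi x) (mpsi : measurable_fun setT psi).
Local Notation l_ n := (l (r_ n)^-1).
Local Notation psi_ n := (psi (r_ n)^-1).
Hypothesis l_gt0 : forall n, 0 < l_ n.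
Hypothesis l_psi : forall n, l_ n <= 2 * psi_ n.
Hypothesis psi_potter : forall n (a : R), 0 < a ->
  `|psi (a * (r_ n)^-1) - psi_ n| <= C * expR (`|ln a| / 2) * l_ n.
Hypothesis psi_haan : forall a : R, 0 < a ->
  (psi (a * (r_ n)^-1) - psi_ n) / l_ n @[n --> \oo] --> ln a.
Hypothesis tpsi0 : t_ n * psi_ n @[n --> \oo] --> (0 : R).

Local Notation tau n := (t_ n * l_ n).
Lemma tau_gt0 n : 0 < tau n. Proof. by rewrite mulr_gt0. Qed.

Lemma tau_cvg0 : tau n @[n --> \oo] --> (0 : R).
Proof.
apply: (@squeeze_cvgr _ _ _ _ (cst 0) (fun n => 2 * (t_ n * psi_ n))).
- by apply: nearW => n; rewrite ltW ?tau_gt0//= mulrCA ler_pM2l.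
- exact: cvg_cst.
- by rewrite -(mulr0 2); apply: cvgM => //; exact: cvg_cst.
Qed.

Definition haan_quotient (a : R) n := (psi (a * (r_ n)^-1) - psi_ n) / l_ n.
Local Notation D := haan_quotient.

Lemma tpsiE a n : t_ n * psi (a * (r_ n)^-1) = t_ n * psi_ n + tau n * D a n.
Proof.
by rewrite /D [_ / l_ n]mulrC mulrA mulfK ?gt_eqF// mulrBr addrC subrK.
Qed.

Lemma tpsi_cvg0 a : 0 < a -> t_ n * psi (a * (r_ n)^-1) @[n --> \oo] --> (0 : R).
Proof.
move=> a0; rewrite (_ : (fun n => _) = (fun n => t_ n * psi_ n + tau n * D a n)); last first.
  by apply/funext => n; exact: tpsiE.
rewrite -[X in _ --> X](addr0 0) -[X in _ --> _ + X](mul0r (ln a)).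
apply: cvgD => //; apply: cvgM; first exact: tau_cvg0.
exact: psi_haan.
Qed.

Definition laplace_term (k : R) n (s : R) : R := expR (- (t_ n * psi (2 * Num.sqrt k * (r_ n)^-1 * Num.sqrt s))).
Local Notation q := laplace_term.
Definition arg_scale (k s : R) : R := 2 * Num.sqrt k * Num.sqrt s.

Local Notation a_ := arg_scale.
Lemma a_gt0 k s : 0 < k -> 0 < s -> 0 < a_ k s.
Proof. by move=> k0 s0; rewrite !mulr_gt0// sqrtr_gt0. Qed.

Lemma qE k n s : q k n s = expR (- (t_ n * psi (a_ k s * (r_ n)^-1))).
Proof. by rewrite /q /a_ mulrAC. Qed.

Lemma ln_a k s : 0 < k -> 0 < s -> ln (a_ k s) = ln 2 + ln k / 2 + ln s / 2.
Proof.
move=> k0 s0; rewrite /a_ lnM ?posrE ?mulr_gt0 ?sqrtr_gt0//.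
by rewrite lnM ?posrE ?sqrtr_gt0// !ln_sqrt.
Qed.

Lemma tpsi_ge0 a n : 0 <= t_ n * psi a.
Proof. by rewrite mulr_ge0// ltW. Qed.

Lemma q_diff k k' n s : `|(q k n s - q k' n s) / tau n| <= `|D (a_ k' s) n - D (a_ k s) n| /\
  `|(q k n s - q k' n s) / tau n - (D (a_ k' s) n - D (a_ k s) n)| <=
  `|D (a_ k' s) n - D (a_ k s) n| *
    (t_ n * psi (a_ k s * (r_ n)^-1) + t_ n * psi (a_ k' s * (r_ n)^-1)).
Proof.
have T0 := tau_gt0 n.
have [] := expR_diff_bounds (tpsi_ge0 (a_ k s * (r_ n)^-1) n) (tpsi_ge0 (a_ k' s * (r_ n)^-1) n).
rewrite -!qE.
set A := t_ n * _; set B := t_ n * _.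
have E : A - B = tau n * (D (a_ k' s) n - D (a_ k s) n).
  by rewrite /A /B !tpsiE opprD addrACA subrr add0r -mulrBr.
rewrite E => h1 h2; split.
  rewrite normrM normfV (gtr0_norm T0) ler_pdivrMr//.
  by move: h1; rewrite normrM (gtr0_norm T0) mulrC.
have gen (x y T : R) : T != 0 -> x / T - y = (x - T * y) / T by move=> T1; field.
rewrite gen ?gt_eqF//.
rewrite normrM normfV (gtr0_norm T0) ler_pdivrMr//.
by move: h2; rewrite normrM (gtr0_norm T0) => /le_trans; apply; rewrite -mulrA mulrC.
Qed.

(** The terms [ln 2] and [ln s / 2] of [ln (a_ k s)] cancel between [k] and [k'], so the limit is
    free of [s]. *)
Lemma q_diff_cvg k k' s : 0 < k -> 0 < k' -> 0 < s ->
  (q k n s - q k' n s) / tau n @[n --> \oo] --> (ln k' - ln k) / 2.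
Proof.
move=> k0 k'0 s0.
have Dc : D (a_ k' s) n - D (a_ k s) n @[n --> \oo] --> (ln k' - ln k) / 2.
  have -> : (ln k' - ln k) / 2 = ln (a_ k' s) - ln (a_ k s) by rewrite !ln_a//; ring.
  by apply: cvgB; apply: psi_haan; exact: a_gt0.
have Z : `|D (a_ k' s) n - D (a_ k s) n| *
    (t_ n * psi (a_ k s * (r_ n)^-1) + t_ n * psi (a_ k' s * (r_ n)^-1)) @[n --> \oo] --> (0 : R).
  rewrite -[X in _ --> X](mulr0 (`|(ln k' - ln k) / 2|)); apply: cvgM; first exact: cvg_norm.
  by rewrite -[X in _ --> X](addr0 0); apply: cvgD; apply: tpsi_cvg0; exact: a_gt0.
rewrite (_ : (fun n => _) = (fun n => ((q k n s - q k' n s) / tau n - (D (a_ k' s) n - D (a_ k s) n))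
    + (D (a_ k' s) n - D (a_ k s) n))); last by apply/funext => n; rewrite subrK.
rewrite -[X in _ --> X]add0r; apply: cvgD => //.
apply: norm_cvg0; apply: (@squeeze_cvgr _ _ _ _ (cst 0) _ _ _ _ _ Z); last exact: cvg_cst.
by apply: nearW => n; rewrite normr_ge0/=; case: (q_diff k k' n s).
Qed.

Definition potter_cst (k : R) : R := C * expR (`|ln 2 + ln k / 2| / 2).

Local Notation cst_ := potter_cst.
(** [ln (a_ k s)] contains [ln s / 2], which halves the Potter rate to [1 / 4]; the remaining terms
    go into the constant. *)
Lemma D_bound k n s : 0 < k -> 0 < s -> `|D (a_ k s) n| <= cst_ k * (s `^ (1 / 4) + s `^ (- (1 / 4))).
Proof.
move=> k0 s0; have := psi_potter n (a_gt0 k0 s0); rewrite -ler_pdivrMr//.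
rewrite /D normrM normfV (gtr0_norm (l_gt0 n)) => /le_trans; apply.
have C0 : 0 <= C.
  have := psi_potter n ltr01; rewrite ln1 normr0 mul0r expR0 mulr1 => /(le_trans (normr_ge0 _)).
  by rewrite pmulr_lge0.
rewrite /potter_cst -mulrA ler_wpM2l//.
apply: (@le_trans _ _ (expR (`|ln 2 + ln k / 2| / 2) * expR (`|ln s| / 4))).
  rewrite -expRD ler_expR ln_a//.
  have := ler_normD (ln 2 + ln k / 2) (ln s / 2).
  have -> : `|ln s / 2| = `|ln s| / 2 by rewrite normrM normfV (ger0_norm (ler0n _ 2)).
  by lra.
by rewrite ler_wpM2l ?expR_ge0// expR_norm_ln.
Qed.

Let c0 : 0 < c. Proof. by apply: lt_trans c4; rewrite divr_gt0. Qed.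
Local Notation gd := (gamma_density c).

Lemma measurable_q k n : measurable_fun setT (q k n).
Proof.
apply: measurableT_comp => //; apply: measurableT_comp => //.
apply: measurable_funM => //; apply: measurableT_comp => //; apply: measurable_funM => //.
by apply: continuous_measurable_fun; exact: sqrt_continuous.
Qed.

Lemma q01 k n s : 0 <= q k n s <= 1.
Proof. by rewrite expR_ge0 -expR0 ler_expR oppr_le0 tpsi_ge0. Qed.

Lemma integrable_qg k n : leb.-integrable setT (EFin \o (fun s => q k n s * gd s)).
Proof.
apply: (le_integrable _ _ _ (integrable_gamma_density c0)) => //.
  apply/measurable_EFinP; apply: measurable_funM; first exact: measurable_q.
  exact: measurable_gamma_density.
move=> s _ /=; have /andP[q0 q1] := q01 k n s.
by rewrite lee_fin normrM ger0_norm// ler_piMl.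
Qed.

Definition laplace (k : R) n : R := \int[leb]_s (q k n s * gd s).

(** The majorant is a multiple of the Gamma densities of parameters [c + 1/4] and [c - 1/4], the
    latter positive by [c4]. *)
Lemma laplace_diff_cvg k k' : 0 < k -> 0 < k' ->
  (laplace k n - laplace k' n) / tau n @[n --> \oo] --> (ln k' - ln k) / 2 * Gamma c.
Proof.
move=> k0 k'0.
pose f_ n (s : R) : \bar R := ((q k n s - q k' n s) / tau n * gd s)%:E.
pose f (s : R) : \bar R := ((ln k' - ln k) / 2 * gd s)%:E.
pose g (s : R) : \bar R := ((cst_ k + cst_ k')%:E *
  (gamma_density (c + 1 / 4) s + gamma_density (c + - (1 / 4)) s)%:E)%E.
have mgd : measurable_fun setT gd by exact: measurable_gamma_density.
have [_ _ Cv] : [/\ leb.-integrable setT f,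
    [sequence \int[leb]_s `|f_ n s - f s|]_n%E @ \oo --> 0%E &
    [sequence \int[leb]_s f_ n s]_n%E @ \oo --> (\int[leb]_s f s)%E].
  apply: (@dominated_convergence _ _ _ leb setT measurableT f_ f g).
  - move=> n; apply/measurable_EFinP; apply: measurable_funM => //.
    by apply: measurable_funM => //; apply: measurable_funB; exact: measurable_q.
  - by apply/measurable_EFinP; exact: measurable_funM.
  - apply: aeW => s _; have [s0|s0] := ltP 0 s; last first.
      have E : gd s = 0 by rewrite /gamma_density ltNge s0.
      rewrite /f E mulr0; apply: cvg_near_cst; apply: nearW => n.
      by rewrite /f_ E mulr0.
    apply: cvg_EFin; first exact: nearW.
    rewrite (_ : _ \o _ = (fun n => (q k n s - q k' n s) / tau n * gd s))//.
    by apply: cvgM; [exact: q_diff_cvg|exact: cvg_cst].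
  - apply: integrableZl => //.
    under eq_fun do rewrite EFinD.
    by apply: integrableD => //; apply: integrable_gamma_density; rewrite ?subr_gt0// addr_gt0// divr_gt0.
  - apply: aeW => s n _; rewrite /f_ /g -EFinM lee_fin.
    have [s0|s0] := ltP 0 s; last first.
      by rewrite /gamma_density ltNge s0 mulr0 normr0 addr0 mulr0.
    rewrite -!gamma_density_shift// -mulrDl mulrA normrM.
    rewrite (ger0_norm (gamma_density_ge0 _ _)) ler_wpM2r ?gamma_density_ge0//.
    have [h _] := q_diff k k' n s; apply: (le_trans h).
    by rewrite (le_trans (ler_normB _ _))// mulrDl addrC lerD//; exact: D_bound.
have Ef : (\int[leb]_s f s = ((ln k' - ln k) / 2 * Gamma c)%:E)%E.
  rewrite EFinM -integral_gamma_density// -integralZl//; last exact: integrable_gamma_density.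
have Ef_ n : (\int[leb]_s f_ n s = ((laplace k n - laplace k' n) / tau n)%:E)%E.
  have i1 := integrable_qg k n; have i2 := integrable_qg k' n.
  have i3 : leb.-integrable setT (EFin \o (fun s => q k n s * gd s - q k' n s * gd s)).
    by rewrite /comp; under eq_fun do rewrite EFinB; exact: integrableB.
  transitivity (\int[leb]_s ((tau n)^-1%:E * (q k n s * gd s - q k' n s * gd s)%:E))%E.
    by apply: eq_integral => s _; rewrite /f_ -EFinM -mulrBl mulrA (mulrC (_ - _)).
  rewrite integralZl// -[X in (_ * X)%E]fineK; last exact: integrable_fin_num.
  by rewrite -EFinM -[fine _]/(Rintegral _ _ _) RintegralB// mulrC.
have H : EFin \o (fun n => (laplace k n - laplace k' n) / tau n) @ \oo --> ((ln k' - ln k) / 2 * Gamma c)%:E.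
  by rewrite -Ef; move: Cv; rewrite (_ : [sequence _]_n = EFin \o (fun n => (laplace k n - laplace k' n) / tau n))//; apply/funext.
exact: (fine_cvg H).
Qed.

End laplace_differences.

(** * The limit measure and its moments *)

Section exponential_limit.
Context {R : realType}.
Local Notation leb := (@lebesgue_measure R).

Lemma Gamma1 : Gamma (1 : R) = 1.
Proof.
rewrite /Gamma integral_itv_obnd_cbnd; last first.
  apply/measurable_EFinP; apply: measurable_funTS; apply: measurable_funM => //.
  exact: measurableT_comp.
rewrite (_ : (\int[leb]_(x in `[0%R, +oo[) (x `^ (1 - 1) * expR (- x))%:E = 1)%E)//.
rewrite -(@integral_exponential_pdf R 1 _)//.
rewrite integral_mkcond; apply: eq_integral => x _.
rewrite /exponential_pdf !patchE; case: ifPn => // _.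
by rewrite subrr powRr0 !mul1r mulN1r.
Qed.

(** The density [exp (- s) / 2] on [s > 0], that is, the weight [s * exp (- s)] times the density
    [1 / (2 s)]. *)
Definition exp_weight (s : R) : R := 1 / 2 * gamma_density 1 s.
Lemma measurable_exp_weight : measurable_fun setT exp_weight.
Proof. by apply: measurable_funM => //; exact: measurable_gamma_density. Qed.
Lemma exp_weight_ge0 s : 0 <= exp_weight s.
Proof. by rewrite mulr_ge0 ?gamma_density_ge0. Qed.

Local Notation M := (wmeasure leb measurable_exp_weight exp_weight_ge0).

Lemma exp_weight_moment k : (\int[leb]_s (phi_max s ^+ k * exp_weight s)%:E = (1 / (2 * k.+1%:R))%:E)%E.
Proof.
transitivity (\int[leb]_s ((1 / 2)%:E * (gamma_density 1 s * expR (- (k%:R * s)))%:E))%E.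
  apply: eq_integral => s _; rewrite -EFinM; congr EFin.
  rewrite /exp_weight mulrCA; congr (_ * _).
  rewrite /gamma_density; case: ifPn => s0; last by rewrite mulr0 mul0r.
  rewrite mulrC /phi_max -expRM_natl; congr (_ * expR _).
  by rewrite (max_idPr (ltW s0)); ring.
rewrite ge0_integralZl; [|exact: measurableT| | |by rewrite lee_fin].
- rewrite integral_gamma_scale// Gamma1 mul1r natr1 powR_inv1// -EFinM; congr EFin.
  by field; rewrite addrC natr1.
- apply/measurable_EFinP; apply: measurable_funM; first exact: measurable_gamma_density.
  by apply: measurableT_comp => //; apply: measurableT_comp => //; exact: measurable_funM.
- by move=> s _; rewrite lee_fin mulr_ge0 ?gamma_density_ge0 ?expR_ge0.
Qed.

Lemma exp_weight_fin : (M setT < +oo)%E.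
Proof.
apply: (@le_lt_trans _ _ (\int[leb]_s (phi_max s ^+ 0 * exp_weight s)%:E)%E).
  rewrite le_eqVlt; apply/orP; left; apply/eqP; apply: eq_integral => x _.
  by rewrite expr0 mul1r.
by rewrite exp_weight_moment ltry.
Qed.

Lemma moment_exp_weight k : moment_of M phi_max k = 1 / (2 * k.+1%:R).
Proof.
rewrite moment_of_wmeasure ?exp_weight_moment//.
- exact: measurable_phi_max.
- by move=> x; exact: expR_ge0.
Qed.

Lemma exp_weight_itv (a b : R) : 0 < a -> a <= b ->
  (b - a) / 2 * expR (- b) <= fine (M (phi_max @^-1` `[expR (- b), expR (- a)])) <=
  (b - a) / 2 * expR (- a).
Proof.
move=> a0 ab.
have -> : phi_max @^-1` `[expR (- b), expR (- a)] = `[a, b]%classic.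
  apply/seteqP; split => s /=; rewrite !in_itv/= /phi_max !ler_expR !lerN2 le_max ge_max.
    by move=> /andP[/andP[_ ->]]; rewrite leNgt a0/= => ->.
  by move=> /andP[-> ->]; rewrite orbT (le_trans (ltW a0) ab).
have E : (M `[a, b]%classic = \int[leb]_(s in `[a, b]) (1 / 2 * expR (- s))%:E)%E.
  apply: eq_integral => s; rewrite inE/= in_itv/= => /andP[as_ _].
  by rewrite /exp_weight /gamma_density (lt_le_trans a0 as_) subrr powRr0 [1 * expR _]mul1r.
have lebE : leb `[a, b]%classic = (b - a)%:E.
  rewrite lebesgue_measure_itv/= lte_fin; move: ab; rewrite le_eqVlt => /predU1P[->|->//].
  by rewrite ltxx subrr.
have me : measurable_fun `[a, b] (fun s : R => (1 / 2 * expR (- s))%:E).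
  apply/measurable_EFinP; apply: measurable_funTS; apply: measurable_funM => //.
  exact: measurableT_comp.
have lo : (((b - a) / 2 * expR (- b))%:E <= M `[a, b]%classic)%E.
  have -> : (((b - a) / 2 * expR (- b))%:E = \int[leb]_(s in `[a, b]) (1 / 2 * expR (- b))%:E)%E.
    by rewrite integral_cst// [X in (_ * X)%E]lebE -EFinM; congr EFin; ring.
  rewrite E; apply: ge0_le_integral => //.
  by move=> s /=; rewrite in_itv/= => /andP[_ sb]; rewrite lee_fin ler_pM2l// ler_expR lerN2.
have hi : (M `[a, b]%classic <= ((b - a) / 2 * expR (- a))%:E)%E.
  have -> : (((b - a) / 2 * expR (- a))%:E = \int[leb]_(s in `[a, b]) (1 / 2 * expR (- a))%:E)%E.
    by rewrite integral_cst// [X in (_ * X)%E]lebE -EFinM; congr EFin; ring.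
  rewrite E; apply: ge0_le_integral => //.
  by move=> s /=; rewrite in_itv/= => /andP[sa _]; rewrite lee_fin ler_pM2l// ler_expR lerN2.
have f : M `[a, b]%classic \is a fin_num.
  by rewrite ge0_fin_numE//; apply: (le_lt_trans hi); rewrite ltry.
by apply/andP; split; rewrite -lee_fin fineK.
Qed.

End exponential_limit.

(** [A] and [B] stand for the difference quotients that bracket [h * x]. Up to [h * e / 4] they are
    half-increments of [ln], and [h <= k / 2] with [h <= e * k^2 / 2] puts [1 / (2 (k - h))] and
    [1 / (2 (k + h))] within [e / 2] of [1 / (2 k)]. *)
Lemma log_diff_bound {R : realType} (k e h A B x : R) : 0 < k -> 0 < e -> 0 < h ->
  h <= k / 2 -> h <= e * k ^+ 2 / 2 ->
  A <= (ln k - ln (k - h)) / 2 + h * e / 4 ->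
  (ln (k + h) - ln k) / 2 - h * e / 4 <= B ->
  B <= h * x -> h * x <= A -> `|1 / (2 * k) - x| <= e.
Proof.
move=> k0 e0 h0 h1 h2 C1 C2 B1 B2.
have hk : h < k by lra.
have kh : 0 < k - h by rewrite subr_gt0.
have kh' : 0 < k + h by rewrite addr_gt0.
have l1 : ln k - ln (k - h) <= h / (k - h).
  rewrite -ln_div ?posrE//.
  have -> : k / (k - h) = 1 + h / (k - h) by field; rewrite gt_eqF.
  by apply: le_ln1Dx; apply: (@lt_trans _ _ 0); rewrite ?oppr_lt0// divr_gt0.
have l2 : h / (k + h) <= ln (k + h) - ln k.
  rewrite -[X in _ <= X]opprB lerNr -ln_div ?posrE//.
  have -> : k / (k + h) = 1 + - (h / (k + h)) by field; rewrite gt_eqF.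
  by apply: le_ln1Dx; rewrite ltrN2 ltr_pdivrMr// mul1r ltrDr.
have u1 : h * x <= h * (1 / (2 * (k - h)) + e / 4).
  have -> : h * (1 / (2 * (k - h)) + e / 4) = h / (k - h) / 2 + h * e / 4.
    by field; rewrite gt_eqF.
  by lra.
have u2 : h * (1 / (2 * (k + h)) - e / 4) <= h * x.
  have -> : h * (1 / (2 * (k + h)) - e / 4) = h / (k + h) / 2 - h * e / 4.
    by field; rewrite gt_eqF.
  by lra.
rewrite ler_pM2l// in u1; rewrite ler_pM2l// in u2.
have k2 : 0 < k ^+ 2 by rewrite exprn_gt0.
have v1 : 1 / (2 * (k - h)) <= 1 / (2 * k) + e / 2.
  have : 1 / (2 * (k - h)) - 1 / (2 * k) = h / (2 * k * (k - h)).
    by field; rewrite !gt_eqF.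
  have : h / (2 * k * (k - h)) <= e / 2.
    rewrite ler_pdivrMr ?mulr_gt0//; rewrite expr2 in h2; nra.
  by lra.
have v2 : 1 / (2 * k) - e / 4 <= 1 / (2 * (k + h)).
  have : 1 / (2 * k) - 1 / (2 * (k + h)) = h / (2 * k * (k + h)).
    by field; rewrite !gt_eqF.
  have : h / (2 * k * (k + h)) <= e / 4.
    rewrite ler_pdivrMr ?mulr_gt0//; rewrite expr2 in h2; nra.
  by lra.
by rewrite ler_norml; apply/andP; split; lra.
Qed.

(** * From Laplace transforms to masses of annuli *)

Section annuli.
Context {R : realType} (dT : measure_display) (T : measurableType dT).
Local Notation leb := (@lebesgue_measure R).
Variables (mu_ : nat -> {measure set T -> \bar R}) (s_ : nat -> T -> R) (tau : nat -> R).
Hypotheses (mu_lty : forall n, (mu_ n setT < +oo)%E) (s_ge0 : forall n x, 0 <= s_ n x).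
Hypotheses (ms : forall n, measurable_fun setT (s_ n)) (tau_gt0 : forall n, 0 < tau n).

Definition lap (k : R) n : R := \int[mu_ n]_x expR (- (k * s_ n x)).
Hypothesis lap_diff_cvg : forall k k' : R, 0 < k -> 0 < k' ->
  (lap k n - lap k' n) / tau n @[n --> \oo] --> (ln k' - ln k) / 2.

(** Minus the derivative of [lap] in [k]. *)
Definition lap1 (k : R) n : R := \int[mu_ n]_x (s_ n x * expR (- (k * s_ n x))).

Lemma measurable_lap k n : measurable_fun setT (fun x => expR (- (k * s_ n x))).
Proof. by apply: measurableT_comp => //; apply: measurableT_comp => //; exact: measurable_funM. Qed.

Lemma integrable_lap (k : R) n : 0 <= k ->
  (mu_ n).-integrable setT (EFin \o (fun x => expR (- (k * s_ n x)))).
Proof.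
move=> k0; apply: (@integrable_bounded01 _ _ _ (mu_ n) _ _ 1) => //.
- exact: measurable_lap.
- by move=> x; rewrite ger0_norm ?expR_ge0// -expR0 ler_expR oppr_le0 mulr_ge0.
Qed.

Lemma le_lap1 (k : R) n x : 0 < k -> s_ n x * expR (- (k * s_ n x)) <= k^-1.
Proof.
move=> k0; rewrite expRN ler_pdivrMr ?expR_gt0// ler_pdivlMl//.
by apply: (le_trans _ (expR_ge1Dx _)); rewrite lerDr.
Qed.

Lemma integrable_lap1 (k : R) n : 0 < k ->
  (mu_ n).-integrable setT (EFin \o (fun x => s_ n x * expR (- (k * s_ n x)))).
Proof.
move=> k0; apply: (@integrable_bounded01 _ _ _ (mu_ n) _ _ k^-1) => //.
- by apply: measurable_funM => //; exact: measurable_lap.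
- by move=> x; rewrite ger0_norm ?mulr_ge0 ?expR_ge0// le_lap1.
Qed.

(* Convexity of [k |-> exp (- k s)] brackets the derivative of [lap] by difference quotients. *)
Lemma lap1_bounds (k h : R) n : 0 < h -> h < k ->
  lap k n - lap (k + h) n <= h * lap1 k n <= lap (k - h) n - lap k n.
Proof.
move=> h0 hk; have k0 := lt_trans h0 hk.
have i1 := integrable_lap n (ltW k0).
have i2 : (mu_ n).-integrable setT (EFin \o (fun x => expR (- ((k + h) * s_ n x)))).
  by apply: integrable_lap; rewrite addr_ge0 ?ltW.
have i3 : (mu_ n).-integrable setT (EFin \o (fun x => expR (- ((k - h) * s_ n x)))).
  by apply: integrable_lap; rewrite subr_ge0 ltW.
have i4 := integrable_lap1 n k0.
rewrite /lap1 /lap -!RintegralB// -RintegralZl//.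
have i5 : (mu_ n).-integrable setT (EFin \o (fun x => h * (s_ n x * expR (- (k * s_ n x))))).
  by rewrite /comp; under eq_fun do rewrite EFinM; exact: integrableZl.
apply/andP; split; apply: le_Rintegral => //.
- by rewrite /comp; under eq_fun do rewrite EFinB; exact: integrableB.
- move=> x _; have -> : - ((k + h) * s_ n x) = - (k * s_ n x) - h * s_ n x by ring.
  rewrite expRD -[X in X - _]mulr1 -mulrBr mulrA mulrC ler_wpM2r ?expR_ge0//.
  by have := expR_ge1Dx (- (h * s_ n x)); lra.
- by rewrite /comp; under eq_fun do rewrite EFinB; exact: integrableB.
- move=> x _; have -> : - ((k - h) * s_ n x) = - (k * s_ n x) + h * s_ n x by ring.
  rewrite expRD -[X in _ - X]mulr1 -mulrBr mulrA mulrC ler_wpM2l ?expR_ge0//.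
  by have := expR_ge1Dx (h * s_ n x); lra.
Qed.

(** The step [h] is fixed in terms of [e] before [n] grows, so pointwise convergence of the
    differences is enough; the limit is the derivative of [ln k / 2]. *)
Lemma lap1_cvg (k : R) : 0 < k -> lap1 k n / tau n @[n --> \oo] --> 1 / (2 * k).
Proof.
move=> k0; apply/cvgrPdist_le => e e0.
pose h := Num.min (k / 2) (e * k ^+ 2 / 2).
have h0 : 0 < h by rewrite lt_min !divr_gt0 ?mulr_gt0// exprn_gt0.
have h1 : h <= k / 2 by rewrite ge_min lexx.
have h2 : h <= e * k ^+ 2 / 2 by rewrite ge_min lexx orbT.
have hk : h < k by lra.
have kh : 0 < k - h by rewrite subr_gt0.
have kh' : 0 < k + h by rewrite addr_gt0.
have he : 0 < h * e / 4 by rewrite divr_gt0// mulr_gt0.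
have c1 : \forall n \near \oo, (lap (k - h) n - lap k n) / tau n <= (ln k - ln (k - h)) / 2 + h * e / 4.
  by move/cvgr_le : (lap_diff_cvg kh k0); apply; rewrite ltrDl.
have c2 : \forall n \near \oo, (ln (k + h) - ln k) / 2 - h * e / 4 <= (lap k n - lap (k + h) n) / tau n.
  by move/cvgr_ge : (lap_diff_cvg k0 kh'); apply; rewrite ltrBlDr ltrDl.
near=> n.
have C1 : (lap (k - h) n - lap k n) / tau n <= (ln k - ln (k - h)) / 2 + h * e / 4 by near: n.
have C2 : (ln (k + h) - ln k) / 2 - h * e / 4 <= (lap k n - lap (k + h) n) / tau n by near: n.
have /andP[b1 b2] := lap1_bounds n h0 hk.
have T0 := tau_gt0 n.
have B1 : (lap k n - lap (k + h) n) / tau n <= h * (lap1 k n / tau n).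
  by rewrite mulrA ler_wpM2r// invr_ge0 ltW.
have B2 : h * (lap1 k n / tau n) <= (lap (k - h) n - lap k n) / tau n.
  by rewrite mulrA ler_wpM2r// invr_ge0 ltW.
set x := lap1 k n / tau n in B1 B2 *.
exact: (@log_diff_bound _ _ _ _ _ _ _ k0 e0 h0 h1 h2 C1 C2 B1 B2).
Unshelve. all: by end_near. Qed.

(* The unweighted limit of [mu_ n / tau n] is [ds / (2 s)], which is infinite near 0. *)
Definition ann_weight n (x : T) : R := s_ n x * expR (- s_ n x) / tau n.
Lemma measurable_ann_weight n : measurable_fun setT (ann_weight n).
Proof.
apply: measurable_funM => //; apply: measurable_funM => //.
by apply: measurableT_comp => //; exact: measurableT_comp.
Qed.
Lemma ann_weight_ge0 n x : 0 <= ann_weight n x.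
Proof. by rewrite divr_ge0 ?mulr_ge0 ?expR_ge0// ltW. Qed.

Definition ann_measure n : {measure set T -> \bar R} :=
  wmeasure (mu_ n) (measurable_ann_weight n) (ann_weight_ge0 n).
Definition ann_phi n (x : T) : R := expR (- s_ n x).
Lemma measurable_ann_phi n : measurable_fun setT (ann_phi n).
Proof. by apply: measurableT_comp => //; exact: measurableT_comp. Qed.
Lemma ann_phi01 n x : 0 <= ann_phi n x <= 1.
Proof. by rewrite /ann_phi expR_ge0/= -[leRHS]expR0 ler_expR oppr_le0. Qed.

(** The weight has its own factor [exp (- s)], whence the shift to [k + 1]; it keeps the argument of
    [lap1] positive even for the total mass. *)
Lemma ann_moment k n : moment_of (ann_measure n) (ann_phi n) k = lap1 k.+1%:R n / tau n.
Proof.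
rewrite moment_of_wmeasure; [|exact: measurable_ann_phi|by move=> x; exact: expR_ge0].
rewrite -[RHS]mulrC /lap1 -RintegralZl//; last exact: integrable_lap1.
rewrite /Rintegral; congr fine; apply: eq_integral => x _; congr EFin.
rewrite /ann_phi /ann_weight -expRM_natl [LHS]mulrA mulrCA mulrA -[X in X / _]mulrA.
rewrite [RHS]mulrC; congr (_ * _ / _); rewrite -expRD; congr expR.
by rewrite -natr1; ring.
Qed.

Lemma ann_fin n : (ann_measure n setT < +oo)%E.
Proof.
rewrite /ann_measure/= /wmeasure.
apply: (@integrable_lty _ _ _ (mu_ n) setT measurableT).
have := integrable_lap1 n ltr01; rewrite /comp /ann_weight.
under [X in _ -> integrable _ _ X]eq_fun do rewrite mulrC EFinM.
move=> H; apply: integrableZl => //.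
rewrite (_ : (fun x => _) = (fun x => (s_ n x * expR (- (1 * s_ n x)))%:E))//.
by apply/funext => x; rewrite mul1r.
Qed.

Let moments_cvg k : moment_of (ann_measure n) (ann_phi n) k @[n --> \oo] -->
  moment_of (wmeasure leb (@measurable_exp_weight R) (@exp_weight_ge0 R)) phi_max k.
Proof.
rewrite moment_exp_weight.
rewrite (_ : (fun n => _) = (fun n => lap1 k.+1%:R n / tau n)); last first.
  by apply/funext => n; exact: ann_moment.
exact: lap1_cvg.
Qed.

Definition annulus (a b : R) n : set T := [set x | a <= s_ n x <= b].

Lemma annulusE a b n : annulus a b n = ann_phi n @^-1` `[expR (- b), expR (- a)].
Proof.
by apply/seteqP; split => x; rewrite /annulus /ann_phi/= in_itv/= !ler_expR !lerN2 andbC.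
Qed.

Lemma measurable_annulus a b n : measurable (annulus a b n).
Proof. by rewrite annulusE; apply: measurable_phi_itv; exact: measurable_ann_phi. Qed.

Lemma fin_mu n A : measurable A -> mu_ n A \is a fin_num.
Proof.
move=> mA; rewrite ge0_fin_numE//; apply: (le_lt_trans _ (mu_lty n)).
by rewrite le_measure ?inE.
Qed.

(** Removes the weight: on a thin annulus [s * exp (- s)] is nearly constant. *)
Lemma ann_measure_bounds (a b : R) n : 0 < a -> a <= b ->
  a * expR (- b) * (fine (mu_ n (annulus a b n)) / tau n) <= fine (ann_measure n (annulus a b n)) <=
  b * expR (- a) * (fine (mu_ n (annulus a b n)) / tau n).
Proof.
move=> a0 ab; have mA := measurable_annulus a b n.
have b0 := lt_le_trans a0 ab.
have cstE (c : R) : (\int[mu_ n]_(x in annulus a b n) (c / tau n)%:E =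
    (c * (fine (mu_ n (annulus a b n)) / tau n))%:E)%E.
  rewrite integral_cst// -[X in (_ * X)%E](fineK (fin_mu n mA)) -EFinM.
  by rewrite mulrAC -mulrA.
have mw : measurable_fun (annulus a b n) (fun x => (ann_weight n x)%:E).
  by apply: measurable_funTS; apply/measurable_EFinP; exact: measurable_ann_weight.
have Ti : 0 <= (tau n)^-1 by rewrite invr_ge0 ltW.
have lo : ((a * expR (- b) * (fine (mu_ n (annulus a b n)) / tau n))%:E <= ann_measure n (annulus a b n))%E.
  rewrite -cstE; apply: ge0_le_integral => //.
  - by move=> x _; rewrite lee_fin !mulr_ge0 ?expR_ge0 ?(ltW a0).
  - move=> x /andP[h1 h2]; rewrite lee_fin ler_wpM2r// ler_pM// ?expR_ge0 ?(ltW a0)//.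
    by rewrite ler_expR lerN2.
have hi : (ann_measure n (annulus a b n) <= (b * expR (- a) * (fine (mu_ n (annulus a b n)) / tau n))%:E)%E.
  rewrite -cstE; apply: ge0_le_integral => //.
  - by move=> x _; rewrite lee_fin ann_weight_ge0.
  - move=> x /andP[h1 h2]; rewrite lee_fin ler_wpM2r// ler_pM// ?expR_ge0//.
    by rewrite ler_expR lerN2.
have f : ann_measure n (annulus a b n) \is a fin_num.
  by rewrite ge0_fin_numE//; apply: (le_lt_trans hi); rewrite ltry.
by apply/andP; split; rewrite -lee_fin fineK.
Qed.

(** [exp (- s)] reverses order, so [[a, b]] becomes [[exp (- b), exp (- a)]]; the margins to [a']
    and [b'] are those required by [moment_cvg_le]. *)
Lemma annulus_le (a' a b b' e : R) : 0 < a' -> a' < a -> a <= b -> b < b' -> 0 < e ->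
  \forall n \near \oo, a * expR (- b) * (fine (mu_ n (annulus a b n)) / tau n) <=
    (b' - a') / 2 * expR (- a') + e.
Proof.
move=> a'0 a'a ab bb' e0.
have e1 : expR (- b') < expR (- b) by rewrite ltr_expR ltrN2.
have e2 : expR (- a) < expR (- a') by rewrite ltr_expR ltrN2.
have H := moment_cvg_le ann_fin measurable_ann_phi ann_phi01 exp_weight_fin
  (@measurable_phi_max R) (@phi_max01 R) moments_cvg e1 e2 e0.
near=> n.
have /andP[h1 _] := ann_measure_bounds n (lt_trans a'0 a'a) ab.
apply: (le_trans h1); rewrite annulusE.
have : fine (ann_measure n (ann_phi n @^-1` `[expR (- b), expR (- a)])) <=
  fine (wmeasure leb (@measurable_exp_weight R) (@exp_weight_ge0 R)
     (phi_max @^-1` `[expR (- b'), expR (- a')])) + e by near: n.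
move=> /le_trans; apply; rewrite lerD2r.
by have /andP[] := exp_weight_itv a'0 (ltW (lt_trans a'a (le_lt_trans ab bb'))).
Unshelve. all: by end_near. Qed.

Lemma annulus_ge (a a' b' b e : R) : 0 < a -> a < a' -> a' <= b' -> b' < b -> 0 < e ->
  \forall n \near \oo, (b' - a') / 2 * expR (- b') - e <=
    b * expR (- a) * (fine (mu_ n (annulus a b n)) / tau n).
Proof.
move=> a0 aa' a'b' b'b e0.
have e1 : expR (- b) < expR (- b') by rewrite ltr_expR ltrN2.
have e2 : expR (- a') < expR (- a) by rewrite ltr_expR ltrN2.
have H := moment_cvg_ge ann_fin measurable_ann_phi ann_phi01 exp_weight_fin
  (@measurable_phi_max R) (@phi_max01 R) moments_cvg e1 e2 e0.
near=> n.
have /andP[_ h1] := ann_measure_bounds n a0 (ltW (lt_trans aa' (le_lt_trans a'b' b'b))).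
apply: (le_trans _ h1); rewrite annulusE.
have : fine (wmeasure leb (@measurable_exp_weight R) (@exp_weight_ge0 R)
     (phi_max @^-1` `[expR (- b'), expR (- a')])) - e <=
  fine (ann_measure n (ann_phi n @^-1` `[expR (- b), expR (- a)])) by near: n.
apply: le_trans; rewrite lerD2r.
by have /andP[] := exp_weight_itv (lt_trans a0 aa') a'b'.
Unshelve. all: by end_near. Qed.

End annuli.

(** * From annuli to the density *)

Section radial_densities.
Context {R : realType}.
Local Notation leb := (@lebesgue_measure R).
Variables (d : nat) (lam : {measure set (d.-tuple R) -> \bar R}).
Hypotheses (hd : (0 < d)%N) (hl : is_lebesgue_Rd lam).

Definition sq_annulus (a b : R) : set (d.-tuple R) := [set x | a <= dotp x x <= b].

Lemma measurable_sq_annulus a b : measurable (sq_annulus a b).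
Proof.
rewrite (_ : sq_annulus a b = setT `&` (fun x : d.-tuple R => dotp x x) @^-1` `[a, b]%classic).
  by apply: measurable_sq => //; exact: measurable_itv.
by apply/seteqP; split => x; rewrite /sq_annulus /= in_itv/= => //; case.
Qed.

Lemma sq_annulus_nonzero a b : 0 < a -> sq_annulus a b `<=` Rd_nonzero d.
Proof.
by move=> a0 x /andP[h _]; rewrite /Rd_nonzero/= enorm_gt0 (lt_le_trans a0 h).
Qed.

(** Polar coordinates are applied to the indicator times [exp s], which cancels the Gaussian factor
    on both sides. *)
Lemma lebesgue_sq_annulusE (a b : R) : 0 < a ->
  (lam (sq_annulus a b) = \int[leb]_(s in `[a, b]) (@polar_cst R d * s `^ (d%:R / 2 - 1))%:E)%E.
Proof.
move=> a0; pose G (s : R) : R := \1_`[a, b] s * expR s.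
have mG : measurable_fun setT G by apply: measurable_funM => //; exact: measurable_indic.
have G0 s : 0 <= G s by rewrite mulr_ge0 ?expR_ge0.
transitivity (\int[lam]_x (\1_(sq_annulus a b) x)%:E)%E.
  by rewrite integral_indic ?setIT//; exact: measurable_sq_annulus.
transitivity (\int[lam]_x (G (dotp x x) * expR (- dotp x x))%:E)%E.
  apply: eq_integral => x _; rewrite /G -mulrA -expRD subrr expR0 mulr1 !indicE.
  by congr (_ %:R%:E); congr nat_of_bool; apply/idP/idP; rewrite !inE /sq_annulus/= in_itv.
rewrite (@polar _ _ lam hd hl _ mG G0) [RHS]integral_mkcond.
apply: eq_integral => s _; rewrite patchE /G indicE; case: ifPn => sab; last by rewrite !mul0r.
move: sab; rewrite inE/= in_itv/= => /andP[as_ _].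
rewrite mul1r /polar_w /gamma_density (lt_le_trans a0 as_); congr EFin.
by rewrite mulrCA [expR _ * _]mulrCA -expRD subrr expR0 mulr1.
Qed.

(** Writing [s^(d/2 - 1)] as [sqrt s^d / s] and bounding numerator and denominator separately avoids
    a case distinction on the sign of [d/2 - 1]. *)
Lemma lebesgue_sq_annulus_bounds (a b : R) : 0 < a -> a <= b ->
  ((@polar_cst R d * (Num.sqrt a ^+ d / b) * (b - a))%:E <= lam (sq_annulus a b))%E /\
  (lam (sq_annulus a b) <= (@polar_cst R d * (Num.sqrt b ^+ d / a) * (b - a))%:E)%E.
Proof.
move=> a0 ab; rewrite lebesgue_sq_annulusE//.
have c0 : 0 <= @polar_cst R d by rewrite ltW// (polar_cst_gt0 hd).
have b0 := lt_le_trans a0 ab.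
have lebE : leb `[a, b]%classic = (b - a)%:E.
  rewrite lebesgue_measure_itv/= lte_fin; move: ab; rewrite le_eqVlt => /predU1P[->|->//].
  by rewrite ltxx subrr.
have cstE (k : R) : ((k * (b - a))%:E = \int[leb]_(s in `[a, b]) k%:E)%E.
  by rewrite integral_cst// [X in (_ * X)%E]lebE -EFinM.
have mf : measurable_fun `[a, b] (fun s : R => (@polar_cst R d * s `^ (d%:R / 2 - 1))%:E).
  apply/measurable_EFinP; apply: measurable_funTS; exact: measurable_funM.
have powE (s : R) : 0 < s -> s `^ (d%:R / 2 - 1) = Num.sqrt s ^+ d / s.
  move=> s0; rewrite powRD; last by rewrite (gt_eqF s0) implybT.
  by rewrite powR_inv1 ?(ltW s0)// sqrtX_powR// ltW.
split; rewrite cstE; apply: ge0_le_integral => //.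
- move=> s _; rewrite lee_fin.
  exact: mulr_ge0 c0 (divr_ge0 (exprn_ge0 _ (sqrtr_ge0 _)) (ltW b0)).
- move=> s /=; rewrite in_itv/= => /andP[as_ sb]; have s0 := lt_le_trans a0 as_.
  rewrite lee_fin ler_wpM2l// powE// ler_pM ?exprn_ge0 ?sqrtr_ge0 ?invr_ge0 ?(ltW b0)//.
    by rewrite lerXn2r ?nnegrE ?sqrtr_ge0// ler_wsqrtr.
  by rewrite lef_pV2.
- by move=> s _; rewrite lee_fin mulr_ge0// powR_ge0.
- move=> s /=; rewrite in_itv/= => /andP[as_ sb]; have s0 := lt_le_trans a0 as_.
  rewrite lee_fin ler_wpM2l// powE// ler_pM ?exprn_ge0 ?sqrtr_ge0 ?invr_ge0 ?(ltW s0)//.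
    by rewrite lerXn2r ?nnegrE ?sqrtr_ge0// ler_wsqrtr.
  by rewrite lef_pV2.
Qed.

Lemma measurable_radial_nonincr (f : d.-tuple R -> R) : radial_nonincr f ->
  measurable_fun (Rd_nonzero d) f.
Proof.
move=> hf.
apply: (eq_measurable_fun ((fun r => f (radial_pt d r)) \o (fun x : d.-tuple R => enorm x))).
  move=> x; rewrite inE => x0 /=; symmetry; apply: radialE => //.
  by rewrite enorm_radial_pt// ger0_norm// enorm_ge0.
apply: (@measurable_comp _ _ _ _ _ _ (`]0, +oo[%classic : set R)) => //.
- by move=> _ [x x0 <-]; rewrite /= in_itv/= andbT.
- apply: nonincreasing_in_measurable => //; first exact: interval_is_interval.
  move=> x y /=; rewrite !in_itv/= !andbT => x0 y0 xy.
  by apply: hf.2; rewrite !enorm_radial_pt// !gtr0_norm.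
- by apply: measurable_funTS; exact: measurable_enorm.
Qed.

Variables (mu : {measure set (d.-tuple R) -> \bar R}) (f : d.-tuple R -> R).
Hypotheses (hf : radial_nonincr f) (muT : (mu setT < +oo)%E).
Hypothesis hmu : forall A, measurable A -> A `<=` Rd_nonzero d ->
  mu A = (\int[lam]_(x in A) (f x)%:E)%E.

Let mu_fin A : measurable A -> mu A \is a fin_num.
Proof.
move=> mA; rewrite ge0_fin_numE//; apply: (le_lt_trans _ muT).
by rewrite le_measure ?inE.
Qed.

(** Monotonicity puts [f] above [f x] inside the sphere through [x], so the volume bound applies.
    The power of [sqrt (1 - e)] it produces is weakened to one of [1 - e], sufficient as [e] tends
    to 0. *)
Lemma mass_inner_annulus (x : d.-tuple R) (e : R) : 0 < enorm x -> 0 < e -> e < 1 ->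
  f x * enorm x ^+ d * (@polar_cst R d * e * (1 - e) ^+ d) <=
  fine (mu (sq_annulus ((1 - e) * enorm x ^+ 2) (enorm x ^+ 2))).
Proof.
move=> x0 e0 e1; set r := enorm x in x0 *.
have r2 : 0 < r ^+ 2 by rewrite exprn_gt0.
have e1' : 0 < 1 - e by rewrite subr_gt0.
have a0 : 0 < (1 - e) * r ^+ 2 by rewrite mulr_gt0.
have ab : (1 - e) * r ^+ 2 <= r ^+ 2 by rewrite ger_pMl// lerBlDr lerDl ltW.
have mA := measurable_sq_annulus ((1 - e) * r ^+ 2) (r ^+ 2).
have sA := @sq_annulus_nonzero _ (r ^+ 2) a0.
set A := sq_annulus _ _ in mA sA *.
have fx : 0 <= f x by apply: hf.1.
have [lo _] := lebesgue_sq_annulus_bounds a0 ab.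
rewrite -lee_fin fineK ?mu_fin// hmu//.
apply: (@le_trans _ _ (\int[lam]_(y in A) (f x)%:E)%E); last first.
  apply: ge0_le_integral => //.
  - by apply/measurable_EFinP; apply: measurable_funS (measurable_radial_nonincr hf) => //;
      exact: measurable_Rd_nonzero.
  - move=> y Ay; rewrite lee_fin; apply: hf.2; first exact: sA.
    by rewrite -/r -(@ler_pXn2r _ 2)// ?nnegrE ?enorm_ge0 ?(ltW x0)// (sqr_enorm y); case/andP: Ay.
rewrite integral_cst//; apply: le_trans; last by apply: lee_wpmul2l lo; rewrite lee_fin.
rewrite -EFinM lee_fin -mulrA ler_wpM2l//.
have c0e := mulr_ge0 (ltW (@polar_cst_gt0 R _ hd)) (ltW e0).
have -> : @polar_cst R d * (Num.sqrt ((1 - e) * r ^+ 2) ^+ d / r ^+ 2) * (r ^+ 2 - (1 - e) * r ^+ 2) =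
  r ^+ d * (@polar_cst R d * e * Num.sqrt (1 - e) ^+ d).
  rewrite sqrtrM ?(ltW e1')// sqrtr_sqr gtr0_norm// exprMn.
  have rn : r ^+ 2 != 0 by rewrite gt_eqF.
  by move: (Num.sqrt _ ^+ d) (r ^+ d) (r ^+ 2) rn (@polar_cst R d) => u v w wn c; field.
rewrite ler_wpM2l ?exprn_ge0 ?(ltW x0)// ler_wpM2l//.
rewrite lerXn2r ?nnegrE ?sqrtr_ge0 ?(ltW e1')//.
by rewrite -[leLHS]gtr0_norm// -sqrtr_sqr ler_wsqrtr// expr2 ger_pMl// lerBlDr lerDl ltW.
Qed.

(** Outside the sphere [f] lies below [f x], and [sqrt (1 + e) <= 1 + e]. *)
Lemma mass_outer_annulus (x : d.-tuple R) (e : R) : 0 < enorm x -> 0 < e ->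
  fine (mu (sq_annulus (enorm x ^+ 2) ((1 + e) * enorm x ^+ 2))) <=
  f x * enorm x ^+ d * (@polar_cst R d * e * (1 + e) ^+ d).
Proof.
move=> x0 e0; set r := enorm x in x0 *.
have r2 : 0 < r ^+ 2 by rewrite exprn_gt0.
have e1' : 0 < 1 + e by rewrite addr_gt0.
have ab : r ^+ 2 <= (1 + e) * r ^+ 2 by rewrite ler_pMl// lerDl ltW.
have mA := measurable_sq_annulus (r ^+ 2) ((1 + e) * r ^+ 2).
have sA := @sq_annulus_nonzero _ ((1 + e) * r ^+ 2) r2.
set A := sq_annulus _ _ in mA sA *.
have fx : 0 <= f x by apply: hf.1.
have [_ hi] := lebesgue_sq_annulus_bounds r2 ab.
rewrite -lee_fin fineK ?mu_fin// hmu//.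
apply: (@le_trans _ _ (\int[lam]_(y in A) (f x)%:E)%E).
  apply: ge0_le_integral => //.
  - by move=> y Ay; rewrite lee_fin; apply: hf.1; exact: sA.
  - by apply/measurable_EFinP; apply: measurable_funS (measurable_radial_nonincr hf) => //;
      exact: measurable_Rd_nonzero.
  - move=> y Ay; rewrite lee_fin; apply: hf.2 => //.
    by rewrite -/r -(@ler_pXn2r _ 2)// ?nnegrE ?enorm_ge0 ?(ltW x0)// (sqr_enorm y); case/andP: Ay.
rewrite integral_cst//; apply: le_trans; first by apply: lee_wpmul2l hi; rewrite lee_fin.
rewrite -EFinM lee_fin -[leRHS]mulrA ler_wpM2l//.
have c0e := mulr_ge0 (ltW (@polar_cst_gt0 R _ hd)) (ltW e0).
have -> : @polar_cst R d * (Num.sqrt ((1 + e) * r ^+ 2) ^+ d / r ^+ 2) * ((1 + e) * r ^+ 2 - r ^+ 2) =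
  r ^+ d * (@polar_cst R d * e * Num.sqrt (1 + e) ^+ d).
  rewrite sqrtrM ?(ltW e1')// sqrtr_sqr gtr0_norm// exprMn.
  have rn : r ^+ 2 != 0 by rewrite gt_eqF.
  by move: (Num.sqrt _ ^+ d) (r ^+ d) (r ^+ 2) rn (@polar_cst R d) => u v w wn c; field.
rewrite ler_wpM2l ?exprn_ge0 ?(ltW x0)// ler_wpM2l//.
rewrite lerXn2r ?nnegrE ?sqrtr_ge0 ?(ltW e1')//.
by rewrite -[leRHS]gtr0_norm// -sqrtr_sqr ler_wsqrtr// expr2 ler_pMl// lerDl ltW.
Qed.

End radial_densities.

(** * The two-parameter squeeze and its explicit bounds *)

Section squeeze.
Context {R : realType}.

Lemma cvg_parametric_squeeze (y : nat -> R) (L U : R -> R) (a c : R) : 0 < c ->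
  L e @[e --> 0^'+] --> a -> U e @[e --> 0^'+] --> a ->
  (forall e, 0 < e < c -> \forall n \near \oo, L e <= y n <= U e) ->
  y n @[n --> \oo] --> a.
Proof.
move=> c0 La Ua h; apply/cvgrPdist_le => e e0.
have [d [d0 dc Ld Ud]] : exists d, [/\ 0 < d, d < c, a - e <= L d & U d <= a + e].
  near (0 : R)^'+ => d; exists d; split.
  - by near: d; exact: nbhs_right_gt.
  - by near: d; exact: nbhs_right_lt.
  - by near: d; move/cvgr_ge : La; apply; rewrite ltrBlDr ltrDl.
  - by near: d; move/cvgr_le : Ua; apply; rewrite ltrDl.
have d0c : 0 < d < c by rewrite d0.
apply: filterS (h d d0c) => n /andP[h1 h2]; rewrite ler_distlC.
by rewrite (le_trans Ld h1) (le_trans h2 Ud).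
Unshelve. all: by end_near. Qed.

(** This is [annulus_le] at [1 - e - e^2], [1 - e], [1], [1 + e^2] with error [e^2], divided by the
    width [e]: as margins and error are [o(e)], the limit is unaffected. [expR 1] undoes the bound
    [(1 - e) * exp (- 1)] on the weight, and the remaining [1 - e] joins the [d] factors of the
    volume, so that [k] will be [d + 1]. *)
Definition upper_bound (c : R) (k : nat) (e : R) : R :=
  ((1 + 2 * e) / 2 * expR (e + e * e) + expR 1 * e) / (c * (1 - e) ^+ k).
Definition lower_bound (c : R) (k : nat) (e : R) : R :=
  ((1 - 2 * e) / 2 * expR (- (e - e * e)) - expR 1 * e) / (c * (1 + e) ^+ k).

Let cid : (fun e : R => e) @ (0 : R)^'+ --> (0 : R).
Proof. by apply: cvg_at_right_filter; exact: cvg_id. Qed.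

Lemma upper_bound_cvg (c : R) k : 0 < c -> upper_bound c k e @[e --> 0^'+] --> 1 / (2 * c).
Proof.
move=> c0; have -> : 1 / (2 * c) = ((1 + 2 * 0) / 2 * expR (0 + 0 * 0) + expR 1 * 0) / (c * (1 - 0) ^+ k).
  rewrite !mulr0 !addr0 subr0 expR0 expr1n; field; rewrite gt_eqF//.
have ce : expR (e + e * e) @[e --> (0 : R)^'+] --> expR (0 + 0 * 0 : R).
  by apply: continuous_cvg; [exact: continuous_expR|apply: cvgD => //; exact: cvgM].
apply: cvgM.
  apply: cvgD; last by apply: cvgM => //; exact: cvg_cst.
  apply: cvgM => //; apply: cvgM; last exact: cvg_cst.
  by apply: cvgD; [exact: cvg_cst|apply: cvgM => //; exact: cvg_cst].
apply: cvgV; first by rewrite subr0 expr1n mulr1 gt_eqF.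
apply: cvgM; first exact: cvg_cst.
apply: (@continuous_cvg _ _ _ _ _ _ (@GRing.exp R ^~ k)); first exact: exprn_continuous.
by apply: cvgB => //; exact: cvg_cst.
Qed.

Lemma lower_bound_cvg (c : R) k : 0 < c -> lower_bound c k e @[e --> 0^'+] --> 1 / (2 * c).
Proof.
move=> c0; have -> : 1 / (2 * c) = ((1 - 2 * 0) / 2 * expR (- (0 - 0 * 0)) - expR 1 * 0) / (c * (1 + 0) ^+ k).
  rewrite !mulr0 !subr0 oppr0 addr0 expR0 expr1n; field; rewrite gt_eqF//.
have ce : expR (- (e - e * e)) @[e --> (0 : R)^'+] --> expR (- (0 - 0 * 0) : R).
  by apply: continuous_cvg; [exact: continuous_expR|apply: cvgN; apply: cvgB => //; exact: cvgM].
apply: cvgM.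
  apply: cvgB; last by apply: cvgM => //; exact: cvg_cst.
  apply: cvgM => //; apply: cvgM; last exact: cvg_cst.
  by apply: cvgB; [exact: cvg_cst|apply: cvgM => //; exact: cvg_cst].
apply: cvgV; first by rewrite addr0 expr1n mulr1 gt_eqF.
apply: cvgM; first exact: cvg_cst.
apply: (@continuous_cvg _ _ _ _ _ _ (@GRing.exp R ^~ k)); first exact: exprn_continuous.
by apply: cvgD => //; exact: cvg_cst.
Qed.

Lemma le_upper_bound (c e y m : R) k : 0 < c -> 0 < e < 1 / 4 ->
  y * (c * e * (1 - e) ^+ k) <= m ->
  (1 - e) * expR (- 1) * m <= ((1 + e * e) - (1 - e - e * e)) / 2 * expR (- (1 - e - e * e)) + e * e ->
  y <= upper_bound c k.+1 e.
Proof.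
move=> c0 /andP[e0 e4] h1 h2.
have e1 : 0 < 1 - e by lra.
have X0 : 0 < expR (1 : R) by exact: expR_gt0.
have p0 : 0 < (1 - e) ^+ k by rewrite exprn_gt0.
rewrite /upper_bound ler_pdivlMr ?mulr_gt0 ?exprn_gt0//.
have E : - (1 - e - e * e) = - 1 + (e + e * e) by ring.
rewrite E expRD expRN in h2.
rewrite -(ler_pM2l e0).
have h3 : (1 - e) * (y * (c * e * (1 - e) ^+ k)) <= (1 - e) * m by rewrite ler_pM2l.
have h4 : (1 - e) * m <= e * ((1 + 2 * e) / 2 * expR (e + e * e) + expR 1 * e).
  move: h2; rewrite -(ler_pM2l X0).
  have -> : expR 1 * ((1 - e) / expR 1 * m) = (1 - e) * m by field; rewrite gt_eqF.
  move=> /le_trans; apply; rewrite le_eqVlt; apply/orP; left; apply/eqP.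
  by move: (expR (e + _)) (expR 1) X0 => u v v0; field; rewrite gt_eqF.
apply: le_trans h4; apply: le_trans h3.
by rewrite exprS le_eqVlt; apply/orP; left; apply/eqP; ring.
Qed.

Lemma ge_lower_bound (c e y m : R) k : 0 < c -> 0 < e < 1 / 4 ->
  m <= y * (c * e * (1 + e) ^+ k) ->
  ((1 + e - e * e) - (1 + e * e)) / 2 * expR (- (1 + e - e * e)) - e * e <= (1 + e) * expR (- 1) * m ->
  lower_bound c k.+1 e <= y.
Proof.
move=> c0 /andP[e0 e4] h1 h2.
have e1 : 0 < 1 + e by lra.
have X0 : 0 < expR (1 : R) by exact: expR_gt0.
have p0 : 0 < (1 + e) ^+ k by rewrite exprn_gt0.
rewrite /lower_bound ler_pdivrMr ?mulr_gt0 ?exprn_gt0//.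
have E : - (1 + e - e * e) = - 1 + - (e - e * e) by ring.
rewrite E expRD [expR (-1)]expRN in h2.
rewrite -(ler_pM2l e0).
have h3 : (1 + e) * m <= (1 + e) * (y * (c * e * (1 + e) ^+ k)) by rewrite ler_pM2l.
have h4 : e * ((1 - 2 * e) / 2 * expR (- (e - e * e)) - expR 1 * e) <= (1 + e) * m.
  move: h2; rewrite -(ler_pM2l X0).
  have -> : expR 1 * ((1 + e) / expR 1 * m) = (1 + e) * m by field; rewrite gt_eqF.
  apply: le_trans; rewrite le_eqVlt; apply/orP; left; apply/eqP.
  by move: (expR (- (e - _))) (expR 1) X0 => u v v0; field; rewrite gt_eqF.
apply: (le_trans h4); apply: (le_trans h3).
by rewrite exprS le_eqVlt; apply/orP; left; apply/eqP; ring.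
Qed.

End squeeze.

(** * The density along the given sequences *)

Section density_limit.
Context {R : realType}.
Local Notation leb := (@lebesgue_measure R).
Variables (d : nat) (lam : {measure set (d.-tuple R) -> \bar R}) (nu : d.-tuple R -> R).
Variables (mu : R -> probability (d.-tuple R) R) (p : R -> d.-tuple R -> R) (l : R -> R).
Hypotheses (hd : (0 < d)%N) (hl : is_lebesgue_Rd lam) (hnu : radial_nonincr nu).
Hypothesis hmu : forall t, 0 < t -> forall xi : d.-tuple R,
     (\int[mu t]_x (cos (dotp xi x))%:E
        = (expR (- (t * lk_exponent lam nu xi)))%:E)%E /\
     (\int[mu t]_x (sin (dotp xi x))%:E = 0)%E.
Hypothesis hp : forall t, 0 < t -> radial_nonincr (p t).
Hypothesis hmup : forall t, 0 < t -> forall A, measurable A -> A `<=` Rd_nonzero d ->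
     mu t A = (\int[lam]_(x in A) (p t x)%:E)%E.
Variables (t_ : nat -> R) (x_ : nat -> d.-tuple R) (C : R).
Hypotheses (t_gt0 : forall n, 0 < t_ n) (x_gt0 : forall n, 0 < enorm (x_ n)).
Local Notation r_ := (fun n => enorm (x_ n)).
Local Notation l_ n := (l (enorm (x_ n))^-1).
Local Notation psi := (psi lam nu).
Local Notation psi_ n := (psi (enorm (x_ n))^-1).
Hypotheses (l_gt0 : forall n, 0 < l_ n) (l_psi : forall n, l_ n <= 2 * psi_ n).
Hypothesis psi_potter : forall n (a : R), 0 < a ->
  `|psi (a * (r_ n)^-1) - psi_ n| <= C * expR (`|ln a| / 2) * l_ n.
Hypothesis psi_haan : forall a : R, 0 < a ->
  (psi (a * (r_ n)^-1) - psi_ n) / l_ n @[n --> \oo] --> ln a.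
Hypothesis tpsi0 : t_ n * psi_ n @[n --> \oo] --> (0 : R).

Definition law n : {measure set (d.-tuple R) -> \bar R} := mu (t_ n).
(** Scaled so that the sphere through [x_ n] is the level set [s = 1]. *)
Definition rel_sq n (x : d.-tuple R) : R := dotp x x / enorm (x_ n) ^+ 2.
Definition jump_rate n : R := t_ n * l_ n.

Lemma rel_sq_ge0 n x : 0 <= rel_sq n x.
Proof. by rewrite divr_ge0 ?dotpp_ge0 ?sqr_ge0. Qed.

Lemma measurable_rel_sq n : measurable_fun setT (rel_sq n).
Proof. by apply: measurable_funM => //; exact: measurable_sq. Qed.

Lemma jump_rate_gt0 n : 0 < jump_rate n. Proof. exact: mulr_gt0. Qed.

Lemma law_lty n : (law n setT < +oo)%E. Proof. exact: mu_lty. Qed.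

Let d2 : 0 < d%:R / 2 :> R. Proof. by rewrite divr_gt0// ltr0n. Qed.
Let d4 : 1 / 4 < d%:R / 2 :> R.
Proof. by rewrite ltr_pdivlMr// (@lt_le_trans _ _ 1)// ?ler1n//; lra. Qed.
Let mpsi : measurable_fun setT psi.
Proof. by apply: continuous_measurable_fun; exact: continuous_psi hmu. Qed.

Lemma lap_law (k : R) n : 0 < k ->
  lap law rel_sq k n = (Gamma (d%:R / 2))^-1 * laplace psi t_ r_ (d%:R / 2) k n.
Proof.
move=> k0; have r0 := x_gt0 n.
(* This value of [rho] makes [rho^2 / 4] equal to [k / r^2], the rate of the Laplace transform in
   [rel_sq]. *)
have rho0 : 0 < 2 * Num.sqrt k * (r_ n)^-1 by rewrite !mulr_gt0 ?sqrtr_gt0// invr_gt0.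
have := subordination hd hl hnu hmu (t_gt0 n) rho0.
have -> : (2 * Num.sqrt k * (enorm (x_ n))^-1) ^+ 2 / 4 = k / enorm (x_ n) ^+ 2.
  rewrite !exprMn sqr_sqrtr ?(ltW k0)// exprVn.
  by move: (enorm _ ^+ 2)^-1 => w; field.
move=> H; rewrite /lap /Rintegral.
rewrite (_ : (\int[law n]_x _ = \int[mu (t_ n)]_x (expR (- (k / enorm (x_ n) ^+ 2 * dotp x x)))%:E)%E); last first.
  by apply: eq_integral => x _; rewrite /rel_sq [k / _ * _]mulrAC -mulrA.
by rewrite H fineM// (integrable_fin_num measurableT (integrable_qg r_ t_gt0 d4 (psi_ge0 lam hnu) mpsi k n)).
Qed.

Lemma lap_law_diff_cvg (k k' : R) : 0 < k -> 0 < k' ->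
  (lap law rel_sq k n - lap law rel_sq k' n) / jump_rate n @[n --> \oo] --> (ln k' - ln k) / 2.
Proof.
move=> k0 k'0.
have G0 := Gamma_gt0 d2.
have H := laplace_diff_cvg t_gt0 d4 (psi_ge0 lam hnu) mpsi l_gt0 l_psi psi_potter psi_haan tpsi0 k0 k'0.
have -> : (ln k' - ln k) / 2 = (Gamma (d%:R / 2))^-1 * ((ln k' - ln k) / 2 * Gamma (d%:R / 2)) :> R.
  by rewrite [RHS]mulrC mulfK ?gt_eqF.
rewrite (_ : (fun n => _) = (fun n => (Gamma (d%:R / 2))^-1 *
  ((laplace psi t_ r_ (d%:R / 2) k n - laplace psi t_ r_ (d%:R / 2) k' n) / (t_ n * l_ n)))); last first.
  by apply/funext => n; rewrite !lap_law// -mulrBr mulrA.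
by apply: cvgM => //; exact: cvg_cst.
Qed.

Lemma annulus_rel_sq a b n : annulus rel_sq a b n = sq_annulus (a * enorm (x_ n) ^+ 2) (b * enorm (x_ n) ^+ 2).
Proof.
have r2 : 0 < enorm (x_ n) ^+ 2 by rewrite exprn_gt0.
by apply/seteqP; split => x; rewrite /annulus /sq_annulus /rel_sq/= ler_pdivlMr// ler_pdivrMr.
Qed.

Lemma density_bounds (e : R) : 0 < e < 1 / 4 -> \forall n \near \oo,
  lower_bound (polar_cst d) d.+1 e <= p (t_ n) (x_ n) * enorm (x_ n) ^+ d / jump_rate n <=
  upper_bound (polar_cst d) d.+1 e.
Proof.
move=> e04; have /andP[e0 e4] := e04.
have ee : 0 < e * e by rewrite mulr_gt0.
have ee4 : e * e < e / 4 by rewrite ltr_pM2l//; lra.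
have cp := @polar_cst_gt0 R _ hd.
(* Both annuli have width [e] and end at 1, with margins [e^2]; [e < 1/4] keeps the left end
   positive here and the shrunken interval nonempty in [lo]. *)
have hi := @annulus_le _ _ _ law rel_sq jump_rate law_lty rel_sq_ge0 measurable_rel_sq jump_rate_gt0
  lap_law_diff_cvg (1 - e - e * e) (1 - e) 1 (1 + e * e) (e * e) ltac:(lra) ltac:(lra) ltac:(lra) ltac:(lra) ee.
have lo := @annulus_ge _ _ _ law rel_sq jump_rate law_lty rel_sq_ge0 measurable_rel_sq jump_rate_gt0
  lap_law_diff_cvg 1 (1 + e * e) (1 + e - e * e) (1 + e) (e * e) ltac:(lra) ltac:(lra) ltac:(lra) ltac:(lra) ee.
apply: filterS2 hi lo => n hi lo; apply/andP; split.
- apply: ge_lower_bound cp e04 _ lo.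
  rewrite annulus_rel_sq mul1r -[leRHS]mulrAC ler_pM2r ?invr_gt0 ?jump_rate_gt0//.
  exact: (mass_outer_annulus hd hl (hp (t_gt0 n)) (law_lty n) (hmup (t_gt0 n))).
- apply: le_upper_bound cp e04 _ hi.
  rewrite annulus_rel_sq mul1r -[leLHS]mulrAC ler_pM2r ?invr_gt0 ?jump_rate_gt0//.
  apply: (mass_inner_annulus hd hl (hp (t_gt0 n)) (law_lty n) (hmup (t_gt0 n))) => //.
  by apply: (lt_trans e4); lra.
Qed.

Lemma density_cvg : p (t_ n) (x_ n) / (t_ n * enorm (x_ n) ^- d * l_ n)
  @[n --> \oo] --> Gamma (d%:R / 2) / (2 * pi `^ (d%:R / 2)).
Proof.
have cp := @polar_cst_gt0 R _ hd.
have -> : Gamma (d%:R / 2) / (2 * pi `^ (d%:R / 2)) = 1 / (2 * polar_cst d) :> R.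
  have P0 : pi `^ (d%:R / 2) != 0 :> R by rewrite gt_eqF// powR_gt0// pi_gt0.
  have G0 := lt0r_neq0 (Gamma_gt0 d2).
  by rewrite /polar_cst; field; rewrite P0 G0.
rewrite (_ : (fun n => _) = (fun n => p (t_ n) (x_ n) * enorm (x_ n) ^+ d / jump_rate n)); last first.
  apply/funext => n; rewrite /jump_rate mulrAC.
  have rn : enorm (x_ n) ^+ d != 0 by rewrite gt_eqF// exprn_gt0.
  by rewrite [in LHS]invfM invrK mulrA mulrAC.
apply: (@cvg_parametric_squeeze _ _ _ _ _ (1 / 4)) density_bounds => //.
- exact: lower_bound_cvg.
- exact: upper_bound_cvg.
Qed.

End density_limit.

Theorem mainTheorem2 (R : realType) (d : nat) (hd : (0 < d)%N)
  (lam : {measure set (d.-tuple R) -> \bar R})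
  (nu : d.-tuple R -> R)
  (mu : R -> probability (d.-tuple R) R)
  (p : R -> d.-tuple R -> R)
  (l : R -> R) :
  is_lebesgue_Rd lam ->
  (* isotropic unimodal Levy measure *)
  radial_nonincr nu -> levy_density lam nu ->
  (* mu t is the law of X_t: E exp(i<xi,X_t>) = exp(-t psi(xi)) *)
  (forall t, 0 < t -> forall xi : d.-tuple R,
     (\int[mu t]_x (cos (dotp xi x))%:E
        = (expR (- (t * lk_exponent lam nu xi)))%:E)%E /\
     (\int[mu t]_x (sin (dotp xi x))%:E = 0)%E) ->
  (* p t is a radial, radially non-increasing density of mu t on R^d \ {0} *)
  (forall t, 0 < t -> radial_nonincr (p t)) ->
  (forall t, 0 < t -> forall A, measurable A -> A `<=` Rd_nonzero d ->
     mu t A = (\int[lam]_(x in A) (p t x)%:E)%E) ->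
  (* psi in Pi_l, l slowly varying *)
  slowly_varying l ->
  deHaan l (fun r => lk_exponent lam nu (radial_pt d r)) ->
  forall (t_ : nat -> R) (x_ : nat -> d.-tuple R),
    (forall n, 0 < t_ n) -> (forall n, 0 < enorm (x_ n)) ->
    enorm (x_ n) @[n --> \oo] --> 0 ->
    t_ n * lk_exponent lam nu (radial_pt d (enorm (x_ n))^-1) @[n --> \oo] --> 0 ->
    p (t_ n) (x_ n) / (t_ n * (enorm (x_ n)) ^- d * l (enorm (x_ n))^-1)
      @[n --> \oo] --> Gamma (d%:R / 2) / (2 * pi `^ (d%:R / 2)).

Proof.
move=> hl hnu _ hmu hp hmup sl dH t_ x_ t_gt0 x_gt0 x0 tpsi0.
have cpsi := continuous_psi hd hmu.
have [C [X [C0 X0 HX]]] := potter cpsi (psi_ge0 lam hnu) sl dH.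
have rV : (enorm (x_ n))^-1 @[n --> \oo] --> +oo.
  apply/gtr0_cvgV0; first by near=> n; rewrite invr_gt0.
  rewrite (_ : unstable.inv_fun _ = (fun n => enorm (x_ n)))//.
  by apply/funext => n; rewrite /unstable.inv_fun invrK.
have [N _ HN] : \forall n \near \oo, X <= (enorm (x_ n))^-1 by move/cvgryPge : rV; exact.
(* The Potter bound holds only beyond [X]; shifting both sequences by [N] makes it hold at every
   index and leaves the limit unchanged. *)
pose s_ n := t_ (n + N)%N; pose y_ n := x_ (n + N)%N.
have yX n : X <= (enorm (y_ n))^-1 by apply: HN; exact: leq_addl.
have rVy : (enorm (y_ n))^-1 @[n --> \oo] --> +oo.
  by move: rV; rewrite -(cvg_shiftn N).
have yl n : 0 < l (enorm (y_ n))^-1 by have [] := HX _ (yX n).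
have yp n : l (enorm (y_ n))^-1 <= 2 * psi lam nu (enorm (y_ n))^-1 by have [] := HX _ (yX n).
have ya n (a : R) : 0 < a -> `|psi lam nu (a * (enorm (y_ n))^-1) - psi lam nu (enorm (y_ n))^-1| <=
    C * expR (`|ln a| / 2) * l (enorm (y_ n))^-1.
  by move=> a0; have [_ _ /(_ a a0)] := HX _ (yX n).
have yh (a : R) : 0 < a -> (psi lam nu (a * (enorm (y_ n))^-1) - psi lam nu (enorm (y_ n))^-1) /
    l (enorm (y_ n))^-1 @[n --> \oo] --> ln a.
  by move=> a0; have H := dH.2 a a0; exact: (cvg_comp _ _ rVy H).
have y0 : s_ n * psi lam nu (enorm (y_ n))^-1 @[n --> \oo] --> (0 : R).
  rewrite -(cvg_shiftn N (fun n => t_ n * lk_exponent lam nu (radial_pt d (enorm (x_ n))^-1))) in tpsi0.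
  exact: tpsi0.
have := @density_cvg R d lam nu mu p l hd hl hnu hmu hp hmup s_ y_ C
  (fun n => t_gt0 (n + N)%N) (fun n => x_gt0 (n + N)%N) yl yp ya yh y0.
by rewrite -[X in _ -> X](cvg_shiftn N).
Unshelve. all: by end_near. Qed.
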